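(* Let $s>3/2$. A solution $\vec u=(\eta,v)$ of $$\eta_t-\eta_{txx}+v_x+(\eta v)_x=0,\qquad v_t-v_{txx}+\eta_x+vv_x=0,\qquad x\in\mathbb R,\ t\ge0,$$ with initial data $\vec u_0\in X^s$ blows up in finite time $T<\infty$ if and only if $$\liminf_{t\to T}\Big[\inf_{x\in\mathbb R}v_x(t,x)\Big]=-\infty .$$
   Context: $X^s=H^s(\mathbb R)\times H^s(\mathbb R)$ with norm $\|(\eta,v)\|_s=\|\eta\|_{H^s}+\|v\|_{H^s}$. The system is locally well-posed in $X^s$: for each $\vec u_0\in X^s$ there is a unique solution, continuous in time with values in $X^s$, on a maximal interval of existence. In the statement the solution is considered on $[0,T)$ (i.e. $\vec u\in C([0,T),X^s)$), and ''blows up in finite time $T<\infty$'' means that $T$ is its maximal existence time in $X^s$, equivalently $\limsup_{t\to T^-}\|\vec u(t)\|_s=\infty$. The limit is taken as $t\to T$ from below. *)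

(* Defs.v *)
From HB Require Import structures.
From mathcomp Require Import all_boot all_order all_algebra.
From mathcomp Require Import all_classical all_reals all_analysis.
Set Implicit Arguments.
Unset Strict Implicit.
Unset Printing Implicit Defensive.
Import Order.TTheory GRing.Theory Num.Theory.
Import numFieldNormedType.Exports.
Local Open Scope classical_set_scope.
Local Open Scope ring_scope.

Section Sobolev.
Context {R : realType}.
Local Notation mu := (@lebesgue_measure R).

(* Real and imaginary parts of the truncated Fourier integral
   \int_{-n}^{n} f(x) e^{-i x xi} dx of a real-valued f. *)
Definition fourier_trunc_Re (f : R -> R) (n : nat) (xi : R) : R :=
  \int[mu]_(x in `[- n%:R, n%:R]) (f x * cos (x * xi)).
Definition fourier_trunc_Im (f : R -> R) (n : nat) (xi : R) : R :=
  - \int[mu]_(x in `[- n%:R, n%:R]) (f x * sin (x * xi)).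

(* Plancherel: g.1 + i g.2 is the limit in L^2 of the truncated Fourier
   integrals. It determines g up to a null set. *)
Definition is_fourierL2 (f : R -> R) (g : (R -> R) * (R -> R)) : Prop :=
  [/\ g.1 \in Lfun mu 2%:E, g.2 \in Lfun mu 2%:E,
      'N[mu]_2%:E[EFin \o (g.1 \- fourier_trunc_Re f n)%R]%E @[n --> \oo]
        --> (0 : \bar R)
    & 'N[mu]_2%:E[EFin \o (g.2 \- fourier_trunc_Im f n)%R]%E @[n --> \oo]
        --> (0 : \bar R)].

(* Only meaningful for f in L^2 (where the limit exists); every use below is
   guarded by membership in L^2. *)
Definition fourierL2 (f : R -> R) : (R -> R) * (R -> R) :=
  xget (cst 0, cst 0) [set g | is_fourierL2 f g].

(* The factor 1 / (2 pi) makes the transform unitary, so that the H^0 norm is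
   the L^2 norm. *)
Definition fourier_modulus (f : R -> R) (xi : R) : R :=
  Num.sqrt (((fourierL2 f).1 xi ^+ 2 + (fourierL2 f).2 xi ^+ 2) / (2 * pi)).

Definition Hs_norm (s : R) (f : R -> R) : \bar R :=
  'N[mu]_2%:E[EFin \o
     (fun xi => (1 + xi ^+ 2) `^ (s / 2) * fourier_modulus f xi)%R]%E.

(* For s >= 0. Elements are functions, not classes modulo null sets. *)
Definition Hs (s : R) : set (R -> R) :=
  [set f | f \in Lfun mu 2%:E /\ (Hs_norm s f < +oo)%E].

Definition Xs (s : R) : set ((R -> R) * (R -> R)) := Hs s `*` Hs s.

Definition Xs_norm (s : R) (w : (R -> R) * (R -> R)) : \bar R :=
  (Hs_norm s w.1 + Hs_norm s w.2)%E.

End Sobolev.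

Section System.
Context {R : realType}.
Local Notation mu := (@lebesgue_measure R).

Definition test_function (phi : R -> R) : Prop :=
  (forall n x, derivable (derive1n n phi) x 1) /\
  compact (closure [set x | phi x != 0]).

(* u t = (eta(t,.), v(t,.)) lies in C([0,T), X^s). For s > 1/2 each class in
   H^s has a unique continuous representative, which is the one used, so that
   pointwise expressions such as v_x(t,x) make sense. *)
Definition continuous_in_Xs (s T : R) (u : R -> (R -> R) * (R -> R)) : Prop :=
  forall t, 0 <= t < T ->
    [/\ Xs s (u t), continuous (u t).1, continuous (u t).2
      & Xs_norm s (u t' - u t) @[t' --> within `[0, T[ (nbhs t)]
          --> (0 : \bar R)].

(* The system holds in the sense of distributions in x: for every test
   function phi,
     d/dt <eta, phi - phi''> = <v + eta v, phi'>,
     d/dt <v, phi - phi''>   = <eta + v^2/2, phi'>. *)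
Definition weak_system (T : R) (u : R -> (R -> R) * (R -> R)) : Prop :=
  forall phi, test_function phi -> forall t, 0 < t < T ->
    is_derive t 1
      (fun t' => \int[mu]_x ((u t').1 x * (phi x - derive1n 2 phi x)) : R)
      (\int[mu]_x (((u t).2 x + (u t).1 x * (u t).2 x) * derive1 phi x)) /\
    is_derive t 1
      (fun t' => \int[mu]_x ((u t').2 x * (phi x - derive1n 2 phi x)) : R)
      (\int[mu]_x (((u t).1 x + (u t).2 x ^+ 2 / 2) * derive1 phi x)).

Definition is_solution (s T : R) (u0 : (R -> R) * (R -> R))
    (u : R -> (R -> R) * (R -> R)) : Prop :=
  [/\ continuous_in_Xs s T u, weak_system T u,
      {ae mu, forall x, (u 0).1 x = u0.1 x}
    & {ae mu, forall x, (u 0).2 x = u0.2 x}].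

(* T is the maximal existence time in X^s of the solution u on [0,T). *)
Definition blows_up_at (s T : R) (u0 : (R -> R) * (R -> R))
    (u : R -> (R -> R) * (R -> R)) : Prop :=
  ~ exists T' u', [/\ T < T', is_solution s T' u0 u'
                    & forall t, 0 <= t < T -> u' t = u t].

End System.

(* Main.v *)
Require Import Defs.
From mathcomp Require Import all_boot all_order all_algebra.
From mathcomp Require Import all_classical all_reals all_analysis.
From mathcomp Require Import measurable_realfun ring lra.
Import Order.TTheory GRing.Theory Num.Theory.
Import numFieldNormedType.Exports.
Set Implicit Arguments.
Unset Strict Implicit.
Unset Printing Implicit Defensive.
Local Open Scope classical_set_scope.
Local Open Scope ring_scope.

(** On the transform side the system is an ordinary differential equation:
    eta' = - (1 - d^2)^-1 d (v + eta v) and v' = - (1 - d^2)^-1 d (eta + v^2 / 2),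
    where the operator is bounded on H^s and H^s is an algebra. The norm of H^s
    is a weighted L^2 norm of the transform. The kernel cas = cos + sin (Hartley)
    replaces the complex exponential, so that all functions stay real; inversion
    and Parseval come from the Poisson kernels (is_hartley_inv, parseval), and
    Hs_normP identifies the Sobolev norm.

    Suppose that the solution cannot be continued past T and that v_x >= - M near
    T. The H^1 energy E satisfies E' = - c int v_x eta^2 <= M E for a constant
    c > 0 (energy_le), so the H^1 norm stays bounded up to T. The product estimate
    nW_star is tame: in each term one factor is measured in H^1 only. Hence the
    H^s energy N satisfies N' <= C N with C depending on the H^1 bound (tame_le),
    and the H^s norm stays bounded as well (hsol_bounded). The vector field is then
    bounded and the solution is Lipschitz in time, with a limit at T
    (Wcont_limit). Since the vector field is quadratic, the equation has a power
    series solution starting from that limit (local_solution); gluing gives a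
    solution past T (hsol_extend), a contradiction. So the infimum of v_x has
    lower limit minus infinity.

    Conversely, if the solution continues past T then its H^s norm is bounded near
    T, and since s > 3/2 the slope v_x is bounded by the H^s norm (W_L1_dmul).

    The equation is only assumed against test functions. The passage to
    derivatives in H^s is mean_value: the scalar mean value theorem for each test
    function, followed by the density of the transforms of test functions
    (kern_dense), which rests on an explicit smooth bump whose transform is
    bounded below on a given interval. *)

Section Integration.
Context {R : realType}.
Local Notation mu := (@lebesgue_measure R).
Implicit Types (f g h k : R -> R) (c x M C e : R).

(** * Integrable functions on the line *)

Lemma normK x : `|x| ^+ 2 = x ^+ 2.
Proof. by rewrite real_normK ?num_real. Qed.

Definition L1 f : Prop := mu.-integrable [set: R] (EFin \o f).

Lemma ae_S (P Q : R -> Prop) : (forall x, P x -> Q x) ->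
  {ae mu, forall x, P x} -> {ae mu, forall x, Q x}.
Proof. exact: (@filterS _ _ (ae_filter_ringOfSetsType mu) P Q). Qed.

Lemma ae_I (P Q : R -> Prop) : {ae mu, forall x, P x} ->
  {ae mu, forall x, Q x} -> {ae mu, forall x, P x /\ Q x}.
Proof. exact: (@filterI _ _ (ae_filter_ringOfSetsType mu) P Q). Qed.

Lemma L1_measurable f : L1 f -> measurable_fun [set: R] f.
Proof. by move=> /(measurable_int mu)/measurable_EFinP. Qed.

Lemma L1_le f g : measurable_fun [set: R] f -> L1 g ->
  (forall x, `|f x| <= g x) -> L1 f.
Proof.
move=> mf Lg fg; apply: (le_integrable measurableT _ _ Lg).
  exact/measurable_EFinP.
by move=> x _ /=; rewrite lee_fin (le_trans (fg x))// ler_norm.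
Qed.

Lemma eq_L1 f g : f =1 g -> L1 f -> L1 g.
Proof. by move=> /funext ->. Qed.

Lemma L1D f g : L1 f -> L1 g -> L1 (fun x => f x + g x).
Proof. by move=> Lf Lg; exact: (integrableD measurableT Lf Lg). Qed.

Lemma L1B f g : L1 f -> L1 g -> L1 (fun x => f x - g x).
Proof. by move=> Lf Lg; exact: (integrableB measurableT Lf Lg). Qed.

Lemma L1Z c f : L1 f -> L1 (fun x => c * f x).
Proof. by move=> Lf; exact: (integrableZl measurableT c Lf). Qed.

Lemma L10 : L1 (cst 0).
Proof. exact: integrable0. Qed.

Lemma L1_abs f : L1 f -> L1 (fun x => `|f x|).
Proof. exact: integrable_norm. Qed.

Lemma L1_sum (n : nat) (F : 'I_n -> R -> R) : (forall i, L1 (F i)) ->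
  L1 (fun x => \sum_(i < n) F i x).
Proof.
elim: n F => [|n IH] F LF.
  by apply: eq_L1 L10 => x; rewrite big_ord0.
apply: (@eq_L1 (fun x => \sum_(i < n) F (widen_ord (leqnSn n) i) x + F ord_max x)).
  by move=> x; rewrite big_ord_recr.
by apply: L1D => //; apply: IH => i.
Qed.

Lemma L1M_bdd f k M : L1 f -> measurable_fun [set: R] k ->
  (forall x, `|k x| <= M) -> L1 (fun x => f x * k x).
Proof.
move=> Lf mk kM; apply: (@L1_le _ (fun x => M * `|f x|)).
- by apply: measurable_funM => //; exact: L1_measurable.
- exact/L1Z/L1_abs.
- by move=> x; rewrite normrM mulrC ler_wpM2r.
Qed.

Lemma RintD f g : L1 f -> L1 g ->
  \int[mu]_x (f x + g x) = \int[mu]_x f x + \int[mu]_x g x.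
Proof. by move=> Lf Lg; exact: RintegralD. Qed.

Lemma RintB f g : L1 f -> L1 g ->
  \int[mu]_x (f x - g x) = \int[mu]_x f x - \int[mu]_x g x.
Proof. by move=> Lf Lg; exact: RintegralB. Qed.

Lemma RintZ c f : L1 f -> \int[mu]_x (c * f x) = c * \int[mu]_x f x.
Proof. by move=> Lf; exact: RintegralZl. Qed.

Lemma Rint0 : \int[mu]_x (0 : R) = 0.
Proof. by rewrite /Rintegral integral0. Qed.

Lemma eq_Rint f g : f =1 g -> \int[mu]_x f x = \int[mu]_x g x.
Proof. by move=> /funext ->. Qed.

Lemma Rint_sum (n : nat) (F : 'I_n -> R -> R) : (forall i, L1 (F i)) ->
  \int[mu]_x (\sum_(i < n) F i x) = \sum_(i < n) \int[mu]_x F i x.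
Proof.
elim: n F => [|n IH] F LF.
  rewrite big_ord0 -[RHS]Rint0; apply: eq_Rint => x; by rewrite big_ord0.
rewrite big_ord_recr/= -IH// -RintD//; last by apply: L1_sum.
by apply: eq_Rint => x; rewrite big_ord_recr.
Qed.

Lemma Rint_le f g : L1 f -> L1 g -> (forall x, f x <= g x) ->
  \int[mu]_x f x <= \int[mu]_x g x.
Proof. by move=> Lf Lg fg; apply: le_Rintegral. Qed.

Lemma Rint_ge0 f : (forall x, 0 <= f x) -> 0 <= \int[mu]_x f x.
Proof. by move=> f0; apply: Rintegral_ge0. Qed.

Lemma Rint_norm f : L1 f -> `|\int[mu]_x f x| <= \int[mu]_x `|f x|.
Proof. by move=> Lf; apply: le_normr_Rintegral. Qed.

Lemma Rint_ae f g : measurable_fun [set: R] f -> measurable_fun [set: R] g ->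
  {ae mu, forall x, f x = g x} -> \int[mu]_x f x = \int[mu]_x g x.
Proof.
move=> mf mg fg; rewrite /Rintegral; congr fine; apply: ae_eq_integral => //.
- exact/measurable_EFinP.
- exact/measurable_EFinP.
- by apply: (ae_S _ fg) => x /= -> _.
Qed.

Lemma L1_ae f g : measurable_fun [set: R] g -> L1 f ->
  {ae mu, forall x, f x = g x} -> L1 g.
Proof.
move=> mg Lf fg; have mf := L1_measurable Lf.
apply/integrableP; split; first exact/measurable_EFinP.
move/integrableP : Lf => [_].
rewrite (@ae_eq_integral _ _ _ mu setT (fun x => `|(EFin \o g) x|)%E)//.
- by apply: measurableT_comp => //; exact/measurable_EFinP.
- by apply: measurableT_comp => //; exact/measurable_EFinP.
- by apply: (ae_S _ fg) => x /= -> _.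
Qed.

Lemma EFin_Rint f : L1 f -> (\int[mu]_x f x)%:E = (\int[mu]_x (f x)%:E)%E.
Proof. by move=> Lf; rewrite /Rintegral fineK//; exact: integrable_fin_num. Qed.

Lemma L1_lty f : measurable_fun [set: R] f -> (forall x, 0 <= f x) ->
  (\int[mu]_x (f x)%:E < +oo)%E -> L1 f.
Proof.
move=> mf f0 fi; apply/integrableP; split; first exact/measurable_EFinP.
by under eq_integral do rewrite gee0_abs ?lee_fin//.
Qed.

Lemma L1_ge0 f : L1 f -> (forall x, 0 <= f x) -> forall C,
  (\int[mu]_x (f x)%:E <= C%:E)%E -> \int[mu]_x f x <= C.
Proof. by move=> Lf f0 C; rewrite -EFin_Rint. Qed.

Lemma dominated_cvgR (f_ : nat -> R -> R) f g :
  (forall n, measurable_fun [set: R] (f_ n)) -> L1 g ->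
  (forall n x, `|f_ n x| <= g x) -> (forall x, f_ ^~ x @ \oo --> f x) ->
  L1 f /\ (fun n => \int[mu]_x f_ n x) @ \oo --> \int[mu]_x f x.
Proof.
move=> mf Lg fg ff.
have mF : measurable_fun [set: R] f.
  by apply: (@measurable_fun_cvg _ _ _ _ f_) => // x _; exact: ff.
have mf' n : measurable_fun [set: R] (fun x => (f_ n x)%:E).
  by apply/measurable_EFinP; exact: mf.
have [||||Lf _ H] := @dominated_convergence _ _ _ mu setT measurableT
   (fun n x => (f_ n x)%:E) (EFin \o f) (EFin \o g) _ _ _ Lg.
- exact: mf'.
- exact/measurable_EFinP.
- by apply: aeW => x _; apply: cvg_EFin; [exact: nearW|exact: ff].
- by apply: aeW => x n _ /=; rewrite lee_fin.
split=> //; apply: fine_cvg.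
have -> : (\int[mu]_x f x)%:E = (\int[mu]_x (EFin \o f) x)%E by exact: EFin_Rint.
exact: H.
Qed.

Lemma fatouR (f_ : nat -> R -> R) f C : 
  (forall n, L1 (f_ n)) -> (forall n x, 0 <= f_ n x) ->
  (forall x, f_ ^~ x @ \oo --> f x) ->
  (forall n, \int[mu]_x f_ n x <= C) ->
  L1 f /\ \int[mu]_x f x <= C.
Proof.
move=> Lf f0 ff fC.
have mF : measurable_fun [set: R] f.
  apply: (@measurable_fun_cvg _ _ _ _ f_) => [n|x _]; last exact: ff.
  exact: L1_measurable.
have F0 x : 0 <= f x.
  rewrite -(cvg_lim _ (ff x))//; apply: limr_ge; first by apply/cvg_ex; eexists; exact: ff.
  exact: nearW.
have H : (\int[mu]_x (f x)%:E <= C%:E)%E.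
  have mf' n : measurable_fun [set: R] (fun x => (f_ n x)%:E).
    by apply/measurable_EFinP; exact: L1_measurable.
  have f0' n x : [set: R] x -> (0 <= (f_ n x)%:E)%E by rewrite lee_fin.
  have := fatou mu measurableT mf' f0'.
  have -> : (fun x => limn_einf (fun n => (f_ n x)%:E)) = (fun x => (f x)%:E).
    apply/funext => x; rewrite is_cvg_limn_einfE; last first.
      by apply/cvg_ex; exists (f x)%:E; apply: cvg_EFin; [exact: nearW|exact: ff].
    by apply/cvg_lim => //; apply: cvg_EFin; [exact: nearW|exact: ff].
  move=> /le_trans; apply; rewrite limn_einf_lim.
  apply: lime_le; first exact: is_cvg_einfs.
  apply: nearW => n; apply: (@le_trans _ _ (\int[mu]_x (f_ n x)%:E)%E).
    apply: ereal_inf_lbound; exists n => //=.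
  by rewrite -EFin_Rint// lee_fin.
have LF : L1 f by apply: L1_lty => //; exact: le_lt_trans H (ltry _).
by split=> //; exact: L1_ge0.
Qed.

(** * Square integrable functions *)

Definition L2 f : Prop := measurable_fun [set: R] f /\ L1 (fun x => f x ^+ 2).

Definition n2 f : R := Num.sqrt (\int[mu]_x (f x ^+ 2)).

Lemma L2_measurable f : L2 f -> measurable_fun [set: R] f.
Proof. by case. Qed.

Lemma eq_L2 f g : f =1 g -> L2 f -> L2 g.
Proof. by move=> /funext ->. Qed.

Lemma eq_n2 f g : f =1 g -> n2 f = n2 g.
Proof. by move=> /funext ->. Qed.

Lemma n2_ge0 f : 0 <= n2 f.
Proof. exact: sqrtr_ge0. Qed.

Lemma sqr_n2 f : n2 f ^+ 2 = \int[mu]_x (f x ^+ 2).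
Proof. by rewrite sqr_sqrtr// Rint_ge0// => x; exact: sqr_ge0. Qed.

Lemma L2_le f g : measurable_fun [set: R] f -> L2 g ->
  (forall x, `|f x| <= `|g x|) -> L2 f.
Proof.
move=> mf [mg Lg] fg; split=> //; apply: (L1_le _ Lg).
  exact: measurable_funX.
by move=> x; rewrite ger0_norm ?sqr_ge0// -(normK (f x)) -(normK (g x)) lerXn2r// nnegrE.
Qed.

Lemma n2_le f g : L2 f -> L2 g -> (forall x, `|f x| <= `|g x|) -> n2 f <= n2 g.
Proof.
move=> [_ Lf] [_ Lg] fg; rewrite ler_wsqrtr// Rint_le// => x.
by rewrite -(normK (f x)) -(normK (g x)) lerXn2r// nnegrE.
Qed.

Lemma L2M f g : L2 f -> L2 g -> L1 (fun x => f x * g x).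
Proof.
move=> [mf Lf] [mg Lg]; apply: (L1_le _ (L1D Lf Lg)).
  exact: measurable_funM.
move=> x; rewrite normrM -(normK (f x)) -(normK (g x)).
have := sqr_ge0 (`|f x| - `|g x|); have := normr_ge0 (f x); have := normr_ge0 (g x).
nra.
Qed.

Lemma L2Z c f : L2 f -> L2 (fun x => c * f x).
Proof.
move=> [mf Lf]; split; first exact: measurable_funM.
by apply: eq_L1 (L1Z (c ^+ 2) Lf) => x; rewrite exprMn.
Qed.

Lemma L2D f g : L2 f -> L2 g -> L2 (fun x => f x + g x).
Proof.
move=> Lf Lg; split.
  by apply: measurable_funD; [case: Lf|case: Lg].
apply: eq_L1 (L1D (L1D (proj2 Lf) (L1Z 2 (L2M Lf Lg))) (proj2 Lg)) => x.
by ring.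
Qed.

Lemma L2N f : L2 f -> L2 (fun x => - f x).
Proof. by move=> /(L2Z (-1)); apply: eq_L2 => x; rewrite mulN1r. Qed.

Lemma L2B f g : L2 f -> L2 g -> L2 (fun x => f x - g x).
Proof. by move=> Lf Lg; apply: L2D => //; exact: L2N. Qed.

Lemma L20 : L2 (cst 0).
Proof.
by split; [exact: measurable_cst|apply: eq_L1 L10 => x; rewrite /= expr0n].
Qed.

Lemma n20 : n2 (cst 0) = 0.
Proof.
rewrite /n2 (eq_Rint (g := cst 0)) => [|x]; last by rewrite /= expr0n.
by rewrite Rint0 sqrtr0.
Qed.

Lemma L2_sum (n : nat) (F : 'I_n -> R -> R) : (forall i, L2 (F i)) ->
  L2 (fun x => \sum_(i < n) F i x).
Proof.
elim: n F => [|n IH] F LF.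
  by apply: eq_L2 L20 => x; rewrite big_ord0.
apply: (@eq_L2 (fun x => \sum_(i < n) F (widen_ord (leqnSn n) i) x + F ord_max x)).
  by move=> x; rewrite big_ord_recr.
by apply: L2D => //; apply: IH => i.
Qed.

Lemma L2M_bdd f k M : L2 f -> measurable_fun [set: R] k ->
  (forall x, `|k x| <= M) -> L2 (fun x => k x * f x).
Proof.
move=> Lf mk kM; apply: (@L2_le _ (fun x => M * f x)).
- by apply: measurable_funM => //; exact: L2_measurable.
- exact: L2Z.
- move=> x; rewrite !normrM ler_wpM2r//.
  by rewrite (le_trans (kM x))// ler_norm.
Qed.

(** The discriminant of t |-> |f + t g|^2 is nonpositive. *)
Lemma cauchy_schwarz f g : L2 f -> L2 g ->
  `|\int[mu]_x (f x * g x)| <= n2 f * n2 g.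
Proof.
move=> Lf Lg.
have Lfg := L2M Lf Lg; case: (Lf) (Lg) => mf Lff [mg Lgg].
set C := \int[mu]_x _; set A := \int[mu]_x (f x ^+ 2); set B := \int[mu]_x (g x ^+ 2).
have A0 : 0 <= A by apply: Rint_ge0 => x; exact: sqr_ge0.
have B0 : 0 <= B by apply: Rint_ge0 => x; exact: sqr_ge0.
have H t : 0 <= A + 2 * t * C + t ^+ 2 * B.
  rewrite /A /B /C -!RintZ// -!RintD//; last 3 first.
  - by apply: L1D => //; exact: L1Z.
  - exact: L1Z.
  - exact: L1Z.
  apply: Rint_ge0 => x.
  rewrite (_ : _ + _ = (f x + t * g x) ^+ 2) ?sqr_ge0//; by ring.
rewrite /n2 -/A -/B -sqrtrM// -sqrtr_sqr ler_wsqrtr//.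
have [B00|B00] := eqVneq B 0.
  have [C0|C0] := eqVneq C 0; first by rewrite C0 B00 mulr0 expr0n.
  have := H (- (A + 1) / (2 * C)).
  rewrite B00 mulr0 addr0 mulrAC (_ : 2 * C * _ = - (A + 1)); last by field.
  by rewrite opprD addrA subrr add0r oppr_ge0 ler10.
have := H (- C / B).
rewrite (_ : _ + _ = A - C ^+ 2 / B); last by field.
by rewrite subr_ge0 ler_pdivrMr// lt0r B00.
Qed.

Lemma ler_n2D f g : L2 f -> L2 g -> n2 (fun x => f x + g x) <= n2 f + n2 g.
Proof.
move=> Lf Lg.
rewrite -(@ler_pXn2r _ 2)// ?nnegrE ?addr_ge0 ?n2_ge0//.
rewrite sqr_n2 sqrrD !sqr_n2.
rewrite (eq_Rint (g := fun x => f x ^+ 2 + 2 * (f x * g x) + g x ^+ 2)); last first.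
  by move=> x; ring.
have Lfg := L2M Lf Lg; have CS := cauchy_schwarz Lf Lg.
case: Lf Lg => _ Lff [_ Lgg].
rewrite !RintD//; [|exact: L1Z|by apply: L1D => //; exact: L1Z].
rewrite RintZ//.
have := ler_norm (\int[mu]_x (f x * g x)).
lra.
Qed.

Lemma n2Z c f : L2 f -> n2 (fun x => c * f x) = `|c| * n2 f.
Proof.
move=> [mf Lf]; rewrite /n2 (eq_Rint (g := fun x => c ^+ 2 * f x ^+ 2)).
  by rewrite RintZ// sqrtrM ?sqr_ge0// sqrtr_sqr.
by move=> x; rewrite exprMn.
Qed.

Lemma n2N f : n2 (fun x => - f x) = n2 f.
Proof. by rewrite /n2; congr Num.sqrt; apply: eq_Rint => x; rewrite sqrrN. Qed.

Lemma ler_n2B f g : L2 f -> L2 g -> n2 (fun x => f x - g x) <= n2 f + n2 g.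
Proof. by move=> Lf Lg; rewrite -(n2N g); apply: ler_n2D => //; exact: L2N. Qed.

Lemma n2BC f g : n2 (fun x => f x - g x) = n2 (fun x => g x - f x).
Proof. by rewrite -n2N; apply: eq_n2 => x; rewrite opprB. Qed.

Lemma n2M_bdd f k M : L2 f -> measurable_fun [set: R] k -> 0 <= M ->
  (forall x, `|k x| <= M) -> n2 (fun x => k x * f x) <= M * n2 f.
Proof.
move=> Lf mk M0 kM; rewrite -[M in leRHS](ger0_norm M0) -n2Z//; apply: n2_le.
- exact: L2M_bdd kM.
- exact: L2Z.
- by move=> x; rewrite !normrM ler_wpM2r// (le_trans (kM x))// ler_norm.
Qed.

Lemma n2_sum (n : nat) (F : 'I_n -> R -> R) : (forall i, L2 (F i)) ->
  n2 (fun x => \sum_(i < n) F i x) <= \sum_(i < n) n2 (F i).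
Proof.
elim: n F => [|n IH] F LF.
  rewrite big_ord0 (@eq_n2 _ (cst 0)) ?n20// => x; by rewrite big_ord0.
rewrite (@eq_n2 _ (fun x => \sum_(i < n) F (widen_ord (leqnSn n) i) x + F ord_max x)); last first.
  by move=> x; rewrite big_ord_recr.
rewrite big_ord_recr/=; apply: le_trans (ler_n2D _ _) _ => //.
  exact: L2_sum.
by rewrite lerD2r; exact: IH.
Qed.

Lemma n2_ae0 f : L2 f -> n2 f = 0 -> {ae mu, forall x, f x = 0}.
Proof.
move=> [mf Lf] /eqP; rewrite sqrtr_eq0 => f0.
have I0 : (\int[mu]_x `|(f x ^+ 2)%:E| = 0)%E.
  transitivity ((\int[mu]_x (f x ^+ 2))%:E).
    rewrite EFin_Rint//; apply: eq_integral => x _.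
    by rewrite gee0_abs// lee_fin sqr_ge0.
  congr EFin; apply/eqP; rewrite eq_le f0/=; apply: Rint_ge0 => x; exact: sqr_ge0.
have mf2 : measurable_fun [set: R] (fun x => (f x ^+ 2)%:E).
  by apply/measurable_EFinP; exact: measurable_funX.
have /(ae_eq_integral_abs mu measurableT mf2) := I0.
apply: ae_S => x /(_ I) /= [] /eqP; rewrite sqrf_eq0 => /eqP //.
Qed.

Lemma ae_n2 f g : L2 f -> L2 g -> {ae mu, forall x, f x = g x} -> n2 f = n2 g.
Proof.
move=> [mf _] [mg _] fg; rewrite /n2; congr Num.sqrt; apply: Rint_ae.
- exact: measurable_funX.
- exact: measurable_funX.
- by apply: ae_S fg => x ->.
Qed.

Lemma L2_ae f g : measurable_fun [set: R] g -> L2 f ->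
  {ae mu, forall x, f x = g x} -> L2 g.
Proof.
move=> mg [mf Lf] fg; split=> //; apply: (L1_ae _ Lf).
- exact: measurable_funX.
- by apply: ae_S fg => x ->.
Qed.

Lemma cvg_Rint_mul (f_ : nat -> R -> R) f g : (forall n, L2 (f_ n)) -> L2 f -> L2 g ->
  (fun n => n2 (fun x => f_ n x - f x)) @ \oo --> 0 ->
  (fun n => \int[mu]_x (f_ n x * g x)) @ \oo --> \int[mu]_x (f x * g x).
Proof.
move=> Lf_ Lf Lg f0.
apply/cvgrPdist_le => e e0.
have /cvgrPdist_lt/(_ (e / (n2 g + 1))) : (fun n => n2 (fun x => f_ n x - f x)) @ \oo --> 0 by [].
have g1 : 0 < n2 g + 1 by rewrite ltr_wpDl ?n2_ge0.
move=> /(_ (divr_gt0 e0 g1)); apply: filterS => n; rewrite sub0r normrN ger0_norm ?n2_ge0// => fn.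
rewrite -RintB; [|exact: L2M|exact: L2M].
rewrite (eq_Rint (g := fun x => (f x - f_ n x) * g x)) => [|x]; last by rewrite mulrBl.
rewrite (le_trans (cauchy_schwarz _ _))//; first exact: L2B.
rewrite n2BC (@le_trans _ _ (e / (n2 g + 1) * (n2 g + 1)))//.
  by apply: ler_pM; rewrite ?n2_ge0// ?(ltW fn)// lerDl.
by rewrite divfK// gt_eqF.
Qed.

Lemma fatou_L2 (f_ : nat -> R -> R) f C : 0 <= C ->
  (forall n, L2 (f_ n)) -> (forall x, f_ ^~ x @ \oo --> f x) ->
  (forall n, n2 (f_ n) <= C) -> L2 f /\ n2 f <= C.
Proof.
move=> C0 Lf ff fC.
have [||||LF IF] := @fatouR (fun n x => f_ n x ^+ 2) (fun x => f x ^+ 2) (C ^+ 2).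
- by move=> n; case: (Lf n).
- by move=> n x; exact: sqr_ge0.
- by move=> x; apply: cvgM; exact: ff.
- by move=> n; rewrite -sqr_n2 lerXn2r ?nnegrE ?n2_ge0.
split; first split=> //.
  apply: (@measurable_fun_cvg _ _ _ _ f_) => [n|x _]; last exact: ff.
  exact: L2_measurable.
by rewrite -(ger0_norm C0) -sqrtr_sqr ler_wsqrtr.
Qed.

(** * Changes of variables and Fubini *)

(** Reflections and translations preserve Lebesgue measure; both are instances. *)
Lemma transfer_L1 (phi : R -> R) f : measurable_fun [set: R] phi ->
  (forall A : set (measurableTypeR R), measurable A ->
     pushforward mu (phi : measurableTypeR R -> measurableTypeR R) A = mu A) ->
  L1 f -> L1 (fun x => f (phi x)) /\ \int[mu]_x f (phi x) = \int[mu]_x f x.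
Proof.
move=> mphi Hphi Lf; have mf := L1_measurable Lf.
have mfp : measurable_fun [set: R] (fun x => f (phi x)) by exact: measurableT_comp.
have Hge0 (g : R -> \bar R) : measurable_fun [set: R] g -> (forall x, 0 <= g x)%E ->
    (\int[mu]_x g (phi x) = \int[mu]_x g x)%E.
  move=> mg g0.
  have := @ge0_integral_pushforward _ _ (measurableTypeR R) (measurableTypeR R) R phi mphi mu
    setT g measurableT mg (fun y _ => g0 y).
  rewrite preimage_setT => <-.
  by apply: eq_measure_integral => A mA _; exact: Hphi.
have Lp : L1 (fun x => f (phi x)).
  apply/integrableP; split; first exact/measurable_EFinP.
  have /= -> := Hge0 (fun x => `|(f x)%:E|%E).
  - by move/integrableP : Lf => [].
  - by apply/measurable_EFinP; exact: measurableT_comp.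
  - by move=> x; rewrite lee_fin.
split=> //; rewrite /Rintegral; congr fine.
have mf' : measurable_fun [set: R] (EFin \o f) by exact/measurable_EFinP.
have := @integral_pushforward _ _ (measurableTypeR R) (measurableTypeR R) R phi mphi mu
   setT (EFin \o f) mf' Lp measurableT.
rewrite preimage_setT /= => <-.
by apply: eq_measure_integral => A mA _; exact: Hphi.
Qed.

Lemma measurable_opp : measurable_fun [set: R] (fun x : R => - x).
Proof. exact: oppr_measurable. Qed.

Lemma measurable_addl c : measurable_fun [set: R] (fun x : R => c + x).
Proof. exact: measurable_funD. Qed.

Lemma L1_reflect f : L1 f -> L1 (fun x => f (- x)).
Proof. by move=> Lf; have [] := transfer_L1 measurable_opp (@lebesgue_measureN R) Lf. Qed.

Lemma Rint_reflect f : L1 f -> \int[mu]_x f (- x) = \int[mu]_x f x.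
Proof. by move=> Lf; have [] := transfer_L1 measurable_opp (@lebesgue_measureN R) Lf. Qed.

Lemma lebesgue_measure_shift c (A : set (measurableTypeR R)) : measurable A ->
  pushforward mu ((fun x => c + x) : measurableTypeR R -> measurableTypeR R) A = mu A.
Proof.
move=> mA; apply/esym.
have mc := measurable_addl c.
pose m' : {measure set (measurableTypeR R) -> \bar R} :=
  pushforward mu ((fun x => c + x) : measurableTypeR R -> measurableTypeR R).
apply: (@lebesgue_measure_unique R (m' mc)) => //= _ [[a b]] _ <-.
rewrite /m' /pushforward.
rewrite (_ : _ @^-1` _ = `](a - c), (b - c)]%classic); last first.
  by apply/seteqP; split=> x /=; rewrite !in_itv/= ltrBlDl lerBrDl.
by rewrite !lebesgue_measure_itv/= !lte_fin ltrD2r -!EFinB; case: ifP => // _; congr EFin; ring.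
Qed.

Lemma L1_shift c f : L1 f -> L1 (fun x => f (c + x)).
Proof.
by move=> Lf; have [] := transfer_L1 (measurable_addl c) (@lebesgue_measure_shift c) Lf.
Qed.

Lemma Rint_shift c f : L1 f -> \int[mu]_x f (c + x) = \int[mu]_x f x.
Proof.
by move=> Lf; have [] := transfer_L1 (measurable_addl c) (@lebesgue_measure_shift c) Lf.
Qed.

Lemma L1_shiftN c f : L1 f -> L1 (fun x => f (c - x)).
Proof. by move=> /(L1_shift c) /L1_reflect. Qed.

Lemma Rint_shiftN c f : L1 f -> \int[mu]_x f (c - x) = \int[mu]_x f x.
Proof.
move=> Lf; rewrite (Rint_reflect (f := fun x => f (c + x))); last exact: L1_shift.
exact: Rint_shift.
Qed.

Lemma L2_reflect f : L2 f -> L2 (fun x => f (- x)).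
Proof.
move=> [mf Lf]; split; first exact: measurableT_comp mf measurable_opp.
exact: L1_reflect Lf.
Qed.

Lemma n2_reflect f : L2 f -> n2 (fun x => f (- x)) = n2 f.
Proof. by move=> [mf Lf]; rewrite /n2 (Rint_reflect Lf). Qed.

Lemma L2_shiftN c f : L2 f -> L2 (fun x => f (c - x)).
Proof.
move=> [mf Lf]; split; last exact: L1_shiftN Lf.
by apply: (measurableT_comp mf); exact: measurable_funB.
Qed.

Lemma n2_shiftN c f : L2 f -> n2 (fun x => f (c - x)) = n2 f.
Proof. by move=> [mf Lf]; rewrite /n2 (Rint_shiftN c Lf). Qed.

Lemma emeasurable_Rint (F : R * R -> R) : measurable_fun setT F ->
  measurable_fun [set: R] (fun x => \int[mu]_y (F (x, y))%:E)%E.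
Proof.
move=> mF.
have mF' : measurable_fun setT (fun z => (F z)%:E) by exact/measurable_EFinP.
have -> : (fun x => \int[mu]_y (F (x, y))%:E)%E =
   (fun x => \int[mu]_y ((fun z => (F z)%:E)^\+ (x, y)) -
             \int[mu]_y ((fun z => (F z)%:E)^\- (x, y)))%E.
  apply/funext => x; rewrite [LHS]integralE.
  by congr (_ - _)%E; apply: eq_integral => y _; rewrite ?funeposE ?funenegE.
apply: emeasurable_funB.
  apply: (@measurable_fun_fubini_tonelli_F _ _ _ _ R mu _) => //.
  exact: measurable_funepos.
apply: (@measurable_fun_fubini_tonelli_F _ _ _ _ R mu _) => //.
exact: measurable_funeneg.
Qed.

Lemma measurable_Rint (F : R * R -> R) : measurable_fun setT F ->
  measurable_fun [set: R] (fun x => \int[mu]_y F (x, y)).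
Proof.
move=> mF; rewrite /Rintegral; apply: measurableT_comp; first exact: fine_measurable.
exact: emeasurable_Rint.
Qed.

(** A bound for the inner integrals of |F| in one order gives, by Tonelli,
    integrability on the plane, hence the exchange. The sections in the other
    order are then integrable only almost everywhere. *)
Lemma fubiniR (F : R * R -> R) (A : R -> R) : measurable_fun setT F ->
  (forall x, L1 (fun y => F (x, y))) -> L1 A ->
  (forall x, \int[mu]_y `|F (x, y)| <= A x) ->
  [/\ L1 (fun x => \int[mu]_y F (x, y)),
      {ae mu, forall y, L1 (fun x => F (x, y))},
      L1 (fun y => \int[mu]_x F (x, y)) &
      \int[mu]_x (\int[mu]_y F (x, y)) = \int[mu]_y (\int[mu]_x F (x, y))].
Proof.
move=> mF LF LA FA.
have mF' : measurable_fun setT (EFin \o F) by exact/measurable_EFinP.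
have mFs : measurable_fun setT (fun z : R * R => F (z.2, z.1)).
  by apply: (measurableT_comp mF); exact: measurable_fun_pair.
have I12 : (\int[mu]_x \int[mu]_y `|(F (x, y))%:E| < +oo)%E.
  apply: (@le_lt_trans _ _ (\int[mu]_x (A x)%:E)%E); last exact: integrable_lty.
  apply: ge0_le_integral => //.
  - by move=> x _; exact: integral_ge0.
  - apply: (@measurable_fun_fubini_tonelli_F _ _ _ _ R mu (fun z => `|(F z)%:E|%E)) => //.
    exact: measurableT_comp.
  - by apply/measurable_EFinP; exact: L1_measurable.
  - move=> x _; apply: le_trans (_ : _ <= (\int[mu]_y `|F (x, y)|)%:E)%E _.
      by rewrite EFin_Rint//; exact: L1_abs.
    by rewrite lee_fin.
have intF : (mu \x mu)%E.-integrable setT (EFin \o F).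
  by apply/integrable12ltyP.
have L1F : L1 (fun x => \int[mu]_y F (x, y)).
  apply: L1_le LA _; first exact: measurable_Rint.
  by move=> x; apply: le_trans (FA x); exact: Rint_norm.
have aeF : {ae mu, forall y, L1 (fun x => F (x, y))}.
  exact: (ae_integrable2 intF).
have L1G : L1 (fun y => \int[mu]_x F (x, y)).
  have mG := measurable_Rint mFs.
  apply/integrableP; split; first exact/measurable_EFinP.
  apply: (@le_lt_trans _ _ (\int[mu]_y \int[mu]_x `|(F (x, y))%:E|)%E); last first.
    rewrite -(@fubini_tonelli _ _ _ _ R mu mu (fun z => `|(F z)%:E|%E))//.
    exact: measurableT_comp.
  apply: ge0_le_integral => //.
  - by apply/measurable_EFinP; exact: measurableT_comp.
  - apply: (@measurable_fun_fubini_tonelli_G _ _ _ _ R mu (fun z => `|(F z)%:E|%E)) => //.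
    exact: measurableT_comp.
  - move=> y _; apply: (@le_trans _ _ `|\int[mu]_x (F (x, y))%:E|%E).
      by rewrite /= /Rintegral; case: (\int[mu]_x _)%E => [r| |] //=; rewrite normr0 leey.
    apply: le_abse_integral => //; apply/measurable_EFinP.
    exact: measurableT_comp mF _.
split; [exact: L1F|exact: aeF|exact: L1G|].
have := Fubini intF.
rewrite {1}/Rintegral [in X in _ -> _ = X]/Rintegral.
move=> HF; congr fine.
transitivity (\int[mu]_x \int[mu]_y (F (x, y))%:E)%E.
  by apply: eq_integral => x _; rewrite EFin_Rint.
rewrite [LHS]HF; apply: ae_eq_integral; first exact: measurableT.
- exact: (emeasurable_Rint mFs).
- by apply/measurable_EFinP; exact: (measurable_Rint mFs).
- by apply: ae_S aeF => y LFy _; rewrite /= EFin_Rint.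
Qed.

Lemma fubini_tensor (F : R * R -> R) (a b : R -> R) : measurable_fun setT F ->
  L1 a -> L1 b -> (forall x y, `|F (x, y)| <= a x * b y) ->
  \int[mu]_x (\int[mu]_y F (x, y)) = \int[mu]_y (\int[mu]_x F (x, y)).
Proof.
move=> mF La Lb Fab.
have LF x : L1 (fun y => F (x, y)).
  by apply: (L1_le _ (L1Z (a x) Lb)) => //; exact: measurableT_comp mF _.
have [] // := @fubiniR F (fun x => a x * \int[mu]_y b y) mF LF.
  by apply: eq_L1 (L1Z (\int[mu]_y b y) La) => x; rewrite mulrC.
move=> x; rewrite -RintZ//; apply: Rint_le => //.
- exact: L1_abs.
- exact: L1Z.
Qed.

(** * Convolution *)

Local Opaque Rintegral L1.

Definition conv h k x : R := \int[mu]_a (h a * k (x - a)).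

Lemma measurable_sub_pair : measurable_fun setT (fun z : R * R => z.1 - z.2).
Proof. exact: measurable_funB. Qed.

Lemma measurable_conv h k : measurable_fun [set: R] h -> measurable_fun [set: R] k ->
  measurable_fun [set: R] (conv h k).
Proof.
move=> mh mk; apply: (@measurable_Rint (fun z => h z.2 * k (z.1 - z.2))).
apply: measurable_funM; first exact: (measurableT_comp mh).
exact: (measurableT_comp mk measurable_sub_pair).
Qed.

Definition trunc k n x : R := if `|k x| <= n%:R then k x else 0.

Lemma measurable_trunc k n : measurable_fun [set: R] k -> measurable_fun [set: R] (trunc k n).
Proof.
move=> mk; apply: measurable_fun_ifT => //.
by apply: measurable_fun_ler => //; exact: measurableT_comp.
Qed.

Lemma trunc_le k n x : `|trunc k n x| <= `|k x|.
Proof. by rewrite /trunc; case: ifP => //; rewrite normr0. Qed.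

Lemma trunc_bdd k n x : `|trunc k n x| <= n%:R.
Proof. by rewrite /trunc; case: ifP => //; rewrite normr0. Qed.

Lemma trunc_cvg k x : trunc k ^~ x @ \oo --> k x.
Proof.
apply: cvg_near_cst; near=> n; rewrite /trunc ifT//.
by near: n; exact: nbhs_infty_ger.
Unshelve. all: by end_near. Qed.

Lemma young_bdd h k M : L1 h -> L2 h -> L2 k -> (forall x, `|k x| <= M) ->
  L2 (conv h k) /\ n2 (conv h k) <= (\int[mu]_x `|h x|) * n2 k.
Proof.
move=> L1h L2h L2k kM.
have mh := L1_measurable L1h; have mk := L2_measurable L2k.
set A := \int[mu]_x _.
have A0 : 0 <= A by exact: Rint_ge0.
pose F (z : R * R) := `|h z.1| * k (z.2 - z.1) ^+ 2.
have mF : measurable_fun setT F.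
  apply: measurable_funM.
    by apply: measurableT_comp => //; exact: (measurableT_comp mh).
  apply: measurable_funX; apply: (measurableT_comp mk).
  exact: measurable_funB.
have Lks x : L1 (fun y => k (y - x) ^+ 2).
  by apply: eq_L1 (L1_shift (- x) (proj2 L2k)) => y; rewrite addrC.
have LF x : L1 (fun y => F (x, y)) by exact: (L1Z `|h x| (Lks x)).
have IF x : \int[mu]_y F (x, y) = `|h x| * n2 k ^+ 2.
  rewrite /F /= RintZ//; congr (_ * _); rewrite sqr_n2.
  rewrite -(Rint_shift (- x) (proj2 L2k)); apply: eq_Rint => y.
  by rewrite addrC.
have {IF} [LG EA] : L1 (fun y => \int[mu]_x F (x, y)) /\
    \int[mu]_y (\int[mu]_x F (x, y)) <= A * n2 k ^+ 2.
  have [||_ _ LG EG] := @fubiniR F (fun x => `|h x| * n2 k ^+ 2) mF LF.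
- by apply: eq_L1 (L1Z (n2 k ^+ 2) (L1_abs L1h)) => x; rewrite mulrC.
- move=> x; rewrite (eq_Rint (g := fun y => F (x, y))) ?IF// => y.
  by rewrite ger0_norm// mulr_ge0// sqr_ge0.
  split; first exact: LG.
  rewrite -EG (eq_Rint IF) mulrC -RintZ; last exact: L1_abs.
  by rewrite le_eqVlt; apply/orP; left; apply/eqP; apply: eq_Rint => x; rewrite mulrC.
have Lh2 : L2 (fun x => Num.sqrt `|h x|).
  split.
    apply: (@measurableT_comp _ _ _ _ _ _ (@Num.sqrt R)); last exact: measurableT_comp.
    apply: continuous_measurable_fun; exact: sqrt_continuous.
  by apply: eq_L1 (L1_abs L1h) => x; rewrite sqr_sqrtr.
have pt x : conv h k x ^+ 2 <= A * \int[mu]_a F (a, x).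
  have Lg : L2 (fun a => Num.sqrt `|h a| * k (x - a)).
    split.
      apply: measurable_funM; first by case: Lh2.
      by apply: (measurableT_comp mk); exact: measurable_funB.
    apply: (@L1_le _ (fun a => M ^+ 2 * `|h a|)).
    - apply: measurable_funX; apply: measurable_funM; first by case: Lh2.
      by apply: (measurableT_comp mk); exact: measurable_funB.
    - exact/L1Z/L1_abs.
    - move=> a; rewrite ger0_norm ?sqr_ge0// exprMn sqr_sqrtr// mulrC ler_wpM2r//.
      by rewrite -(normK (k _)) lerXn2r ?nnegrE// (le_trans _ (kM (x-a))).
  have CS : `|conv h k x| <= n2 (fun x => Num.sqrt `|h x|) *
      n2 (fun a => Num.sqrt `|h a| * k (x - a)).
    apply: le_trans (Rint_norm _) _; first by apply: L2M => //; exact: L2_shiftN.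
    have <- : n2 (fun a => Num.sqrt `|h a| * `|k (x - a)|) =
              n2 (fun a => Num.sqrt `|h a| * k (x - a)).
      by rewrite /n2; congr Num.sqrt; apply: eq_Rint => a; rewrite !exprMn normK.
    apply: le_trans (cauchy_schwarz Lh2 _); last first.
      apply: L2_le Lg _.
        apply: measurable_funM; first by case: Lh2.
        by apply: measurableT_comp => //; apply: (measurableT_comp mk); exact: measurable_funB.
      by move=> a; rewrite !normrM normr_id.
    apply: le_trans (ler_norm _); rewrite le_eqVlt; apply/orP; left; apply/eqP.
    by apply: eq_Rint => a; rewrite normrM mulrA -expr2 sqr_sqrtr.
  rewrite -(normK (conv _ _ _)).
  apply: (@le_trans _ _ ((n2 (fun x => Num.sqrt `|h x|) *
      n2 (fun a => Num.sqrt `|h a| * k (x - a))) ^+ 2)).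
    by rewrite lerXn2r// nnegrE// mulr_ge0 ?n2_ge0.
  rewrite exprMn !sqr_n2 (eq_Rint (g := fun x => `|h x|)) ?/F; last first.
    by move=> a; rewrite sqr_sqrtr.
  rewrite le_eqVlt; apply/orP; left; apply/eqP; congr (_ * _).
  by apply: eq_Rint => a; rewrite exprMn sqr_sqrtr.
have LAG : L1 (fun x => A * \int[mu]_a F (a, x)) by exact: (L1Z A LG).
have L2c : L2 (conv h k).
  split; first exact: measurable_conv.
  apply: L1_le LAG _; first by apply: measurable_funX; exact: measurable_conv.
  by move=> x; rewrite ger0_norm ?sqr_ge0.
split=> //; rewrite -(@ler_pXn2r _ 2)// ?nnegrE ?mulr_ge0 ?n2_ge0//.
rewrite sqr_n2; apply: le_trans (Rint_le _ LAG pt) _; first by case: L2c.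
rewrite RintZ// exprMn [A ^+ 2]expr2 -mulrA; exact: ler_wpM2l.
Qed.

(** Young's inequality L^1 * L^2 -> L^2. With h in L^2 as well the convolution
    integral converges at every point; truncating k to bounded functions makes
    Cauchy-Schwarz for the measure |h| da available at every point, and Fatou's
    lemma removes the truncation. *)
Lemma young h k : L1 h -> L2 h -> L2 k ->
  L2 (conv h k) /\ n2 (conv h k) <= (\int[mu]_x `|h x|) * n2 k.
Proof.
move=> L1h L2h L2k.
have mk := L2_measurable L2k.
have LT n : L2 (trunc k n).
  apply: L2_le L2k _; first exact: measurable_trunc.
  exact: trunc_le.
have B n := young_bdd L1h L2h (LT n) (trunc_bdd k n).
apply: (@fatou_L2 (fun n => conv h (trunc k n))).
- by rewrite mulr_ge0 ?n2_ge0// Rint_ge0.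
- by move=> n; case: (B n).
- move=> x.
  have [||||//] := @dominated_cvgR (fun n a => h a * trunc k n (x - a))
     (fun a => h a * k (x - a)) (fun a => `|h a * k (x - a)|).
  + move=> n; apply: measurable_funM; first by case: L2h.
    by apply: (measurableT_comp (measurable_trunc n mk)); exact: measurable_funB.
  + by apply: L1_abs; apply: L2M => //; exact: L2_shiftN.
  + by move=> n a; rewrite !normrM ler_wpM2l// trunc_le.
  + by move=> a; apply: cvgMr; exact: trunc_cvg.
- move=> n; case: (B n) => _ /le_trans; apply.
  by rewrite ler_wpM2l ?Rint_ge0// n2_le// => x; exact: trunc_le.
Qed.

(** * Completeness of L^2 *)

(** Multiplying by e turns convergence almost everywhere into convergence
    everywhere, changing no integral. *)
Lemma conull_restrict (P : R -> Prop) : {ae mu, forall x, P x} ->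
  exists e : R -> R, [/\ measurable_fun [set: R] e,
    forall x, e x = 0 \/ e x = 1 /\ P x & {ae mu, forall x, e x = 1}].
Proof.
move=> [N [mN N0 PN]]; exists (\1_(~` N)); split.
- by apply: measurable_indic; exact: measurableC.
- move=> x; rewrite indicE; have [xN|xN] := pselect (N x).
    by left; rewrite memNset//; exact: (fun h => h xN).
  right; rewrite mem_set//; split=> //; apply: contrapT => Px.
  by apply: xN; apply: PN.
- exists N; split => // x /= /eqP; rewrite indicE; case: (boolP (x \in ~` N)) => //.
    by rewrite eqxx.
  by move=> /negP; rewrite inE => /contrapT.
Qed.

Lemma geo_sum K : \sum_(j < K) (2^-1 ^+ j : R) <= 2.
Proof.
suff -> : \sum_(j < K) (2^-1 ^+ j : R) = 2 - 2 * 2^-1 ^+ K.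
  by rewrite lerBlDr lerDl mulr_ge0// exprn_ge0.
elim: K => [|K IH]; first by rewrite big_ord0 expr0 mulr1 subrr.
by rewrite big_ord_recr/= IH exprS; field.
Qed.

(** The squares of the partial sums of sum |g_j| increase and have integrals at
    most 4, so their limit is finite almost everywhere. *)
Lemma L2_series_ae (g : nat -> R -> R) : (forall j, L2 (g j)) ->
  (forall j, n2 (g j) <= 2^-1 ^+ j) ->
  {ae mu, forall x, cvgn [series g j x]_j}.
Proof.
move=> Lg g2.
pose S (K : nat) x : R := \sum_(j < K) `|g j x|.
have Labs (k : nat) : L2 (fun x => `|g k x|).
  apply: L2_le (Lg k) _; last by move=> x; rewrite normr_id.
  by apply: measurableT_comp => //; exact: L2_measurable.
have LS K : L2 (S K) by apply: L2_sum => k; exact: Labs.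
have nS K : n2 (S K) <= 2.
  apply: le_trans (n2_sum _) _ => [k|]; first exact: Labs.
  apply: le_trans (geo_sum K); apply: ler_sum => k _; apply: le_trans (g2 k).
  by apply: n2_le => // x; rewrite normr_id.
have S0 K x : 0 <= S K x by apply: sumr_ge0.
have Sm x : {homo (S ^~ x) : m n / (m <= n)%N >-> m <= n}.
  apply: homo_leq => // [|K]; first by move=> a b c; exact: le_trans.
  by rewrite /S big_ord_recr/= lerDl.
pose F x : \bar R := limn (fun K => (S K x ^+ 2)%:E).
have ndF x : nondecreasing_seq (fun K => (S K x ^+ 2)%:E).
  by move=> m n mn; rewrite lee_fin lerXn2r ?nnegrE//; exact: Sm.
have cF x : (fun K => (S K x ^+ 2)%:E) @ \oo --> F x.
  exact: ereal_nondecreasing_is_cvgn.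
have mS K : measurable_fun [set: R] (fun x => (S K x ^+ 2)%:E).
  by apply/measurable_EFinP; apply: measurable_funX; exact: L2_measurable.
have mF : measurable_fun [set: R] F.
  by apply: (emeasurable_fun_cvg (fun K x => (S K x ^+ 2)%:E)) => // x _; exact: cF.
have F0 x : (0 <= F x)%E.
  apply: lime_ge; first by apply/cvg_ex; eexists; exact: cF.
  by apply: nearW => K; rewrite lee_fin sqr_ge0.
have IF : (\int[mu]_x F x <= 4%:E)%E.
  rewrite /F monotone_convergence; [|exact: measurableT|exact: mS| |]; last 2 first.
  - by move=> n x _ /=; rewrite lee_fin sqr_ge0.
  - by move=> x _ /=; exact: ndF.
  apply: lime_le.
    apply: ereal_nondecreasing_is_cvgn => m n mn; apply: ge0_le_integral => //.
    - by move=> x _; rewrite lee_fin sqr_ge0.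
    - exact: mS.
    - exact: mS.
    - by move=> x _; exact: ndF.
  apply: nearW => K; rewrite -EFin_Rint ?lee_fin -?sqr_n2; last by case: (LS K).
  have -> : (4 : R) = 2 ^+ 2 by rewrite -natrX.
  by rewrite lerXn2r// nnegrE ?n2_ge0.
have LF : mu.-integrable [set: R] F.
  apply/integrableP; split=> //.
  under eq_integral do rewrite gee0_abs//.
  exact: le_lt_trans IF (ltry _).
have := integrable_ae measurableT LF.
apply: ae_S => x /(_ I) Fx.
apply: normed_cvg.
have -> : [normed [series g j x]_j] = S ^~ x.
  by apply/funext => K; rewrite /S -(big_mkord xpredT (fun j => `|g j x|)).
apply: nondecreasing_is_cvgn; first exact: Sm.
exists (Num.sqrt (fine (F x))) => _ [K _ <-].
rewrite -(@ler_pXn2r _ 2)// ?nnegrE ?sqrtr_ge0//.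
rewrite sqr_sqrtr ?fine_ge0// -lee_fin fineK//.
have := ereal_nondecreasing_cvgn (ndF x).
move/(cvg_lim _) => /(_ (@ereal_hausdorff R)); rewrite -/(F x) => ->.
by apply: ereal_sup_ubound; exists K.
Qed.

(** Riesz-Fischer: a subsequence with summable increments converges almost
    everywhere, and Fatou's lemma shows that its limit is the limit in the mean. *)
Lemma L2_complete (f_ : nat -> R -> R) : (forall n, L2 (f_ n)) ->
  (forall e, 0 < e -> exists N, forall m n, (N <= m)%N -> (N <= n)%N ->
     n2 (fun x => f_ m x - f_ n x) <= e) ->
  exists f, L2 f /\ (fun n => n2 (fun x => f_ n x - f x)) @ \oo --> 0.
Proof.
move=> Lf Cf.
have H (k : nat) : exists N, forall m n, (N <= m)%N -> (N <= n)%N ->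
     n2 (fun x => f_ m x - f_ n x) <= 2^-1 ^+ k by apply: Cf; rewrite exprn_gt0.
have [N HN] := choice H.
pose phi (k : nat) := (\sum_(i < k.+1) (N i).+1)%N.
have phiN (k : nat) : (N k <= phi k)%N.
  by rewrite /phi big_ord_recr/= (leq_trans (leqnSn _))// leq_addl.
have phik (k : nat) : (k <= phi k)%N.
  by elim: k => // k IH; rewrite /phi big_ord_recr/= -[leqLHS]addn1 leq_add.

have phim (k : nat) : (phi k <= phi k.+1)%N by rewrite /phi [leqRHS]big_ord_recr/= leq_addr.
have phimm : {homo phi : m n / (m <= n)%N}.
  by apply: homo_leq => // a b c; exact: leq_trans.
pose g (k : nat) x := f_ (phi k.+1) x - f_ (phi k) x.
have Lg (k : nat) : L2 (g k) by exact: L2B.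
have ng (k : nat) : n2 (g k) <= 2^-1 ^+ k.
  by apply: HN; [exact: leq_trans (phiN k) (phim k)|exact: phiN].
have [e [me eP e1]] := conull_restrict (L2_series_ae Lg ng).
pose h (k : nat) x := e x * f_ (phi k) x.
have Lh (k : nat) : L2 (h k).
  by apply: (L2M_bdd (M := 1)) => // x; case: (eP x) => [->|[-> _]]; rewrite ?normr0 ?normr1.
have ch x : cvgn (h ^~ x).
  rewrite /h; case: (eP x) => [->|[-> cx]].
    by under eq_fun do rewrite mul0r; exact: is_cvg_cst.
  under eq_fun do rewrite mul1r.
  have -> : (fun k : nat => f_ (phi k) x) = (fun k : nat => [series g j x]_j k + f_ (phi 0%N) x).
    apply/funext => K; rewrite /series/= big_mkord.
    elim: K => [|K IH]; first by rewrite big_ord0 add0r.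
    by rewrite big_ord_recr/= /g addrAC -IH; ring.
  by apply: is_cvgD => //; exact: is_cvg_cst.
pose f x := limn (h ^~ x).
have hf x : h ^~ x @ \oo --> f x by exact: ch.
have key n d : 0 <= d -> (exists L : nat, forall m, (L <= m)%N -> n2 (fun x => f_ n x - f_ m x) <= d) ->
    L2 (fun x => f_ n x - f x) /\ n2 (fun x => f_ n x - f x) <= d.
  move=> d0 [L HL].
  apply: (@fatou_L2 (fun (k : nat) x => f_ n x - h (k + L)%N x)) => //.
  - by move=> m; exact: L2B.
  - move=> x; apply: cvgB; first exact: cvg_cst.
    by have := hf x; rewrite -(cvg_shiftn L).
  - move=> m; apply: le_trans (_ : _ <= n2 (fun x => f_ n x - f_ (phi (m + L)%N) x)) _.
      rewrite le_eqVlt; apply/orP; left; apply/eqP; apply: ae_n2.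
      + exact: L2B.
      + exact: L2B.
      + by apply: ae_S e1 => x; rewrite /h => ->; rewrite mul1r.
    by apply: HL; rewrite (leq_trans _ (phik _))// leq_addl.
have [M0 HM0] := Cf 1 ltr01.
have [Lf0 _] : L2 (fun x => f_ M0 x - f x) /\ n2 (fun x => f_ M0 x - f x) <= 1.
  by apply: key => //; exists M0 => m M0m; exact: HM0.
exists f; split.
  by apply: eq_L2 (L2B (Lf M0) Lf0) => x; rewrite opprB addrC subrK.
apply/cvgrPdist_le => e' e'0; have [M HM] := Cf _ e'0.
exists M => // n /= Mn; rewrite sub0r normrN ger0_norm ?n2_ge0//.
have [] // := key n e' (ltW e'0).
by exists M => m Mm; exact: HM.
Qed.

(** * Restriction to intervals *)

Definition box c d : R -> R := \1_(`]c, d]%classic).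

Lemma boxE c d x : box c d x = ((c < x <= d)%R)%:R.
Proof.
rewrite /box indicE.
by have -> : (x \in `]c, d]%classic) = (c < x <= d)%R by apply/idP/idP; rewrite inE/= in_itv.
Qed.

Lemma box_ge0 c d x : 0 <= box c d x.
Proof. by rewrite boxE ler0n. Qed.

Lemma box_le1 c d x : box c d x <= 1.
Proof. by rewrite boxE lern1 leq_b1. Qed.

Lemma box_norm c d x : `|box c d x| <= 1.
Proof. by rewrite ger0_norm ?box_ge0 ?box_le1. Qed.

Lemma box_sqr c d x : box c d x ^+ 2 = box c d x.
Proof. by rewrite boxE; case: (_ && _); rewrite ?expr1n ?expr0n. Qed.

Lemma measurable_box c d : measurable_fun [set: R] (box c d).
Proof. exact: measurable_indic. Qed.

Lemma L1_box c d : L1 (box c d).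
Proof. exact: integrable_indic_itv. Qed.

Lemma L2_box c d : L2 (box c d).
Proof.
split; first exact: measurable_box.
by apply: eq_L1 (L1_box c d) => x; rewrite box_sqr.
Qed.

Definition cut (n : nat) f x : R := box (- n%:R) n%:R x * f x.

Lemma cutE n f x : cut n f x = if - n%:R < x <= n%:R then f x else 0.
Proof. by rewrite /cut boxE; case: ifP; rewrite ?mul1r ?mul0r. Qed.

Lemma cut_norm n f x : `|cut n f x| <= `|f x|.
Proof. by rewrite cutE; case: ifP; rewrite // normr0. Qed.

Lemma measurable_cut n f : measurable_fun [set: R] f -> measurable_fun [set: R] (cut n f).
Proof. by move=> mf; apply: measurable_funM => //; exact: measurable_box. Qed.

Lemma L2_cut n f : L2 f -> L2 (cut n f).
Proof. by move=> Lf; apply: (L2M_bdd (M := 1)) => //; [exact: measurable_box|exact: box_norm]. Qed.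

Lemma L2_cut_L1 n f : L2 f -> L1 (cut n f).
Proof. by move=> Lf; apply: L2M => //; exact: L2_box. Qed.

Lemma L1_cut n f : L1 f -> L1 (cut n f).
Proof.
move=> Lf; apply: L1_le (L1_abs Lf) _; last exact: cut_norm.
by apply: measurable_cut; exact: L1_measurable.
Qed.

Lemma cut_cvg f x : (fun n => cut n f x) @ \oo --> f x.
Proof.
apply: cvg_near_cst; near=> n; rewrite cutE ifT//.
apply/andP; split.
  rewrite ltrNl (le_lt_trans (ler_norm _))// normrN.
  by near: n; exact: nbhs_infty_gtr.
rewrite (le_trans (ler_norm _))//.
by near: n; exact: nbhs_infty_ger.
Unshelve. all: by end_near. Qed.

Lemma n2_cut_cvg f : L2 f -> (fun n => n2 (fun x => cut n f x - f x)) @ \oo --> 0.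
Proof.
move=> Lf.
have [||||_ H] := @dominated_cvgR (fun n x => (cut n f x - f x) ^+ 2) (cst 0) (fun x => f x ^+ 2).
- move=> n; apply: measurable_funX; apply: measurable_funB; last by case: Lf.
  by apply: measurable_cut; case: Lf.
- by case: Lf.
- move=> n x; rewrite ger0_norm ?sqr_ge0// cutE; case: ifP => _.
    by rewrite subrr expr0n sqr_ge0.
  by rewrite sub0r sqrrN.
- move=> x; rewrite [X in _ --> X](_ : _ = (f x - f x) ^+ 2); last by rewrite subrr expr0n.
  apply: cvgM; apply: cvgB; [exact: cut_cvg|exact: cvg_cst|exact: cut_cvg|exact: cvg_cst].
move: H; rewrite Rint0 => H.
have S0 : Num.sqrt x @[x --> (0 : R)] --> (0 : R).
  by rewrite -[X in _ --> X](@sqrtr0 R); exact: sqrt_continuous.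
exact: (cvg_comp _ _ H S0).
Qed.

Lemma Rint_box c d f : L1 f ->
  \int[mu]_x (box c d x * f x) = \int[mu]_(x in `]c, d]) f x.
Proof.
move=> Lf; rewrite [RHS]Rintegral_mkcond; apply: eq_Rintegral => x _.
rewrite patchE boxE.
have -> : (x \in (`]c, d]%classic : set R)) = (c < x <= d)%R.
  by apply/idP/idP; rewrite inE/= in_itv.
by case: ifP; rewrite ?mul1r ?mul0r.
Qed.

(** The primitive of f is constant, and its derivative is f almost everywhere
    (Lebesgue). *)
Lemma L1_ae0_box f : L1 f -> (forall c d, c < d -> \int[mu]_x (box c d x * f x) = 0) ->
  {ae mu, forall x, f x = 0}.
Proof.
move=> Lf H.
have H2 (n : nat) : {ae mu, forall x, - n%:R < x -> f x = 0}.
  have Lfs (A : set R) : measurable A -> mu.-integrable A (EFin \o f).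
    by move=> mA; apply: integrableS Lf.
  have := @FTC1 R f (BRight (- n%:R)) (fun y => Lfs _ (measurable_itv _))
     (open_integrable_locally openT Lf).
  apply: ae_S => x /= Hx nx; have [] := Hx; first by rewrite lte_fin.
  move=> _ <-; rewrite derive1E (@near_eq_derive _ _ _ _ (cst 0)); last first.
  - near=> y; rewrite -Rint_box//; apply: H.
    by near: y; exact: lt_nbhsr.
  exact: derive_cst.
have H3 : {ae mu, forall x, forall n : nat, - n%:R < x -> f x = 0}.
  by apply/ae_foralln => n; exact: H2.
apply: ae_S H3 => x H3; apply: (H3 (Num.truncn `|x|).+1).
rewrite ltrNl (le_lt_trans (ler_norm _))// normrN.
exact: truncnS_gt.
Unshelve. all: by end_near. Qed.

Lemma L2_ae0_box f : L2 f -> (forall c d, c < d -> \int[mu]_x (box c d x * f x) = 0) ->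
  {ae mu, forall x, f x = 0}.
Proof.
move=> Lf H.
have H2 (n : nat) : {ae mu, forall x, cut n f x = 0}.
  apply: L1_ae0_box; first exact: L2_cut_L1.
  move=> c d cd.
  rewrite (eq_Rint (g := fun x => box (Num.max c (- n%:R)) (Num.min d n%:R) x * f x)); last first.
    move=> x; rewrite /cut mulrA; congr (_ * _); rewrite !boxE -natrM mulnb.
    by rewrite gt_max le_min andbACA.
  have [/H//|dc] := ltP (Num.max c (- n%:R)) (Num.min d n%:R).
  rewrite -[RHS]Rint0; apply: eq_Rint => x; rewrite boxE.
  case: (boolP (_ && _)); rewrite ?mul0r// => /andP[cx xd].
  by have := lt_le_trans cx xd; rewrite ltNge dc.
have H3 : {ae mu, forall x, forall n : nat, cut n f x = 0} by apply/ae_foralln.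
apply: ae_S H3 => x Hx; have := cut_cvg (f := f) (x := x).
under eq_fun do rewrite Hx.
by move/(cvg_lim (@Rhausdorff R)) => <-; rewrite lim_cst.
Qed.

(** A set where two continuous functions differ is open, so it has positive
    measure or is empty. *)
Lemma ae_eq_continuous f g : continuous f -> continuous g ->
  {ae mu, forall x, f x = g x} -> f =1 g.
Proof.
move=> cf cg [N [mN N0 fgN]] x; apply/eqP/negPn/negP => fgx.
pose d z := f z - g z.
have cd : continuous d by move=> z; apply: cvgB; [exact: cf|exact: cg].
have dx : 0 < `|d x| by rewrite normr_gt0 subr_eq0.
have := cd x; move/cvgrPdist_lt => /(_ _ dx)[e /= e0 He].
have BN : ball x e `<=` N.
  move=> y xy; apply: fgN => /= fgy.
  have := He y xy; rewrite /d fgy subrr subr0 ltxx//.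
have : (mu (ball x e) <= mu N)%E by apply: le_measure; rewrite ?inE//; exact: measurable_ball.
rewrite N0 lebesgue_measure_ball ?(ltW e0)// lee_fin.
by rewrite leNgt mulrn_wgt0.
Qed.

Local Opaque n2.

(** * The Hartley transform *)

(** The Hartley kernel. It plays the role of the complex exponential and keeps
    real functions real: the even and odd parts of the transform are the cosine
    and sine transforms. *)
Definition cas x : R := cos x + sin x.

Lemma cas_norm x : `|cas x| <= 2.
Proof.
rewrite (le_trans (ler_normD _ _))// -[2]/(1 + 1) lerD//.
  by rewrite ler_norml cos_geN1 cos_le1.
by rewrite ler_norml sin_geN1 sin_le1.
Qed.

Lemma continuous_cas : continuous cas.
Proof. by move=> x; apply: cvgD; [exact: continuous_cos|exact: continuous_sin]. Qed.

Lemma measurable_cas : measurable_fun [set: R] cas.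
Proof. exact: continuous_measurable_fun continuous_cas. Qed.

Lemma measurable_casM c : measurable_fun [set: R] (fun x => cas (x * c)).
Proof. by apply: (measurableT_comp measurable_cas); exact: measurable_funM. Qed.

Lemma measurable_cas2 : measurable_fun setT (fun z : R * R => cas (z.1 * z.2)).
Proof. by apply: (measurableT_comp measurable_cas); exact: measurable_funM. Qed.

Definition hartley f xi : R := \int[mu]_x (f x * cas (x * xi)).
Local Notation H := hartley.

Lemma L1_cas f xi : L1 f -> L1 (fun x => f x * cas (x * xi)).
Proof.
move=> Lf; apply: (L1M_bdd (M := 2)) => //; first exact: measurable_casM.
by move=> x; exact: cas_norm.
Qed.

Lemma eq_hartley f g : f =1 g -> H f =1 H g.
Proof. by move=> /funext ->. Qed.

Lemma hartley_norm f xi : L1 f -> `|H f xi| <= 2 * \int[mu]_x `|f x|.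
Proof.
move=> Lf; apply: le_trans (Rint_norm _) _; first exact: L1_cas.
rewrite -RintZ; last exact: L1_abs.
apply: Rint_le; [exact/L1_abs/L1_cas|exact/L1Z/L1_abs|move=> x].
by rewrite normrM mulrC ler_wpM2r// cas_norm.
Qed.

Lemma measurable_hartley f : measurable_fun [set: R] f -> measurable_fun [set: R] (H f).
Proof.
move=> mf; apply: (@measurable_Rint (fun z => f z.2 * cas (z.2 * z.1))).
apply: measurable_funM; first exact: (measurableT_comp mf).
by apply: (measurableT_comp measurable_cas); exact: measurable_funM.
Qed.

Lemma hartleyD f g xi : L1 f -> L1 g -> H (fun x => f x + g x) xi = H f xi + H g xi.
Proof.
move=> Lf Lg; rewrite /H -RintD; [|exact: L1_cas|exact: L1_cas].
by apply: eq_Rint => x; rewrite mulrDl.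
Qed.

Lemma hartleyZ c f xi : L1 f -> H (fun x => c * f x) xi = c * H f xi.
Proof.
move=> Lf; rewrite /H -RintZ; last exact: L1_cas.
by apply: eq_Rint => x; rewrite mulrA.
Qed.

Lemma hartleyB f g xi : L1 f -> L1 g -> H (fun x => f x - g x) xi = H f xi - H g xi.
Proof.
move=> Lf Lg; rewrite /H -RintB; [|exact: L1_cas|exact: L1_cas].
by apply: eq_Rint => x; rewrite mulrBl.
Qed.

Lemma hartley_reflect f xi : L1 f -> H (fun x => f (- x)) xi = H f (- xi).
Proof.
move=> Lf; rewrite /H -(Rint_reflect (f := fun x => f x * cas (x * - xi))).
  by apply: eq_Rint => x; rewrite mulrNN.
exact: L1_cas.
Qed.

(** The kernel cas (x xi) is symmetric, so H is self-adjoint. *)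
Lemma hartley_adjoint f g : L1 f -> L1 g ->
  \int[mu]_x (f x * H g x) = \int[mu]_x (H f x * g x).
Proof.
move=> Lf Lg.
pose F (z : R * R) : R := f z.1 * (g z.2 * cas (z.1 * z.2)).
have mf := L1_measurable Lf; have mg := L1_measurable Lg.
have mF : measurable_fun setT F.
  apply: measurable_funM; first exact: (measurableT_comp mf).
  apply: measurable_funM; first exact: (measurableT_comp mg).
  exact: measurable_cas2.
transitivity (\int[mu]_x (\int[mu]_y F (x, y))).
  apply: eq_Rint => x; rewrite /F /= RintZ; last first.
    by apply: eq_L1 (L1_cas x Lg) => y; rewrite [x * y]mulrC.
  by congr (_ * _); apply: eq_Rint => y; rewrite [x * y]mulrC.
rewrite (@fubini_tensor F (fun x => 2 * `|f x|) (fun y => `|g y|))//.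
- apply: eq_Rint => y; rewrite mulrC /F /= -RintZ; last exact: L1_cas.
  by apply: eq_Rint => x; rewrite mulrCA.
- exact/L1Z/L1_abs.
- exact: L1_abs.
- move=> x y; rewrite /F /= !normrM mulrA mulrAC ler_wpM2r//.
  by rewrite mulrC ler_wpM2r// cas_norm.
Qed.

(** Only x > 0 is asked for the derivative, since |x| is not differentiable at 0. *)
Lemma even_FTC f F (l : R) : (forall x, 0 <= f x) -> continuous f ->
  (forall x, f (- x) = f x) -> F x @[x --> +oo%R] --> l ->
  (forall x, 0 < x -> is_derive x 1 F (f x)) -> {for 0, continuous F} ->
  L1 f /\ \int[mu]_x f x = 2 * (l - F 0).
Proof.
move=> f0 cf ef Fl dF cF.
have E : (\int[mu]_x (f x)%:E = (2 * (l - F 0))%:E)%E.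
  rewrite ge0_symfun_integralT//; last by move=> x; rewrite /= ef.
  rewrite -set_itvcy (@ge0_continuous_FTC2y R f F 0 l)//.
  - exact: continuous_subspaceT.
  - by move=> x /dF [].
  - by apply: cvg_at_right_filter; exact: cF.
  - by move=> x; rewrite in_itv/= andbT derive1E => /dF [].
have Lf : L1 f.
  apply: L1_lty => //; first exact: continuous_measurable_fun.
  by rewrite E ltry.
by split=> //; apply: EFin_inj; rewrite EFin_Rint.
Qed.

(** A convergence factor, whose transform is the Poisson kernel. *)
Definition lap e x : R := expR (- (e * `|x|)).
Definition poisson e x : R := 2 * e / (e ^+ 2 + x ^+ 2).

Lemma lapN e x : lap e (- x) = lap e x.
Proof. by rewrite /lap normrN. Qed.

Lemma lap_ge0 e x : 0 <= lap e x.
Proof. exact: expR_ge0. Qed.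

Lemma lap_le1 e x : 0 <= e -> lap e x <= 1.
Proof. by move=> e0; rewrite /lap -expR0 ler_expR oppr_le0 mulr_ge0. Qed.

Lemma continuous_lap e : continuous (lap e).
Proof.
move=> x; apply: continuous_comp; last exact: continuous_expR.
by apply: cvgN; apply: cvgMr; exact: norm_continuous.
Qed.

Lemma measurable_lap e : measurable_fun [set: R] (lap e).
Proof. by apply: continuous_measurable_fun; exact: continuous_lap. Qed.

Lemma cvg_mulry (e : R) : 0 < e -> e * x @[x --> +oo%R] --> +oo%R.
Proof.
move=> e0; have -> : (fun x : R => e * x) = (fun x => x * e).
  by apply/funext => x; rewrite mulrC.
exact: (gt0_cvgMly (f := id) e0 cvg_id).
Qed.

Lemma cvg_lap0 (e : R) : 0 < e -> expR (- (e * x)) @[x --> +oo%R] --> (0 : R).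
Proof.
move=> e0; apply: (cvg_comp (fun x => e * x) (fun y => expR (- y))); last exact: cvgr_expR.
exact: cvg_mulry.
Qed.

(** * The Laplace and Poisson kernels *)

Lemma is_derive_expRN e x : is_derive x 1 (fun y => expR (- (e * y)) : R) (- e * expR (- (e * x))).
Proof.
have H : is_derive x 1 (fun y : R => - (e * y)) (- e).
  by apply: is_derive_eq; rewrite /GRing.scale/=; ring.
by apply: is_derive_eq; rewrite /GRing.scale/=; ring.
Qed.

Lemma continuous_expRN e : continuous (fun y : R => expR (- (e * y))).
Proof.
move=> x; apply: continuous_comp; last exact: continuous_expR.
by apply: cvgN; apply: cvgMr; exact: cvg_id.
Qed.

Lemma lap_integral e : 0 < e -> L1 (lap e) /\ \int[mu]_x lap e x = 2 / e.
Proof.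
move=> e0.
have [||||||L ->] := @even_FTC (lap e) (fun x => - e^-1 * expR (- (e * x))) (- e^-1 * 0).
- exact: lap_ge0.
- exact: continuous_lap.
- exact: lapN.
- by apply: cvgMr; exact: cvg_lap0.
- move=> x x0; have := is_derive_expRN e x => H.
  apply: is_derive_eq; rewrite /GRing.scale/= /lap gtr0_norm//.
  by field; rewrite gt_eqF.
- by apply: cvgMr; exact: continuous_expRN.
split=> //; rewrite !mulr0 oppr0 expR0; field; by rewrite gt_eqF.
Qed.

Lemma L1_lap e : 0 < e -> L1 (lap e).
Proof. by move=> /lap_integral []. Qed.

Lemma L2_lap e : 0 < e -> L2 (lap e).
Proof.
move=> e0; split; first exact: measurable_lap.
apply: L1_le (L1_lap e0) _; first by apply: measurable_funX; exact: measurable_lap.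
move=> x; rewrite ger0_norm ?sqr_ge0// expr2 ler_piMl ?lap_ge0// lap_le1//.
exact: ltW.
Qed.

Lemma poisson_den_gt0 e x : 0 < e -> 0 < e ^+ 2 + x ^+ 2.
Proof. by move=> e0; rewrite ltr_wpDr ?sqr_ge0// exprn_gt0. Qed.

Lemma poisson_ge0 e x : 0 < e -> 0 <= poisson e x.
Proof. by move=> e0; rewrite divr_ge0 ?mulr_ge0// ?ltW// poisson_den_gt0. Qed.

Lemma poissonN e x : poisson e (- x) = poisson e x.
Proof. by rewrite /poisson sqrrN. Qed.

Lemma continuous_poisson e : 0 < e -> continuous (poisson e).
Proof.
move=> e0 x; apply: cvgMr; apply: cvgV; first by rewrite gt_eqF// poisson_den_gt0.
by apply: cvgD; [exact: cvg_cst|exact: exprn_continuous].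
Qed.

Lemma measurable_poisson e : 0 < e -> measurable_fun [set: R] (poisson e).
Proof. by move=> e0; apply: continuous_measurable_fun; exact: continuous_poisson. Qed.

Lemma poisson_le e x : 0 < e -> poisson e x <= 2 / e.
Proof.
move=> e0; rewrite /poisson ler_pdivrMr ?poisson_den_gt0// mulrDr.
rewrite (_ : 2 / e * e ^+ 2 = 2 * e); last by field; rewrite gt_eqF.
by rewrite lerDl mulr_ge0 ?sqr_ge0// divr_ge0 ?ltW.
Qed.

Lemma poisson_integral e : 0 < e -> L1 (poisson e) /\ \int[mu]_x poisson e x = 2 * pi.
Proof.
move=> e0.
have cA : continuous (fun x : R => 2 * atan (e^-1 * x)).
  move=> x; apply: cvgMr; apply: (continuous_comp (f := fun x => e^-1 * x)).
    by apply: cvgMr; exact: cvg_id.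
  exact: continuous_atan.
have [||||||L ->] := @even_FTC (poisson e) (fun x => 2 * atan (e^-1 * x)) (2 * (pi / 2)).
- by move=> x; exact: poisson_ge0.
- exact: continuous_poisson.
- exact: poissonN.
- apply: cvgMr; apply: (cvg_comp (fun x => e^-1 * x) atan); last exact: cvgy_atan.
  by apply: cvg_mulry; rewrite invr_gt0.
- move=> x x0.
  have H : is_derive x 1 (fun y : R => e^-1 * y) (e^-1).
    by apply: is_derive_eq; rewrite /GRing.scale/=; ring.
  have H2 := is_derive1_atan (e^-1 * x).
  have H3 : is_derive x 1 (fun y : R => atan (e^-1 * y)) (e^-1 * (1 + (e^-1 * x) ^+ 2)^-1).
    by apply: is_derive_eq; rewrite /GRing.scale/=; ring.
  apply: is_derive_eq; rewrite /GRing.scale/= /poisson.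
  have := poisson_den_gt0 x e0 => D.
  field; rewrite !gt_eqF//.
- exact: cA.
split=> //; rewrite mulr0 atan0 mulr0 subr0; by field.
Qed.

Lemma L1_poisson e : 0 < e -> L1 (poisson e).
Proof. by move=> /poisson_integral []. Qed.

Lemma L2_poisson e : 0 < e -> L2 (poisson e).
Proof.
move=> e0; split; first exact: measurable_poisson.
apply: L1_le (L1Z (2 / e) (L1_poisson e0)) _.
  by apply: measurable_funX; exact: measurable_poisson.
move=> x; rewrite ger0_norm ?sqr_ge0// expr2 ler_wpM2r ?poisson_ge0//.
exact: poisson_le.
Qed.

Lemma L1_lap_bdd e k : 0 < e -> measurable_fun [set: R] k -> (forall x, `|k x| <= 1) ->
  L1 (fun x => lap e x * k x).
Proof. by move=> e0 mk k1; apply: (L1M_bdd (M := 1)) => //; exact: L1_lap. Qed.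

Lemma measurable_cosM c : measurable_fun [set: R] (fun x : R => cos (x * c)).
Proof.
by apply: continuous_measurable_fun => x; apply: continuous_comp; [apply: cvgMl; exact: cvg_id|exact: continuous_cos].
Qed.

Lemma measurable_sinM c : measurable_fun [set: R] (fun x : R => sin (x * c)).
Proof.
by apply: continuous_measurable_fun => x; apply: continuous_comp; [apply: cvgMl; exact: cvg_id|exact: continuous_sin].
Qed.

Lemma cos_norm x : `|cos x| <= 1.
Proof. by rewrite ler_norml cos_geN1 cos_le1. Qed.

Lemma sin_norm x : `|sin x| <= 1.
Proof. by rewrite ler_norml sin_geN1 sin_le1. Qed.

Lemma L1_lap_cos e c : 0 < e -> L1 (fun x => lap e x * cos (x * c)).
Proof. by move=> e0; apply: L1_lap_bdd => // [|x]; [exact: measurable_cosM|exact: cos_norm]. Qed.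

Lemma L1_lap_sin e c : 0 < e -> L1 (fun x => lap e x * sin (x * c)).
Proof. by move=> e0; apply: L1_lap_bdd => // [|x]; [exact: measurable_sinM|exact: sin_norm]. Qed.

Lemma Rint_odd f : L1 f -> (forall x, f (- x) = - f x) -> \int[mu]_x f x = 0.
Proof.
move=> Lf of_.
have : \int[mu]_x f x = - \int[mu]_x f x.
  rewrite -{1}(Rint_reflect Lf) (eq_Rint of_).
  rewrite (eq_Rint (g := fun x => -1 * f x)) ?RintZ ?mulN1r// => x.
  by rewrite mulN1r.
by move/eqP; rewrite -addr_eq0 -mulr2n mulrn_eq0/= => /eqP.
Qed.

Lemma Rint_lap_sin e c : 0 < e -> \int[mu]_x (lap e x * sin (x * c)) = 0.
Proof.
move=> e0; apply: Rint_odd; first exact: L1_lap_sin.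
by move=> x; rewrite lapN mulNr sinN mulrN.
Qed.

(** The half-line form of the fundamental theorem of calculus needs a
    nonnegative integrand, hence 1 + cos in place of cos. *)
Lemma Rint_lap_cos e c : 0 < e -> \int[mu]_x (lap e x * cos (x * c)) = poisson e c.
Proof.
move=> e0.
pose D := e ^+ 2 + c ^+ 2.
have D0 : 0 < D by exact: poisson_den_gt0.
pose F x : R := expR (- (e * x)) * (- e^-1 + D^-1 * (c * sin (x * c) - e * cos (x * c))).
have dF x : is_derive x 1 F (expR (- (e * x)) * (1 + cos (x * c))).
  have H1 := is_derive_expRN e x.
  have H0 : is_derive x 1 (fun y : R => y * c) c.
    by apply: is_derive_eq; rewrite /GRing.scale/=; ring.
  have H2 : is_derive x 1 (fun y : R => sin (y * c)) (c * cos (x * c)).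
    by apply: is_derive_eq; rewrite /GRing.scale/=; ring.
  have H3 : is_derive x 1 (fun y : R => cos (y * c)) (c * - sin (x * c)).
    by apply: is_derive_eq; rewrite /GRing.scale/=; ring.
  apply: is_derive_eq; rewrite /GRing.scale/=.
  rewrite /D; field; apply/andP; split; rewrite gt_eqF//; exact: D0.
have [||||||L E] := @even_FTC (fun x => lap e x * (1 + cos (x * c))) F 0.
- by move=> x; rewrite mulr_ge0 ?lap_ge0// -lerBlDl sub0r cos_geN1.
- move=> x; apply: cvgM; first exact: continuous_lap.
  apply: cvgD; first exact: cvg_cst.
  by apply: continuous_comp; [apply: cvgMl; exact: cvg_id|exact: continuous_cos].
- by move=> x; rewrite lapN mulNr cosN.
- pose K := e^-1 + D^-1 * (`|c| + e).
  have := cvg_lap0 e0; move/cvgrPdist_lt => C.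
  apply/cvgrPdist_lt => d d0.
  have K0 : 0 < K + 1.
    by rewrite ltr_wpDl// /K addr_ge0 ?mulr_ge0 ?addr_ge0 ?invr_ge0 ?(ltW e0) ?(ltW D0).
  have := C _ (divr_gt0 d0 K0); apply: filterS => x.
  rewrite !sub0r !normrN ltr_pdivlMr// => /le_lt_trans; apply.
  rewrite /F normrM ler_wpM2l//.
  apply: (@le_trans _ _ K); last by rewrite lerDl.
  rewrite (le_trans (ler_normD _ _))// /K normrN gtr0_norm ?invr_gt0// lerD2l.
  rewrite normrM gtr0_norm ?invr_gt0//; apply: ler_wpM2l; first by rewrite invr_ge0 ltW.
  apply: le_trans (ler_normB _ _) _; rewrite !normrM (gtr0_norm e0).
  by rewrite lerD// ler_piMr ?sin_norm ?cos_norm// (ltW e0).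
- by move=> x x0; rewrite /lap gtr0_norm.
- by apply: differentiable_continuous; apply/derivable1_diffP; case: (dF 0).
have [L0 E0] := lap_integral e0.
have : \int[mu]_x (lap e x * (1 + cos (x * c))) = 2 / e + \int[mu]_x (lap e x * cos (x * c)).
  rewrite -E0 -RintD//; last exact: L1_lap_cos.
  by apply: eq_Rint => x; rewrite mulrDr mulr1.
rewrite {}E => E2.
have -> : \int[mu]_x (lap e x * cos (x * c)) = 2 * (0 - F 0) - 2 / e by lra.
rewrite /F /poisson mulr0 oppr0 expR0 mul0r sin0 cos0 -/D; field.
by rewrite !gt_eqF.
Qed.

(** * The Hartley transform on L^2 *)

Lemma hartleyE f xi : H f xi = \int[mu]_x (f x * cas (x * xi)).
Proof. by []. Qed.

Local Opaque hartley.

(** Modulating by cas (x c) translates the transform by c. *)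
Lemma hartley_lap_cas e c xi : 0 < e ->
  H (fun x => lap e x * cas (x * c)) xi = poisson e (xi - c).
Proof.
move=> e0; rewrite hartleyE -Rint_lap_cos// -[RHS]addr0 -(Rint_lap_sin (c + xi) e0).
rewrite -RintD; [|exact: L1_lap_cos|exact: L1_lap_sin].
apply: eq_Rint => x; rewrite /cas (mulrBr x) (mulrDr x) cosB sinD; ring.
Qed.

Lemma L1_lap_cas e c : 0 < e -> L1 (fun x => lap e x * cas (x * c)).
Proof. by move=> e0; apply: L1_cas; exact: L1_lap. Qed.

Lemma L2_cas f xi : L2 f -> L2 (fun x => f x * cas (x * xi)).
Proof.
move=> Lf; apply: (@eq_L2 (fun x => cas (x * xi) * f x)) => [x|]; first by rewrite mulrC.
by apply: (L2M_bdd (M := 2)) => //; [exact: measurable_casM|move=> x; exact: cas_norm].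
Qed.

Lemma L2_lap_cas e c : 0 < e -> L2 (fun x => lap e x * cas (x * c)).
Proof. by move=> e0; apply: L2_cas; exact: L2_lap. Qed.

Definition eps_ (n : nat) : R := n.+1%:R^-1.

Lemma eps_gt0 n : 0 < eps_ n.
Proof. by rewrite invr_gt0. Qed.

Lemma eps_le1 n : eps_ n <= 1.
Proof. by rewrite invf_le1// ler1n. Qed.

Lemma cvg_eps : eps_ @ \oo --> 0.
Proof. exact: cvg_harmonic. Qed.

Lemma cvg_lap1 x : (fun n => lap (eps_ n) x) @ \oo --> (1 : R).
Proof.
rewrite -(@expR0 R); apply: (cvg_comp _ expR); last exact: continuous_expR.
have : (fun n => - (eps_ n * `|x|)) @ \oo --> - (0 * `|x|).
  by apply: cvgN; apply: cvgMl; exact: cvg_eps.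
by rewrite mul0r oppr0.
Qed.

Definition c2pi : R := Num.sqrt (2 * pi).

Lemma twopi_gt0 : 0 < 2 * pi :> R.
Proof. by rewrite mulr_gt0// pi_gt0. Qed.

Lemma c2pi_ge0 : 0 <= c2pi.
Proof. exact: sqrtr_ge0. Qed.

Lemma sqr_c2pi : c2pi ^+ 2 = 2 * pi.
Proof. by rewrite sqr_sqrtr// ltW// twopi_gt0. Qed.

(** Weighting |H f|^2 by exp(- e |xi|) turns it, by self-adjointness, into the
    quadratic form of the Poisson kernel, which Young's inequality bounds
    uniformly in e. *)
Lemma bessel_weighted f e : 0 < e -> L1 f -> L2 f ->
  \int[mu]_x (lap e x * H f x ^+ 2) <= 2 * pi * n2 f ^+ 2.
Proof.
move=> e0 L1f L2f.
have mH : measurable_fun [set: R] (H f) by apply: measurable_hartley; exact: L1_measurable.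
have LlH : L1 (fun x => lap e x * H f x).
  by apply: (L1M_bdd (M := 2 * \int[mu]_x `|f x|)) => // [|x]; [exact: L1_lap|exact: hartley_norm].
have -> : \int[mu]_x (lap e x * H f x ^+ 2) = \int[mu]_x (f x * conv (poisson e) f x).
  transitivity (\int[mu]_x (f x * H (fun x => lap e x * H f x) x)).
    by rewrite hartley_adjoint//; apply: eq_Rint => x; ring.
  apply: eq_Rint => x; congr (_ * _).
  transitivity (\int[mu]_y (H f y * (lap e y * cas (y * x)))).
    by apply: eq_Rint => y; ring.
  rewrite -hartley_adjoint//; last exact: L1_lap_cas.
  transitivity (\int[mu]_y (f y * poisson e (x - y))).
    apply: eq_Rint => y; rewrite hartley_lap_cas//; congr (_ * _).
    by rewrite -poissonN opprB.
  rewrite /conv -(Rint_shiftN x (f := fun y => f y * poisson e (x - y))).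
    by apply: eq_Rint => y; rewrite mulrC; congr (poisson _ _ * _); ring.
  by apply: L2M => //; apply: L2_shiftN; exact: L2_poisson.
have [L2c n2c] := young (L1_poisson e0) (L2_poisson e0) L2f.
apply: le_trans (ler_norm _) _; apply: le_trans (cauchy_schwarz L2f L2c) _.
rewrite expr2 mulrCA ler_wpM2l ?n2_ge0//; apply: le_trans n2c _.
rewrite ler_wpM2r ?n2_ge0// -(proj2 (poisson_integral e0)).
by rewrite le_eqVlt; apply/orP; left; apply/eqP; apply: eq_Rint => x; rewrite ger0_norm ?poisson_ge0.
Qed.

(** The weights of bessel_weighted tend to 1: Fatou. *)
Lemma bessel f : L1 f -> L2 f -> L2 (H f) /\ n2 (H f) <= c2pi * n2 f.
Proof.
move=> L1f L2f.
have mH : measurable_fun [set: R] (H f) by apply: measurable_hartley; exact: L1_measurable.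
have LH2 e : 0 < e -> L1 (fun x => lap e x * H f x ^+ 2).
  move=> e0; apply: (L1M_bdd (M := (2 * \int[mu]_x `|f x|) ^+ 2)); first exact: L1_lap.
    exact: measurable_funX.
  move=> x; rewrite normrX lerXn2r ?nnegrE ?mulr_ge0 ?Rint_ge0//.
  exact: hartley_norm.
have [||||LF IF] := @fatouR (fun n x => lap (eps_ n) x * H f x ^+ 2) (fun x => H f x ^+ 2) (2 * pi * n2 f ^+ 2).
- by move=> n; apply: LH2; exact: eps_gt0.
- by move=> n x; rewrite mulr_ge0 ?lap_ge0 ?sqr_ge0.
- move=> x; rewrite -[X in _ --> X]mul1r; apply: cvgMl; exact: cvg_lap1.
- by move=> n; apply: bessel_weighted => //; exact: eps_gt0.
split; first by split.
rewrite -(@ler_pXn2r _ 2)// ?nnegrE ?mulr_ge0 ?n2_ge0 ?c2pi_ge0//.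
by rewrite sqr_n2 exprMn sqr_c2pi.
Qed.

(** A transform in L^2 is determined up to a null set only, hence a relation. *)
Definition is_hartley f h : Prop :=
  L2 h /\ (fun n => n2 (fun x => h x - H (cut n f) x)) @ \oo --> 0.

Lemma L2_hartley_cut n f : L2 f -> L2 (H (cut n f)).
Proof. by move=> Lf; have [] := bessel (L2_cut_L1 n Lf) (L2_cut n Lf). Qed.

Lemma is_hartley_ex f : L2 f -> exists h, is_hartley f h.
Proof.
move=> Lf; have Lc n := L2_cut n Lf.
have [||h [Lh hC]] := @L2_complete (fun n => H (cut n f)).
- by move=> n; exact: L2_hartley_cut.
- move=> e e0.
  have /cvgrPdist_le C := n2_cut_cvg Lf.
  have d0 : 0 < e / (2 * (c2pi + 1)) by rewrite divr_gt0// mulr_gt0// ltr_wpDl ?c2pi_ge0.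
  have [N _ HN] := C _ d0.
  exists N => m n Nm Nn.
  rewrite (@eq_n2 _ (H (fun x => cut m f x - cut n f x))); last first.
    by move=> x; rewrite hartleyB//; exact: L2_cut_L1.
  have [||_ /le_trans] := @bessel (fun x => cut m f x - cut n f x).
  + by apply: L1B; exact: L2_cut_L1.
  + exact: L2B.
  apply; apply: (@le_trans _ _ (c2pi * (e / (c2pi + 1)))); last first.
    rewrite mulrCA ler_piMr ?(ltW e0)// ler_pdivrMr ?ltr_wpDl ?c2pi_ge0//.
    by rewrite mul1r lerDl.
  rewrite ler_wpM2l ?c2pi_ge0//.
  rewrite (@eq_n2 _ (fun x => (cut m f x - f x) - (cut n f x - f x))); last by move=> x; ring.
  apply: le_trans (ler_n2B _ _) _; [exact: L2B|exact: L2B|].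
  have {HN} HN (j : nat) : (N <= j)%N -> n2 (fun x => cut j f x - f x) <= e / (2 * (c2pi + 1)).
    by move=> /HN; rewrite sub0r normrN ger0_norm ?n2_ge0.
  apply: le_trans (lerD (HN _ Nm) (HN _ Nn)) _.
  rewrite le_eqVlt; apply/orP; left; apply/eqP; field.
  by rewrite gt_eqF// ltr_wpDl ?c2pi_ge0.
exists h; split=> //; under eq_fun do rewrite n2BC; exact: hC.
Qed.

Lemma cvg0D T (F : set_system T) {FF : Filter F} (a b : T -> R) :
  a @ F --> (0 : R) -> b @ F --> (0 : R) -> (fun t => a t + b t) @ F --> (0 : R).
Proof. by move=> a0 b0; have := cvgD a0 b0; rewrite addr0; apply. Qed.

Lemma cvg0Z T (F : set_system T) {FF : Filter F} c (a : T -> R) :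
  a @ F --> (0 : R) -> (fun t => c * a t) @ F --> (0 : R).
Proof. by move=> a0; have := @cvgMr _ _ F _ _ c _ a0; rewrite mulr0; apply. Qed.

Lemma cvg_le0 (a b : nat -> R) : (forall n, 0 <= a n) -> (forall n, a n <= b n) ->
  b @ \oo --> 0 -> a @ \oo --> 0.
Proof.
move=> a0 ab b0; apply: (squeeze_cvgr _ (cvg_cst 0) b0).
by apply: nearW => n; rewrite a0 ab.
Qed.

Lemma is_hartleyD f g h k : L2 f -> L2 g -> is_hartley f h -> is_hartley g k ->
  is_hartley (fun x => f x + g x) (fun x => h x + k x).
Proof.
move=> Lf Lg [Lh Ch] [Lk Ck]; split; first exact: L2D.
apply: (@cvg_le0 _ (fun n => n2 (fun x => h x - H (cut n f) x) + n2 (fun x => k x - H (cut n g) x))).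
- by move=> n; exact: n2_ge0.
- move=> n; rewrite (@eq_n2 _ (fun x => (h x - H (cut n f) x) + (k x - H (cut n g) x))).
    by apply: ler_n2D; apply: L2B => //; exact: L2_hartley_cut.
  move=> x; rewrite (_ : H (cut n _) x = H (cut n f) x + H (cut n g) x); first by ring.
  rewrite -hartleyD; [|exact: L2_cut_L1|exact: L2_cut_L1].
  by apply: eq_hartley => y; rewrite /cut mulrDr.
- exact: (cvg0D Ch Ck).
Qed.

Lemma is_hartleyZ c f h : L2 f -> is_hartley f h -> is_hartley (fun x => c * f x) (fun x => c * h x).
Proof.
move=> Lf [Lh Ch]; split; first exact: L2Z.
rewrite (_ : (fun n => _) = (fun n => `|c| * n2 (fun x => h x - H (cut n f) x))).
  exact: (cvg0Z `|c| Ch).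
apply/funext => n; rewrite -n2Z; last by apply: L2B => //; exact: L2_hartley_cut.
apply: eq_n2 => x; rewrite mulrBr -hartleyZ; last exact: L2_cut_L1.
by congr (_ - _); apply: eq_hartley => y; rewrite /cut mulrCA.
Qed.

Lemma is_hartleyB f g h k : L2 f -> L2 g -> is_hartley f h -> is_hartley g k ->
  is_hartley (fun x => f x - g x) (fun x => h x - k x).
Proof.
move=> Lf Lg hf hg; have := is_hartleyD Lf (L2Z (-1) Lg) hf (is_hartleyZ (-1) Lg hg).
by under eq_fun do rewrite mulN1r; under [X in is_hartley _ X -> _]eq_fun do rewrite mulN1r.
Qed.

Lemma is_hartley_L1 f : L1 f -> L2 f -> is_hartley f (H f).
Proof.
move=> L1f L2f; split; first by have [] := bessel L1f L2f.
apply: (@cvg_le0 _ (fun n => c2pi * n2 (fun x => cut n f x - f x))).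
- by move=> n; exact: n2_ge0.
- move=> n; rewrite [X in _ * X]n2BC.
  rewrite (@eq_n2 _ (H (fun x => f x - cut n f x))); last first.
    by move=> x; rewrite hartleyB//; exact: L1_cut.
  have [] // := @bessel (fun x => f x - cut n f x).
  + by apply: L1B => //; exact: L1_cut.
  + by apply: L2B => //; exact: L2_cut.
- exact: (cvg0Z c2pi (n2_cut_cvg L2f)).
Qed.

Lemma is_hartley_ae_r f h k : measurable_fun [set: R] k -> is_hartley f h -> L2 f ->
  {ae mu, forall x, h x = k x} -> is_hartley f k.
Proof.
move=> mk [Lh Ch] Lf hk; have Lk := L2_ae mk Lh hk; split=> //.
have -> : (fun n => n2 (fun x => k x - H (cut n f) x)) = (fun n => n2 (fun x => h x - H (cut n f) x)); last exact: Ch.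
apply/funext => n; apply/esym; apply: ae_n2.
- by apply: L2B => //; exact: L2_hartley_cut.
- by apply: L2B => //; exact: L2_hartley_cut.
- by apply: ae_S hk => x ->.
Qed.

Lemma is_hartley_adjoint f h g : L2 f -> is_hartley f h -> L1 g -> L2 g ->
  \int[mu]_x (h x * g x) = \int[mu]_x (f x * H g x).
Proof.
move=> Lf [Lh Ch] L1g L2g.
have [LHg _] := bessel L1g L2g.
have A : (fun n => \int[mu]_x (H (cut n f) x * g x)) @ \oo --> \int[mu]_x (h x * g x).
  apply: cvg_Rint_mul => //; first by move=> n; exact: L2_hartley_cut.
  by under eq_fun do rewrite n2BC.
have B : (fun n => \int[mu]_x (H (cut n f) x * g x)) @ \oo --> \int[mu]_x (f x * H g x).
  have -> : (fun n => \int[mu]_x (H (cut n f) x * g x)) =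
            (fun n => \int[mu]_x (cut n f x * H g x)).
    by apply/funext => n; rewrite hartley_adjoint//; exact: L2_cut_L1.
  apply: cvg_Rint_mul => //; first by move=> n; exact: L2_cut.
  exact: n2_cut_cvg.
exact: cvg_unique A B.
Qed.

(** * Inversion and Parseval *)

Lemma continuous_casM c : continuous (fun x : R => cas (x * c)).
Proof.
move=> x; apply: (@continuous_comp _ _ _ (fun x : R => x * c) cas); last exact: continuous_cas.
by apply: cvgMl; exact: cvg_id.
Qed.

Lemma poissonE e x : poisson e x = 2 * e / (e ^+ 2 + x ^+ 2).
Proof. by []. Qed.

Lemma poisson_norm e x : 0 < e -> `|poisson e x| = poisson e x.
Proof. by move=> e0; rewrite ger0_norm ?poisson_ge0. Qed.

Local Opaque poisson.

Lemma dominated_cvg_ae (f_ : nat -> R -> R) f g :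
  (forall n, measurable_fun [set: R] (f_ n)) -> measurable_fun [set: R] f -> L1 g ->
  (forall n x, `|f_ n x| <= g x) -> {ae mu, forall x, f_ ^~ x @ \oo --> f x} ->
  (fun n => \int[mu]_x f_ n x) @ \oo --> \int[mu]_x f x.
Proof.
move=> mf_ mf Lg fg ff.
have [e [me eP e1]] := conull_restrict ff.
have E k : measurable_fun [set: R] k -> \int[mu]_x k x = \int[mu]_x (e x * k x).
  move=> mk; apply: Rint_ae => //; first exact: measurable_funM.
  by apply: ae_S e1 => x ->; rewrite mul1r.
rewrite (E f)//; have -> : (fun n => \int[mu]_x f_ n x) = (fun n => \int[mu]_x (e x * f_ n x)).
  by apply/funext => n; exact: E.
have [||||//] := @dominated_cvgR (fun n x => e x * f_ n x) (fun x => e x * f x) g.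
- by move=> n; exact: measurable_funM.
- by [].
- move=> n x; rewrite normrM; case: (eP x) => [->|[-> _]].
    by rewrite normr0 mul0r (le_trans _ (fg n x)).
  by rewrite normr1 mul1r.
- move=> x; case: (eP x) => [->|[-> cx]].
    rewrite mul0r; under eq_fun do rewrite mul0r; exact: cvg_cst.
  by rewrite mul1r; under eq_fun do rewrite mul1r.
Qed.

(** Away from the origin the Poisson kernel is O(e), with an integrable profile. *)
Lemma poisson_far e r z : 0 < e -> 0 < r -> r <= `|z| ->
  poisson e z <= e * (1 + r ^- 2) * poisson 1 z.
Proof.
move=> e0 r0 rz; rewrite !poissonE expr1n mulr1.
have z0 : 0 < z ^+ 2 by rewrite -normK exprn_gt0// (lt_le_trans r0).
have rz2 : r ^+ 2 <= z ^+ 2 by rewrite -(normK z) lerXn2r// nnegrE// ltW.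
have D1 : 0 < e ^+ 2 + z ^+ 2 by exact: poisson_den_gt0.
have D2 : 0 < 1 + z ^+ 2 by rewrite ltr_wpDl.
rewrite ler_pdivrMr// (_ : _ * _ * _ * _ = 2 * e * ((1 + r ^- 2) * (e ^+ 2 + z ^+ 2) / (1 + z ^+ 2))); last first.
  by field; rewrite !gt_eqF.
rewrite ler_peMr ?mulr_ge0 ?(ltW e0)// ler_pdivlMr// mul1r.
apply: (@le_trans _ _ ((1 + r ^- 2) * z ^+ 2)).
  rewrite mulrDl mul1r addrC lerD2l mulrC ler_pdivlMr ?exprn_gt0//.
  by rewrite mul1r.
by rewrite ler_wpM2l ?addr_ge0 ?invr_ge0 ?exprn_ge0 ?(ltW r0)// lerDr sqr_ge0.
Qed.

(** The Poisson kernels are an approximate identity of mass 2 pi. *)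
Lemma poisson_approx (phi : R -> R) M x : measurable_fun [set: R] phi ->
  (forall y, `|phi y| <= M) -> {for x, continuous phi} ->
  (fun n => \int[mu]_y (phi y * poisson (eps_ n) (x - y))) @ \oo --> 2 * pi * phi x.
Proof.
move=> mphi phiM cphi.
have M0 : 0 <= M by rewrite (le_trans _ (phiM 0)).
have mphix : measurable_fun [set: R] (fun z => phi (x - z)).
  by apply: (measurableT_comp mphi); exact: measurable_funB.
have Lphi n : L1 (fun z => poisson (eps_ n) z * phi (x - z)).
  by apply: (L1M_bdd (M := M)) => //; apply: L1_poisson; exact: eps_gt0.
have E n : \int[mu]_y (phi y * poisson (eps_ n) (x - y)) - 2 * pi * phi x =
    \int[mu]_z (poisson (eps_ n) z * (phi (x - z) - phi x)).
  rewrite -(Rint_shiftN x (f := fun y => phi y * poisson (eps_ n) (x - y))); last first.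
    apply: eq_L1 (L1_shiftN x (Lphi n)) => z /=.
    by rewrite mulrC; congr (phi _ * _); ring.
  rewrite -(proj2 (poisson_integral (eps_gt0 n))) [X in _ - X]mulrC -RintZ; last by apply: L1_poisson; exact: eps_gt0.
  rewrite -RintB; first last.
  - by apply: L1Z; apply: L1_poisson; exact: eps_gt0.
  - apply: eq_L1 (Lphi n) => z /=; rewrite mulrC; congr (_ * poisson _ _); ring.
  apply: eq_Rint => z /=; rewrite mulrBr mulrC; congr (poisson _ _ * _ - _); first by ring.
  by rewrite mulrC.
apply/cvgrPdist_le => e e0.
have p0 := twopi_gt0.
have e40 : 0 < e / (2 * (2 * pi)) by rewrite divr_gt0// mulr_gt0.
have /cvgrPdist_le/(_ _ e40)[r /= r0 Hr] := cphi.
pose K := 2 * M * (1 + r ^- 2).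
have K0 : 0 <= K by rewrite !mulr_ge0 ?addr_ge0 ?invr_ge0 ?exprn_ge0 ?(ltW r0).
have /cvgrPdist_le C := cvg_eps.
have : 0 < e / (2 * (2 * pi) * (K + 1)) by apply: divr_gt0 => //; apply: mulr_gt0; [exact: mulr_gt0|rewrite ltr_wpDl].
move=> /C; apply: filterS => n; rewrite sub0r normrN gtr0_norm ?eps_gt0// => en.
rewrite distrC E.
have Lb : L1 (fun z => e / (2 * (2 * pi)) * poisson (eps_ n) z + K * eps_ n * poisson 1 z).
  by apply: L1D; apply: L1Z; apply: L1_poisson; rewrite ?eps_gt0.
have Ld : L1 (fun z => poisson (eps_ n) z * (phi (x - z) - phi x)).
  apply: (L1M_bdd (M := M + M)); first by apply: L1_poisson; exact: eps_gt0.
    exact: measurable_funB.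
  by move=> z; rewrite (le_trans (ler_normB _ _))// lerD.
apply: le_trans (Rint_norm Ld) _.
apply: (@le_trans _ _ (\int[mu]_z (e / (2 * (2 * pi)) * poisson (eps_ n) z + K * eps_ n * poisson 1 z))).
  apply: Rint_le => //; first exact: L1_abs.
  move=> z; rewrite normrM ger0_norm ?poisson_ge0 ?eps_gt0//.
  have [zr|rz] := ltP `|z| r.
    rewrite mulrC -[leLHS]addr0 lerD//; last first.
      by rewrite mulr_ge0 ?poisson_ge0// mulr_ge0// ltW// eps_gt0.
    rewrite ler_wpM2r ?poisson_ge0 ?eps_gt0// distrC; apply: Hr => /=.
    by rewrite opprB addrC subrK.
  rewrite -[leLHS]add0r lerD//.
    by rewrite mulr_ge0 ?poisson_ge0 ?eps_gt0// ltW.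
  apply: (@le_trans _ _ (eps_ n * (1 + r ^- 2) * poisson 1 z * (2 * M))).
    apply: ler_pM => //; rewrite ?poisson_ge0 ?eps_gt0//.
      exact: poisson_far (eps_gt0 n) r0 rz.
    by rewrite (le_trans (ler_normB _ _))// mulr2n mulrDl mul1r lerD.
  by rewrite /K le_eqVlt; apply/orP; left; apply/eqP; ring.
rewrite RintD; [|by apply: L1Z; apply: L1_poisson; rewrite ?eps_gt0..].
rewrite (RintZ _ (L1_poisson (eps_gt0 n))) (RintZ _ (L1_poisson ltr01)).
rewrite !(proj2 (poisson_integral _)) ?eps_gt0//.
apply: (@le_trans _ _ (e / 2 + e / 2)); last by rewrite -splitr.
move: p0 {e40 Hr Lb} en; move: (2 * pi : R) => P p0 en.
apply: lerD.
  by rewrite le_eqVlt; apply/orP; left; apply/eqP; field; rewrite gt_eqF.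
apply: (@le_trans _ _ ((K + 1) * (e / (2 * P * (K + 1))) * P)).
  rewrite ler_wpM2r ?(ltW p0)//; apply: ler_pM => //; first exact: ltW (eps_gt0 n).
  by rewrite lerDl.
rewrite le_eqVlt; apply/orP; left; apply/eqP; field.
by rewrite !gt_eqF// ltr_wpDl.
Qed.

Lemma L1_poisson_shift e c : 0 < e -> L1 (fun x => poisson e (x - c)).
Proof.
by move=> e0; apply: eq_L1 (L1_shift (- c) (L1_poisson e0)) => x; rewrite addrC.
Qed.

Lemma L2_poisson_shift e c : 0 < e -> L2 (fun x => poisson e (x - c)).
Proof.
move=> e0; apply: eq_L2 (L2_shiftN c (L2_poisson e0)) => x.
by rewrite -poissonN opprB.
Qed.

(** Inversion for the Poisson kernels: test H (poisson) against the convergence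
    factors, move H to the other side, and use the approximate identity. *)
Lemma hartley_poisson e c x : 0 < e ->
  H (fun xi => poisson e (xi - c)) x = 2 * pi * (lap e x * cas (x * c)).
Proof.
move=> e0; pose f y := lap e y * cas (y * c); pose G xi := poisson e (xi - c).
have L1f : L1 f by exact: L1_lap_cas.
have LG : L1 G by exact: L1_poisson_shift.
have HfG : H f = G by apply/funext => xi; exact: hartley_lap_cas.
have A : (fun n => \int[mu]_xi (G xi * (lap (eps_ n) xi * cas (xi * x)))) @ \oo --> H G x.
  rewrite hartleyE.
  have [||||//] := @dominated_cvgR (fun n xi => G xi * (lap (eps_ n) xi * cas (xi * x)))
    (fun xi => G xi * cas (xi * x)) (fun xi => 2 * `|G xi|).
  - move=> n; apply: measurable_funM; first exact: L1_measurable.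
    by apply: measurable_funM; [exact: measurable_lap|exact: measurable_casM].
  - exact/L1Z/L1_abs.
  - move=> n xi; rewrite normrM mulrC ler_wpM2r// normrM -[leRHS]mul1r ler_pM//.
      by rewrite ger0_norm ?lap_ge0// lap_le1// ltW// eps_gt0.
    exact: cas_norm.
  - move=> xi; apply: cvgMr; rewrite -[X in _ --> X]mul1r; apply: cvgMl; exact: cvg_lap1.
have B : (fun n => \int[mu]_xi (G xi * (lap (eps_ n) xi * cas (xi * x)))) @ \oo --> 2 * pi * f x.
  have -> : (fun n => \int[mu]_xi (G xi * (lap (eps_ n) xi * cas (xi * x)))) =
     (fun n => \int[mu]_y (f y * poisson (eps_ n) (x - y))).
    apply/funext => n; rewrite -HfG -hartley_adjoint//; last exact: L1_lap_cas (eps_gt0 n).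
    apply: eq_Rint => y; rewrite hartley_lap_cas ?eps_gt0//; congr (_ * _).
    by rewrite -poissonN opprB.
  apply: (@poisson_approx _ 2).
  - exact: L1_measurable.
  - move=> y; rewrite /f normrM -[leRHS]mul1r ler_pM ?cas_norm//.
    by rewrite ger0_norm ?lap_ge0// lap_le1// ltW.
  - apply: cvgM; first exact: continuous_lap.
    exact: continuous_casM.
exact: cvg_unique A B.
Qed.

Lemma hartley_hartley_poisson e c x : 0 < e ->
  H (H (fun xi => poisson e (xi - c))) x = 2 * pi * poisson e (x - c).
Proof.
move=> e0; rewrite -hartley_lap_cas// -hartleyZ; last exact: L1_lap_cas.
by apply: eq_hartley => y; rewrite hartley_poisson.
Qed.

Lemma ae_neq c : {ae mu, forall x, x <> c}.
Proof.
exists [set c]; split => //; first exact: lebesgue_measure_set1.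
by move=> x /= /contrapT.
Qed.

Lemma box_continuous c d x : x <> c -> x <> d -> {for x, continuous (box c d)}.
Proof.
move=> xc xd; apply: cvg_near_cst.
have [xltc|cltx|/esym//] := ltgtP x c.
- near=> y; rewrite !boxE (ltNge c x) (ltW xltc)/= (ltNge c y).
  suff -> : y <= c by [].
  by near: y; exact: lt_le_nbhsl.
- have [xltd|dltx|//] := ltgtP x d.
  + near=> y; rewrite !boxE cltx (ltW xltd)/=.
    suff -> : (c < y <= d)%R by [].
    apply/andP; split; first by near: y; exact: lt_nbhsr.
    by near: y; exact: lt_le_nbhsl.
  + near=> y; rewrite !boxE (leNgt x) dltx andbF (leNgt y).
    suff -> : d < y by rewrite andbF.
    by near: y; exact: lt_nbhsr.
Unshelve. all: by end_near. Qed.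

Lemma poisson_le_1 n y : 1 <= `|y| -> poisson (eps_ n) y <= 2 * poisson 1 y.
Proof.
move=> y1; apply: le_trans (poisson_far (eps_gt0 n) ltr01 y1) _.
rewrite ler_wpM2r ?poisson_ge0// expr1n invr1 -[leRHS]mul1r ler_pM//.
- exact: ltW (eps_gt0 n).
- exact: eps_le1.
Qed.

(** A domination by an integrable function, uniform in the scale of the kernel,
    for the Poisson means of an interval: the trivial bound 2 pi for small y,
    the decay of the kernel for large y. *)
Lemma poisson_box_le c d n y : c < d ->
  \int[mu]_a (box c d a * poisson (eps_ n) (y - a)) <=
  (pi * (1 + 4 * (1 + `|c| + `|d|) ^+ 2) + 16 * (d - c)) * poisson 1 y.
Proof.
move=> cd; set m := 1 + `|c| + `|d|.
have m1 : 1 <= m by rewrite /m -addrA lerDl addr_ge0.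
have P0 : 0 <= poisson 1 y by exact: poisson_ge0.
have LP : L1 (fun a => poisson (eps_ n) (y - a)) by apply: L1_shiftN; exact: L1_poisson (eps_gt0 n).
have LbP : L1 (fun a => box c d a * poisson (eps_ n) (y - a)).
  apply: eq_L1 (L1M_bdd (M := 1) LP (measurable_box c d) (box_norm c d)) => a.
  by rewrite mulrC.
have pi0 := pi_gt0 R.
have dc0 : 0 <= d - c by rewrite subr_ge0 ltW.
have Db : \int[mu]_x box c d x = d - c.
  apply: EFin_inj; rewrite EFin_Rint; last exact: L1_box.
  by rewrite /box integral_indic//= setIT lebesgue_measure_itv/= lte_fin cd EFinB.
rewrite mulrDl; have [ym|my] := leP `|y| (2 * m).
  apply: ler_wpDr; first by rewrite mulr_ge0// mulr_ge0.
  apply: (@le_trans _ _ (2 * pi)).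
    rewrite -(proj2 (poisson_integral (eps_gt0 n))) -(Rint_shiftN y (L1_poisson (eps_gt0 n))).
    apply: Rint_le => // a; rewrite ler_piMl ?box_le1// poisson_ge0// eps_gt0//.
  rewrite mulrC -mulrA ler_wpM2l ?(ltW pi0)// poissonE expr1n mulr1 mulrA.
  rewrite ler_pdivlMr ?ltr_wpDr ?sqr_ge0// mulrC ler_wpM2r// lerD2l.
  have -> : 4 * m ^+ 2 = (2 * m) ^+ 2 by ring.
  by rewrite -(normK y) lerXn2r// nnegrE// mulr_ge0// (le_trans ler01).
apply: ler_wpDl; first by rewrite mulr_ge0// mulr_ge0 ?(ltW pi0)// addr_ge0// mulr_ge0// sqr_ge0.
apply: (@le_trans _ _ (\int[mu]_a ((16 * poisson 1 y) * box c d a))).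
  apply: Rint_le => //; first exact/L1Z/L1_box.
  move=> a; rewrite mulrC boxE; case: (boolP (_ && _)); last by rewrite !mulr0.
  move=> /andP[ca ad]; rewrite !mulr1.
  have am : `|a| <= m - 1.
    rewrite (_ : m - 1 = `|c| + `|d|) ?ler_norml; last by rewrite /m; ring.
    apply/andP; split.
      by rewrite (le_trans _ (ltW ca))// lerNl (le_trans (ler_norm _))// normrN lerDl.
    by rewrite (le_trans ad)// (le_trans (ler_norm _))// lerDr.
  have ya : `|y| / 2 <= `|y - a|.
    have := lerB_dist y a; have := my; have := am; have := normr_ge0 a; nra.
  have y1 : 1 <= `|y - a| by apply: le_trans ya; rewrite ler_pdivlMr// mul1r; lra.
  apply: le_trans (poisson_le_1 n y1) _.
  rewrite !poissonE expr1n mulr1 mulrA [leRHS]mulrA.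
  have ya2 : y ^+ 2 / 4 <= (y - a) ^+ 2.
    rewrite -(normK y) -(normK (y - a)) (_ : _ / 4 = (`|y| / 2) ^+ 2); last by field.
    by rewrite lerXn2r// nnegrE divr_ge0.
  rewrite ler_pdivrMr ?ltr_wpDr ?sqr_ge0// mulrAC ler_pdivlMr ?ltr_wpDr ?sqr_ge0//.
  by have := sqr_ge0 y; lra.
rewrite (RintZ _ (L1_box c d)) Db le_eqVlt; apply/orP; left; apply/eqP; ring.
Qed.

(** The translates of the Poisson kernels are total in L^2: integrating them
    over an interval of centres produces approximations of its indicator. *)
Lemma poisson_total k : L2 k ->
  (forall n c, \int[mu]_y (k y * poisson (eps_ n) (y - c)) = 0) ->
  {ae mu, forall x, k x = 0}.
Proof.
move=> Lk Hk; have mk := L2_measurable Lk.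
apply: L2_ae0_box => // c d cd.
pose A n y := \int[mu]_a (box c d a * poisson (eps_ n) (y - a)).
have mP n : measurable_fun setT (fun z : R * R => poisson (eps_ n) (z.2 - z.1)).
  apply: (measurableT_comp (measurable_poisson (eps_gt0 n))); exact: measurable_funB.
have I0 n : \int[mu]_y (k y * A n y) = 0.
  pose F (z : R * R) : R := box c d z.1 * (k z.2 * poisson (eps_ n) (z.2 - z.1)).
  have mF : measurable_fun setT F.
    apply: measurable_funM; first exact: (measurableT_comp (measurable_box c d)).
    by apply: measurable_funM => //; exact: (measurableT_comp mk).
  have LkP a : L1 (fun y => k y * poisson (eps_ n) (y - a)).
    by apply: L2M => //; apply: L2_poisson_shift; exact: eps_gt0.
  have LF a : L1 (fun y => F (a, y)) by exact: (L1Z (box c d a) (LkP a)).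
  have n2P a : n2 (fun y => poisson (eps_ n) (y - a)) = n2 (poisson (eps_ n)).
    rewrite -(n2_shiftN a (L2_poisson (eps_gt0 n))); apply: eq_n2 => y.
    by rewrite -poissonN opprB.
  have Labs : L2 (fun y => `|k y|).
    apply: L2_le Lk _; first exact: measurableT_comp.
    by move=> y; rewrite normr_id.
  have [||_ _ _ E] := @fubiniR F (fun a => (n2 (fun y => `|k y|) * n2 (poisson (eps_ n))) * box c d a) mF LF.
  - exact/L1Z/L1_box.
  - move=> a; rewrite /F /= mulrC.
    rewrite (eq_Rint (g := fun y => box c d a * (`|k y| * poisson (eps_ n) (y - a)))); last first.
      by move=> y; rewrite normrM (ger0_norm (box_ge0 c d a)) normrM (poisson_norm _ (eps_gt0 n)).
    rewrite RintZ; last by apply: L2M => //; apply: L2_poisson_shift; exact: eps_gt0.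
    rewrite ler_wpM2l ?box_ge0// -(n2P a) (le_trans (ler_norm _))// cauchy_schwarz//.
    by apply: L2_poisson_shift; exact: eps_gt0.
  transitivity (\int[mu]_y (\int[mu]_a F (a, y))).
    apply: eq_Rint => y; rewrite /A /F /= -RintZ; first by apply: eq_Rint => a; ring.
    apply: L2M; first exact: L2_box.
    by apply: L2_shiftN; apply: L2_poisson; exact: eps_gt0.
  rewrite -E -[RHS]Rint0; apply: eq_Rint => a.
  by rewrite /F /= (RintZ _ (LkP a)) Hk mulr0.
have mA n : measurable_fun [set: R] (A n).
  apply: (@measurable_Rint (fun z => box c d z.2 * poisson (eps_ n) (z.1 - z.2))).
  apply: measurable_funM; first exact: (measurableT_comp (measurable_box c d)).
  apply: (measurableT_comp (measurable_poisson (eps_gt0 n))); exact: measurable_funB.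
set C := pi * (1 + 4 * (1 + `|c| + `|d|) ^+ 2) + 16 * (d - c).
have A0 n y : 0 <= A n y.
  by apply: Rint_ge0 => a; rewrite mulr_ge0 ?box_ge0// poisson_ge0// eps_gt0.
have Labs : L2 (fun y => `|k y|).
  apply: L2_le Lk _; first exact: measurableT_comp.
  by move=> y; rewrite normr_id.
have := @dominated_cvg_ae (fun n y => k y * A n y) (fun y => k y * (2 * pi * box c d y))
   (fun y => C * (`|k y| * poisson 1 y)).
have -> : (fun n => \int[mu]_y (k y * A n y)) = cst 0 by apply/funext => n; exact: I0.
move=> H; have {H} : cst (0 : R) @ \oo --> \int[mu]_y (k y * (2 * pi * box c d y)).
  apply: H.
  - by move=> n; exact: measurable_funM.
  - by apply: measurable_funM => //; apply: measurable_funM => //; exact: measurable_box.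
  - by apply: L1Z; apply: L2M => //; exact: L2_poisson.
  - move=> n y; rewrite normrM mulrCA ler_wpM2l// ger0_norm//.
    exact: poisson_box_le.
  - apply: ae_S (ae_I (ae_neq c) (ae_neq d)) => y [yc yd].
    apply: cvgMr; apply: (@poisson_approx _ 1); [exact: measurable_box|exact: box_norm|].
    exact: box_continuous.
move/(cvg_lim (@Rhausdorff R)); rewrite lim_cst// => /esym.
rewrite (eq_Rint (g := fun y => (2 * pi) * (box c d y * k y))); last by move=> y; ring.
rewrite RintZ; last by apply: L2M => //; exact: L2_box.
by move/eqP; rewrite mulf_eq0 gt_eqF ?twopi_gt0//= => /eqP.
Qed.

(** h and the transform of its inverse transform have the same pairings with
    all Poisson kernels, for which inversion is known. *)
Lemma is_hartley_inv h : L1 h -> L2 h -> is_hartley (fun x => (2 * pi)^-1 * H h x) h.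
Proof.
move=> L1h L2h; have [LH _] := bessel L1h L2h.
set f := fun x => _.
have Lf : L2 f by exact: L2Z.
have [g hg] := is_hartley_ex Lf; have Lg := proj1 hg.
apply: (is_hartley_ae_r (proj1 L2h) hg Lf).
have : {ae mu, forall x, g x - h x = 0}.
  apply: poisson_total; first exact: L2B.
  move=> n c; have e0 := eps_gt0 n.
  have L1p := L1_poisson_shift c e0; have L2p := L2_poisson_shift c e0.
  have L1Hp : L1 (H (fun y => poisson (eps_ n) (y - c))).
    apply: eq_L1 (L1Z (2 * pi) (L1_lap_cas c e0)) => x.
    by rewrite hartley_poisson.
  rewrite (eq_Rint (g := fun y => g y * poisson (eps_ n) (y - c) - h y * poisson (eps_ n) (y - c))).
    rewrite RintB; [|exact: L2M|exact: L2M].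
    rewrite (is_hartley_adjoint Lf hg)//.
    rewrite (eq_Rint (g := fun x => (2 * pi)^-1 * (H h x * H (fun y => poisson (eps_ n) (y - c)) x))).
      rewrite RintZ; last by apply: L2M => //; have [] := bessel L1p L2p.
      rewrite -hartley_adjoint// (eq_Rint (g := fun x => (2 * pi) * (h x * poisson (eps_ n) (x - c)))).
        rewrite RintZ ?mulKf ?subrr// ?gt_eqF ?twopi_gt0//; exact: L2M.
      by move=> x; rewrite hartley_hartley_poisson//; ring.
    by move=> x; rewrite /f mulrA.
  by move=> y; rewrite mulrBl.
by apply: ae_S => x /eqP; rewrite subr_eq0 => /eqP.
Qed.

(** f and the inverse transform of h have the same transform, so their
    difference pairs to zero with the transforms of the functions lap * cas,
    which are the Poisson kernels. *)
Lemma hartley_inversion f h : L2 f -> is_hartley f h -> L1 h ->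
  {ae mu, forall x, f x = (2 * pi)^-1 * H h x}.
Proof.
move=> Lf hf L1h; have L2h := proj1 hf.
set f' := fun x => (2 * pi)^-1 * H h x.
have Lf' : L2 f' by apply: L2Z; have [] := bessel L1h L2h.
have hd := is_hartleyB Lf Lf' hf (is_hartley_inv L1h L2h).
have Ld : L2 (fun x => f x - f' x) by exact: L2B.
have : {ae mu, forall x, f x - f' x = 0}.
  apply: poisson_total => // n c; have e0 := eps_gt0 n.
  pose g x := 2 * pi * (lap (eps_ n) x * cas (x * c)).
  have L1g : L1 g by apply: L1Z; exact: L1_lap_cas.
  have L2g : L2 g by apply: L2Z; exact: L2_lap_cas.
  have := is_hartley_adjoint Ld hd L1g L2g.
  rewrite (eq_Rint (g := cst 0)) => [|x]; last by rewrite subrr mul0r.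
  rewrite Rint0 (eq_Rint (g := fun x => (2 * pi) * ((f x - f' x) * poisson (eps_ n) (x - c)))).
    rewrite RintZ; last by apply: L2M => //; exact: L2_poisson_shift.
    by move/esym/eqP; rewrite mulf_eq0 gt_eqF ?twopi_gt0//= => /eqP.
  by move=> x; rewrite hartleyZ ?hartley_lap_cas//; [ring|exact: L1_lap_cas].
by apply: ae_S => x /eqP; rewrite subr_eq0 => /eqP.
Qed.

Lemma parseval f g h k : L2 f -> is_hartley f h -> L2 g -> is_hartley g k -> L1 k ->
  \int[mu]_x (h x * k x) = 2 * pi * \int[mu]_x (f x * g x).
Proof.
move=> Lf hf Lg hg L1k; have L2k := proj1 hg.
rewrite (is_hartley_adjoint Lf hf L1k L2k).
rewrite -RintZ; last exact: L2M.
apply: Rint_ae.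
- apply: measurable_funM; first by case: Lf.
  by apply: measurable_hartley; exact: L1_measurable.
- by apply: measurable_funM => //; apply: measurable_funM; [case: Lf|case: Lg].
- apply: ae_S (hartley_inversion Lg hg L1k) => x ->.
  by rewrite [RHS]mulrCA mulVKf// gt_eqF ?twopi_gt0.
Qed.

Lemma continuous_hartley f : L1 f -> continuous (H f).
Proof.
move=> Lf x.
have := @continuity_under_integral R _ _ mu (fun l y => f y * cas (y * l)) setT measurableT
  (x - 1) (x + 1) (fun l _ => L1_cas l Lf) _ (fun y => 2 * `|f y|) _ _.
move=> /(_ _ _ _ x); apply.
- apply: aeW => y _ l _; apply: cvgMr.
  by apply: continuous_comp; [apply: cvgMr; exact: cvg_id|exact: continuous_cas].
- exact/L1Z/L1_abs.
- by move=> l _; apply: aeW => y _; rewrite normrM mulrC ler_wpM2r// cas_norm.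
- by rewrite inE/= in_itv/= ltrBlDr ltrDl ltr01.
Qed.

(** * Weighted L^2 spaces *)

Definition wt p x : R := (1 + x ^+ 2) `^ p.

Lemma onesqr_gt0 x : 0 < 1 + x ^+ 2.
Proof. by rewrite ltr_wpDr ?sqr_ge0. Qed.

Lemma onesqr_ge1 x : 1 <= 1 + x ^+ 2.
Proof. by rewrite lerDl sqr_ge0. Qed.

Lemma wt_gt0 p x : 0 < wt p x.
Proof. by rewrite powR_gt0// onesqr_gt0. Qed.

Lemma wt_ge0 p x : 0 <= wt p x.
Proof. exact: ltW (wt_gt0 p x). Qed.

Lemma wt_ge1 p x : 0 <= p -> 1 <= wt p x.
Proof. by move=> p0; rewrite -(powRr0 (1 + x ^+ 2)) ler_powR// onesqr_ge1. Qed.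

Lemma wtN p x : wt p (- x) = wt p x.
Proof. by rewrite /wt sqrrN. Qed.

Lemma wt0 x : wt 0 x = 1.
Proof. by rewrite /wt powRr0. Qed.

Lemma wtD p q x : wt (p + q) x = wt p x * wt q x.
Proof. by rewrite /wt powRD// (gt_eqF (onesqr_gt0 x)) implybT. Qed.

Lemma wt1 x : wt 1 x = 1 + x ^+ 2.
Proof. by rewrite /wt powRr1// ltW// onesqr_gt0. Qed.

Lemma wt_half_sqr x : wt 2^-1 x ^+ 2 = 1 + x ^+ 2.
Proof. by rewrite expr2 -wtD -wt1; congr wt; field. Qed.

Lemma wtNp p x : wt (- p) x = (wt p x)^-1.
Proof. by rewrite /wt powRN. Qed.

Lemma le_wt p q x : p <= q -> wt p x <= wt q x.
Proof. by move=> pq; rewrite ler_powR// onesqr_ge1. Qed.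

Lemma measurable_wt p : measurable_fun [set: R] (wt p).
Proof.
apply: (@measurableT_comp _ _ _ _ _ _ (fun y => y `^ p)); first exact: measurable_powR.
by apply: measurable_funD => //; exact: measurable_funX.
Qed.

(** Hartley transforms of functions in H^(2p). *)
Definition W p h : Prop := L2 (fun x => wt p x * h x).
Definition nW p h : R := n2 (fun x => wt p x * h x).

Lemma W_measurable p h : W p h -> measurable_fun [set: R] h.
Proof.
move=> [mh _]; have := measurable_funM (measurable_wt (- p)) mh.
congr measurable_fun; apply/funext => x /=.
by rewrite wtNp mulKf// gt_eqF ?wt_gt0.
Qed.

Lemma W_L2 p h : 0 <= p -> W p h -> L2 h.
Proof.
move=> p0 Wh; apply: (L2_le _ Wh); first exact: W_measurable Wh.
by move=> x; rewrite normrM ler_peMl// ger0_norm ?wt_ge0 ?wt_ge1.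
Qed.

Lemma W_le p q h : p <= q -> W q h -> W p h.
Proof.
move=> pq Wh; apply: (L2_le _ Wh).
  by apply: measurable_funM; [exact: measurable_wt|exact: W_measurable Wh].
by move=> x; rewrite !normrM ler_wpM2r// !ger0_norm ?wt_ge0// le_wt.
Qed.

Lemma nW_le p q h : p <= q -> W q h -> nW p h <= nW q h.
Proof.
move=> pq Wh; apply: n2_le => //; first exact: W_le Wh.
by move=> x; rewrite !normrM ler_wpM2r// !ger0_norm ?wt_ge0// le_wt.
Qed.

Lemma nW_ge0 p h : 0 <= nW p h.
Proof. exact: n2_ge0. Qed.

Lemma WD p f g : W p f -> W p g -> W p (fun x => f x + g x).
Proof. by move=> Wf Wg; apply: eq_L2 (L2D Wf Wg) => x; rewrite mulrDr. Qed.

Lemma WZ p c f : W p f -> W p (fun x => c * f x).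
Proof. by move=> Wf; apply: eq_L2 (L2Z c Wf) => x; rewrite mulrCA. Qed.

Lemma WB p f g : W p f -> W p g -> W p (fun x => f x - g x).
Proof. by move=> Wf Wg; apply: eq_L2 (L2B Wf Wg) => x; rewrite mulrBr. Qed.

Lemma W_0 p : W p (cst 0).
Proof. by apply: eq_L2 L20 => x; rewrite /= mulr0. Qed.

Lemma nW_0 p : nW p (cst 0) = 0.
Proof. by rewrite /nW (@eq_n2 _ (cst 0)) ?n20// => x; rewrite /= mulr0. Qed.

Lemma eq_nW p f g : f =1 g -> nW p f = nW p g.
Proof. by move=> /funext ->. Qed.

Lemma nWD p f g : W p f -> W p g -> nW p (fun x => f x + g x) <= nW p f + nW p g.
Proof.
move=> Wf Wg; rewrite /nW (@eq_n2 _ (fun x => wt p x * f x + wt p x * g x)).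
  exact: ler_n2D.
by move=> x; rewrite mulrDr.
Qed.

Lemma nWZ p c f : W p f -> nW p (fun x => c * f x) = `|c| * nW p f.
Proof.
move=> Wf; rewrite /nW -n2Z//; apply: eq_n2 => x; by rewrite mulrCA.
Qed.

Lemma nWBC p f g : nW p (fun x => f x - g x) = nW p (fun x => g x - f x).
Proof.
rewrite /nW -n2N; apply: eq_n2 => x; ring.
Qed.

Lemma nWB p f g : W p f -> W p g -> nW p (fun x => f x - g x) <= nW p f + nW p g.
Proof.
move=> Wf Wg; rewrite /nW (@eq_n2 _ (fun x => wt p x * f x - wt p x * g x)).
  exact: ler_n2B.
by move=> x; rewrite mulrBr.
Qed.

Lemma nW_tri p f g h : W p f -> W p g -> W p h ->
  nW p (fun x => f x - h x) <= nW p (fun x => f x - g x) + nW p (fun x => g x - h x).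
Proof.
move=> Wf Wg Wh; rewrite (@eq_nW _ _ (fun x => (f x - g x) + (g x - h x))).
  by apply: nWD; exact: WB.
by move=> x; ring.
Qed.

Lemma W_sum p (n : nat) (F : 'I_n -> R -> R) : (forall i, W p (F i)) ->
  W p (fun x => \sum_(i < n) F i x).
Proof.
move=> WF; apply: eq_L2 (L2_sum (F := fun i x => wt p x * F i x) WF) => x.
by rewrite mulr_sumr.
Qed.

Lemma nW_sum p (n : nat) (F : 'I_n -> R -> R) : (forall i, W p (F i)) ->
  nW p (fun x => \sum_(i < n) F i x) <= \sum_(i < n) nW p (F i).
Proof.
move=> WF; have := n2_sum (F := fun i x => wt p x * F i x) WF.
by rewrite /nW (@eq_n2 (fun x => wt p x * \sum_(i < n) F i x) (fun x => \sum_(i < n) wt p x * F i x))// => x; rewrite mulr_sumr.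
Qed.

Lemma W_complete p (f_ : nat -> R -> R) : (forall n, W p (f_ n)) ->
  (forall e, 0 < e -> exists N, forall m n, (N <= m)%N -> (N <= n)%N ->
     nW p (fun x => f_ m x - f_ n x) <= e) ->
  exists f, W p f /\ (fun n => nW p (fun x => f_ n x - f x)) @ \oo --> 0.
Proof.
move=> Wf Cf.
have [e e0|g [Lg Cg]] := L2_complete Wf.
  have [N HN] := Cf e e0; exists N => m n Nm Nn.
  rewrite (@eq_n2 _ (fun x => wt p x * (f_ m x - f_ n x))); first exact: HN.
  by move=> x; rewrite mulrBr.
have E x : wt p x * (wt (- p) x * g x) = g x.
  by rewrite wtNp mulVKf// gt_eqF ?wt_gt0.
exists (fun x => wt (- p) x * g x); split.
  by apply: eq_L2 Lg => x; rewrite E.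
rewrite (_ : (fun n => _) = (fun n => n2 (fun x => wt p x * f_ n x - g x)))//.
by apply/funext => n; apply: eq_n2 => x; rewrite mulrBr E.
Qed.

(** * Sobolev norms through the Hartley transform *)

Lemma Lfun2P f : f \in Lfun mu 2%:E <-> L2 f.
Proof.
split=> [Lf|[mf Lf]].
  split; last exact: Lfun2_integrable_sqr Lf.
  by move: Lf; rewrite inE => /andP[]; rewrite inE.
rewrite inE; apply/andP; split; rewrite inE//=.
rewrite /finite_norm unlock /= poweR_lty//.
have E x : `|f x| `^ 2 = f x ^+ 2 by rewrite powR_mulrn// normK.
under eq_integral do rewrite E.
by rewrite -EFin_Rint// ltry.
Qed.

Lemma n2E f : n2 f = Num.sqrt (\int[mu]_x (f x ^+ 2)).
Proof. by rewrite -sqr_n2 sqrtr_sqr ger0_norm ?n2_ge0. Qed.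

Lemma Lnorm2E f : L2 f -> ('N[mu]_2%:E[EFin \o f] = (n2 f)%:E)%E.
Proof.
move=> [mf Lf]; rewrite unlock /=.
have E x : `|f x| `^ 2 = f x ^+ 2 by rewrite powR_mulrn// normK.
under eq_integral do rewrite E.
rewrite -EFin_Rint//= powR12_sqrt ?n2E//.
by apply: Rint_ge0 => x; exact: sqr_ge0.
Qed.

Lemma Rint_itv_cc (n : nat) g : measurable_fun [set: R] g ->
  L1 (fun x => box (- n%:R) n%:R x * g x) ->
  \int[mu]_(x in `[- n%:R, n%:R]) g x = \int[mu]_x (box (- n%:R) n%:R x * g x).
Proof.
move=> mg Lg.
have E (x : R) : (g \_ (`]- n%:R, n%:R]%classic : set R)) x = box (- n%:R) n%:R x * g x.
  rewrite patchE boxE.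
  have -> : (x \in (`]- n%:R, n%:R]%classic : set R)) = (- n%:R < x <= n%:R)%R.
    by apply/idP/idP; rewrite inE/= in_itv.
  by case: ifP; rewrite ?mul1r ?mul0r.
rewrite -Rintegral_itv_obnd_cbnd.
  by rewrite Rintegral_mkcond; apply: eq_Rintegral => x _; exact: E.
apply/integrable_mkcond => //; apply: eq_integrable Lg => // x _.
by rewrite /= restrict_EFin/= E.
Qed.

Lemma hartley_cos_sin f xi : L1 f ->
  \int[mu]_x (f x * cos (x * xi)) = (H f xi + H f (- xi)) / 2 /\
  \int[mu]_x (f x * sin (x * xi)) = (H f xi - H f (- xi)) / 2.
Proof.
move=> Lf.
have Lc : L1 (fun x => f x * cos (x * xi)).
  by apply: (L1M_bdd (M := 1)) => // [|x]; [exact: measurable_cosM|exact: cos_norm].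
have Ls : L1 (fun x => f x * sin (x * xi)).
  by apply: (L1M_bdd (M := 1)) => // [|x]; [exact: measurable_sinM|exact: sin_norm].
have -> : H f xi = \int[mu]_x (f x * cos (x * xi)) + \int[mu]_x (f x * sin (x * xi)).
  by rewrite hartleyE -RintD//; apply: eq_Rint => x; rewrite mulrDr.
have -> : H f (- xi) = \int[mu]_x (f x * cos (x * xi)) - \int[mu]_x (f x * sin (x * xi)).
  rewrite hartleyE -RintB//; apply: eq_Rint => x.
  by rewrite /cas mulrN cosN sinN mulrDr mulrN.
by split; field.
Qed.

Lemma fourier_truncE f n xi : L2 f ->
  fourier_trunc_Re f n xi = (H (cut n f) xi + H (cut n f) (- xi)) / 2 /\
  fourier_trunc_Im f n xi = (H (cut n f) (- xi) - H (cut n f) xi) / 2.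
Proof.
move=> Lf; have Lc := L2_cut_L1 n Lf; have mf := L2_measurable Lf.
have [Ec Es] := hartley_cos_sin xi Lc.
have Lcc : L1 (fun x => cut n f x * cos (x * xi)).
  by apply: (L1M_bdd (M := 1)) => // [|x]; [exact: measurable_cosM|exact: cos_norm].
have Lss : L1 (fun x => cut n f x * sin (x * xi)).
  by apply: (L1M_bdd (M := 1)) => // [|x]; [exact: measurable_sinM|exact: sin_norm].
split.
  rewrite -Ec /fourier_trunc_Re Rint_itv_cc.
  - by apply: eq_Rint => x; rewrite /cut mulrA.
  - by apply: measurable_funM => //; exact: measurable_cosM.
  - by apply: eq_L1 Lcc => x; rewrite /cut mulrA.
rewrite -(opprB (H _ xi)) mulNr -Es /fourier_trunc_Im Rint_itv_cc.
- by congr (- _); apply: eq_Rint => x; rewrite /cut mulrA.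
- by apply: measurable_funM => //; exact: measurable_sinM.
- by apply: eq_L1 Lss => x; rewrite /cut mulrA.
Qed.

Lemma L2_parity f c : L2 f -> L2 (fun x => (f x + c * f (- x)) / 2).
Proof.
move=> Lf; apply: eq_L2 (L2Z 2^-1 (L2D Lf (L2Z c (L2_reflect Lf)))) => x.
by rewrite mulrC.
Qed.

Lemma n2_parity f c : L2 f -> `|c| = 1 -> n2 (fun x => (f x + c * f (- x)) / 2) <= n2 f.
Proof.
move=> Lf c1; have Lr := L2_reflect Lf.
rewrite (@eq_n2 _ (fun x => 2^-1 * (f x + c * f (- x)))) => [|x]; last by rewrite mulrC.
rewrite n2Z; last by apply: L2D => //; exact: L2Z.
rewrite ger0_norm ?invr_ge0// mulrC ler_pdivrMr//.
apply: le_trans (ler_n2D Lf (L2Z c Lr)) _.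
by rewrite n2Z// c1 mul1r n2_reflect// mulr2n mulrDr mulr1.
Qed.

(** The even part of the Hartley transform is the real part of the Fourier
    transform, and its odd part is minus the imaginary part. *)
Definition fourier_of (h : R -> R) : (R -> R) * (R -> R) :=
  (fun x => (h x + 1 * h (- x)) / 2, fun x => - ((h x + -1 * h (- x)) / 2)).

Lemma is_fourier_of f h : L2 f -> is_hartley f h -> is_fourierL2 f (fourier_of h).
Proof.
move=> Lf [Lh Ch].
have Ld n : L2 (fun x => h x - H (cut n f) x) by apply: L2B => //; exact: L2_hartley_cut.
split; rewrite /fourier_of/=.
- by apply/Lfun2P; exact: L2_parity.
- by apply/Lfun2P; apply: L2N; exact: L2_parity.
- have -> : (fun n => 'N[mu]_2%:E[EFin \o ((fun x => (h x + 1 * h (- x)) / 2) \- fourier_trunc_Re f n)%R])%E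
      = (fun n => (n2 (fun x => ((h x - H (cut n f) x) + 1 * (h (- x) - H (cut n f) (- x))) / 2))%:E).
    apply/funext => n; rewrite -Lnorm2E; last by apply: (L2_parity 1) (Ld n).
    apply: eq_Lnorm => x; congr EFin => /=; rewrite (proj1 (fourier_truncE n x Lf)); by field.
  apply: cvg_EFin; first exact: nearW.
  by apply: (cvg_le0 _ _ Ch) => n; [exact: n2_ge0|apply: n2_parity (Ld n) _; rewrite normr1].
- have -> : (fun n => 'N[mu]_2%:E[EFin \o ((fun x => - ((h x + -1 * h (- x)) / 2)) \- fourier_trunc_Im f n)%R])%E
      = (fun n => (n2 (fun x => ((h x - H (cut n f) x) + -1 * (h (- x) - H (cut n f) (- x))) / 2))%:E).
    apply/funext => n; rewrite -n2N -Lnorm2E; last by apply: L2N; apply: (L2_parity (-1)) (Ld n).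
    apply: eq_Lnorm => x; congr EFin => /=; rewrite (proj2 (fourier_truncE n x Lf)); by field.
  apply: cvg_EFin; first exact: nearW.
  by apply: (cvg_le0 _ _ Ch) => n; [exact: n2_ge0|apply: n2_parity (Ld n) _; rewrite normrN normr1].
Qed.

Lemma L2_lim_uniq (t : nat -> R -> R) g g' : (forall n, L2 (t n)) -> L2 g -> L2 g' ->
  (fun n => n2 (fun x => g x - t n x)) @ \oo --> 0 ->
  (fun n => n2 (fun x => g' x - t n x)) @ \oo --> 0 -> {ae mu, forall x, g x = g' x}.
Proof.
move=> Lt Lg Lg' C C'.
have L : L2 (fun x => g x - g' x) by exact: L2B.
have : n2 (fun x => g x - g' x) = 0.
  apply/eqP; rewrite eq_le n2_ge0 andbT; apply/ler_addgt0Pl => e e0; rewrite addr0.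
  have /cvgrPdist_le/(_ e e0)[N _ /(_ N (leqnn N))] :
    (fun n => n2 (fun x => g x - t n x) + n2 (fun x => g' x - t n x)) @ \oo --> (0 : R).
    exact: (cvg0D C C').
  rewrite sub0r normrN ger0_norm ?addr_ge0 ?n2_ge0//; apply: le_trans.
  rewrite (@eq_n2 _ (fun x => (g x - t N x) - (g' x - t N x))); last by move=> x; ring.
  by apply: ler_n2B; exact: L2B.
by move/(n2_ae0 L); apply: ae_S => x /eqP; rewrite subr_eq0 => /eqP.
Qed.

(** Limits in the mean are unique almost everywhere, so the chosen Fourier
    transform is the one given by h. *)
Lemma fourierL2_ae f h : L2 f -> is_hartley f h ->
  [/\ measurable_fun [set: R] (fourierL2 f).1, measurable_fun [set: R] (fourierL2 f).2 &
  {ae mu, forall x, (fourierL2 f).1 x = (fourier_of h).1 x /\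
                    (fourierL2 f).2 x = (fourier_of h).2 x}].
Proof.
move=> Lf hf; have F1 := is_fourier_of Lf hf.
have F2 : is_fourierL2 f (fourierL2 f) by apply: (xgetPex (cst 0, cst 0)); exists (fourier_of h).
have [/Lfun2P L1a /Lfun2P L1b Ca Cb] := F1; have [/Lfun2P L2a /Lfun2P L2b Da Db] := F2.
have Lre n : L2 (fourier_trunc_Re f n).
  apply: eq_L2 (L2_parity 1 (L2_hartley_cut n Lf)) => x.
  by rewrite (proj1 (fourier_truncE n x Lf)) mul1r.
have Lim n : L2 (fourier_trunc_Im f n).
  apply: eq_L2 (L2N (L2_parity (-1) (L2_hartley_cut n Lf))) => x.
  by rewrite (proj2 (fourier_truncE n x Lf)); field.
have cv (g : R -> R) (t : nat -> R -> R) : L2 g -> (forall n, L2 (t n)) ->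
    'N[mu]_2%:E[EFin \o (g \- t n)%R]%E @[n --> \oo] --> (0 : \bar R) ->
    (fun n => n2 (fun x => g x - t n x)) @ \oo --> 0.
  move=> Lg Lt.
  have -> : (fun n => 'N[mu]_2%:E[EFin \o (g \- t n)%R])%E = (fun n => (n2 (fun x => g x - t n x))%:E).
    by apply/funext => n; rewrite -Lnorm2E//; exact: L2B.
  by move=> C; exact: (fine_cvg C).
split; [by case: L2a|by case: L2b|apply: ae_I].
- by apply: (L2_lim_uniq Lre) => //; exact: cv.
- by apply: (L2_lim_uniq Lim) => //; exact: cv.
Qed.

(** A Sobolev norm is a weighted L^2 norm of the Hartley transform: the cross
    terms of the even and odd parts of h cancel. *)
Lemma Hs_normP s f h : L2 f -> is_hartley f h ->
  ((Hs_norm s f < +oo)%E <-> W (s / 2) h) /\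
  (W (s / 2) h -> Hs_norm s f = (nW (s / 2) h / c2pi)%:E).
Proof.
move=> Lf hf; have Lh := proj1 hf.
have [ma mb Eab] := fourierL2_ae Lf hf.
pose m x := wt (s / 2) x * fourier_modulus f x.
have mm : measurable_fun [set: R] m.
  apply: measurable_funM; first exact: measurable_wt.
  apply: (@measurableT_comp _ _ _ _ _ _ (@Num.sqrt R)).
    by apply: continuous_measurable_fun; exact: sqrt_continuous.
  by apply: measurable_funM => //; apply: measurable_funD; exact: measurable_funX.
have P0 := twopi_gt0; have cP := sqr_c2pi.
pose r x := (2 * (2 * pi))^-1 * ((wt (s / 2) x * h x) ^+ 2 + (wt (s / 2) (- x) * h (- x)) ^+ 2).
have Em : {ae mu, forall x, m x ^+ 2 = r x}.
  apply: ae_S Eab => x [Ea Eb]; rewrite /m /fourier_modulus exprMn sqr_sqrtr; last first.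
    by rewrite divr_ge0 ?addr_ge0 ?sqr_ge0// ltW.
  rewrite Ea Eb /fourier_of /r wtN /=; move: P0; move: (2 * pi : R) => P P0.
  by field; rewrite gt_eqF.
have mwh : measurable_fun [set: R] (fun x => wt (s / 2) x * h x).
  by apply: measurable_funM; [exact: measurable_wt|case: Lh].
have mr : measurable_fun [set: R] r.
  apply: measurable_funM => //; apply: measurable_funD; first exact: measurable_funX.
  by apply: measurable_funX; exact: (measurableT_comp mwh measurable_opp).
have Lr : W (s / 2) h -> L1 r.
  by move=> [_ Wh]; apply: L1Z; apply: L1D => //; exact: L1_reflect Wh.
have Lm : W (s / 2) h -> L2 m.
  move=> Wh; split=> //; apply: (L1_ae _ (Lr Wh)); first exact: measurable_funX.
  by apply: ae_S Em => x ->.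
have HsE : Hs_norm s f = 'N[mu]_2%:E[EFin \o m]%E by [].
split; first split.
- move=> fin; have Lmm : L2 m.
    apply/Lfun2P; rewrite inE; apply/andP; split; rewrite inE//=.
  split=> //.
  have Lr' : L1 r.
    by apply: (L1_ae mr (proj2 Lmm)).
  apply: (L1_le _ (L1Z (2 * (2 * pi)) Lr')); first exact: measurable_funX.
  move=> x; rewrite ger0_norm ?sqr_ge0// /r mulVKf ?gt_eqF ?mulr_gt0 ?pi_gt0//.
  by rewrite lerDl sqr_ge0.
- by move=> /Lm Lmm; rewrite HsE Lnorm2E// ltry.
move=> Wh; rewrite HsE (Lnorm2E (Lm Wh)); congr EFin.
apply/eqP; rewrite -(@eqrXn2 _ 2)// ?n2_ge0 ?divr_ge0 ?n2_ge0 ?c2pi_ge0//.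
rewrite exprMn exprVn cP !sqr_n2.
rewrite (Rint_ae _ mr); [|exact: measurable_funX|exact: Em].
have [_ Wh2] := Wh.
rewrite /r RintZ; last by apply: L1D => //; exact: L1_reflect Wh2.
rewrite RintD//; last exact: L1_reflect Wh2.
rewrite (Rint_reflect Wh2); apply/eqP; move: P0; move: (2 * pi : R) => P P0.
by field; rewrite gt_eqF.
Qed.

(** * Inverse transforms as functions *)

Definition hat f : R -> R := xget (cst 0) [set h | is_hartley f h].
Definition ihat h x : R := (2 * pi)^-1 * H h x.

Lemma hatP f : L2 f -> is_hartley f (hat f).
Proof. by move=> /is_hartley_ex [h hf]; apply: (xgetPex (cst 0)); exists h. Qed.

Lemma continuous_ihat h : L1 h -> continuous (ihat h).
Proof. by move=> Lh x; apply: cvgMr; exact: continuous_hartley. Qed.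

(** A continuous function with integrable transform equals the inverse transform
    at every point, so slopes can be computed pointwise. *)
Lemma ihat_hat f h : L2 f -> continuous f -> is_hartley f h -> L1 h -> f =1 ihat h.
Proof.
move=> Lf cf hf Lh; apply: ae_eq_continuous => //; first exact: continuous_ihat.
exact: hartley_inversion.
Qed.

Lemma L2_ihat h : L1 h -> L2 h -> L2 (ihat h).
Proof. by move=> L1h L2h; apply: L2Z; have [] := bessel L1h L2h. Qed.

Lemma ihat_norm h x : L1 h -> `|ihat h x| <= pi^-1 * \int[mu]_y `|h y|.
Proof.
move=> Lh; have p0 := pi_gt0 R; rewrite /ihat normrM ger0_norm ?invr_ge0 ?(ltW twopi_gt0)//.
apply: (@le_trans _ _ ((2 * pi)^-1 * (2 * \int[mu]_y `|h y|))).
  by rewrite ler_wpM2l ?hartley_norm// invr_ge0 (ltW twopi_gt0).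
rewrite le_eqVlt; apply/orP; left; apply/eqP.
by move: p0; move: (pi : R) => P P0; field; rewrite gt_eqF.
Qed.

Lemma ihat_parseval h k : L1 h -> L2 h -> L1 k -> L2 k ->
  \int[mu]_x (h x * k x) = 2 * pi * \int[mu]_x (ihat h x * ihat k x).
Proof.
move=> L1h L2h L1k L2k.
by apply: parseval => //; [exact: L2_ihat|exact: is_hartley_inv|exact: L2_ihat|exact: is_hartley_inv].
Qed.

(** * Weighted L^1 bounds *)

Lemma cvg_lnS : @ln R (1 + x) @[x --> +oo%R] --> +oo%R.
Proof.
apply/cvgryPge => A; near=> x.
rewrite -(expRK A) ler_ln ?posrE ?expR_gt0//.
  by rewrite -lerBlDl; near: x; apply: nbhs_pinfty_ge; rewrite num_real.
rewrite ltr_wpDr//; near: x; apply: nbhs_pinfty_ge; rewrite num_real//.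
Unshelve. all: by end_near. Qed.

(** Compare with (1 + |x|)^(2 r), which has an explicit primitive. *)
Lemma L1_wt r : r < - 2^-1 -> L1 (wt r).
Proof.
move=> r12.
pose a := - (2 * r); have a1 : 0 < a - 1 by rewrite /a; lra.
pose F x : R := - (a - 1)^-1 * expR (- ((a - 1) * ln (1 + x))).
pose g x : R := expR (- (a * ln (1 + `|x|))).
have pos x : 0 < 1 + `|x| by rewrite ltr_wpDr.
have [||||||Lg _] := @even_FTC g F (- (a - 1)^-1 * 0).
- by move=> x; exact: expR_ge0.
- move=> x; apply: (@continuous_comp _ _ _ (fun x : R => - (a * ln (1 + `|x|))) expR); last exact: continuous_expR.
  apply: cvgN; apply: cvgMr.
  apply: (@continuous_comp _ _ _ (fun x : R => 1 + `|x|) (@ln R)); last exact: continuous_ln.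
  by apply: cvgD; [exact: cvg_cst|exact: norm_continuous].
- by move=> x; rewrite /g normrN.
- apply: cvgMr; apply: (cvg_comp (fun x : R => ln (1 + x)) (fun y : R => expR (- ((a - 1) * y)))).
    exact: cvg_lnS.
  exact: cvg_lap0.
- move=> x x0; have x1 : 0 < 1 + x by rewrite addr_gt0.
  have D1 : is_derive x 1 (fun y : R => 1 + y) 1.
    by apply: is_derive_eq; rewrite add0r mulr1.
  have D2 := is_derive1_ln x1.
  have D3 : is_derive x 1 (fun y : R => ln (1 + y)) ((1 + x)^-1).
    by apply: is_derive_eq; rewrite /GRing.scale/= mulr1.
  apply: is_derive_eq; rewrite /GRing.scale/= /g gtr0_norm//.
  have -> : - (a * ln (1 + x)) = - ((a - 1) * ln (1 + x)) + - ln (1 + x) by ring.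
  rewrite expRD [expR (- ln _)]expRN lnK ?posrE//.
  by field; rewrite !gt_eqF.
- apply: cvgMr; apply: (@continuous_comp _ _ _ (fun x : R => - ((a - 1) * ln (1 + x))) expR); last exact: continuous_expR.
  apply: cvgN; apply: cvgMr.
  apply: (@continuous_comp _ _ _ (fun x : R => 1 + x) (@ln R)); last by apply: continuous_ln; rewrite addr0.
  by apply: cvgD; [exact: cvg_cst|exact: cvg_id].
apply: (L1_le (measurable_wt r) (L1Z (2 `^ (- r)) Lg)) => x.
rewrite ger0_norm ?wt_ge0//.
have -> : g x = (((1 + `|x|) ^+ 2) `^ (- r))^-1.
  rewrite -powRN opprK /g -powR_mulrn ?(ltW (pos x))// -powRrM /powR gt_eqF ?pos//.
  by congr expR; rewrite /a; ring.
have -> : wt r x = (wt (- r) x)^-1 by rewrite wtNp invrK.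
have r0 : 0 <= - r by lra.
have A0 : 0 < ((1 + `|x|) ^+ 2) `^ (- r) by rewrite powR_gt0// exprn_gt0.
rewrite ler_pdivlMr// mulrC ler_pdivrMr ?wt_gt0//.
rewrite -powRM ?(ltW (onesqr_gt0 x))//; apply: ge0_ler_powR => //.
- by rewrite nnegrE sqr_ge0.
- by rewrite nnegrE mulr_ge0// ltW// onesqr_gt0.
- have := sqr_ge0 (1 - `|x|); rewrite -(normK x); have := normr_ge0 x; nra.
Qed.

Lemma L2_wt r : r < - 4^-1 -> L2 (wt r).
Proof.
move=> r4; split; first exact: measurable_wt.
apply: eq_L1 (@L1_wt (r + r) _) => [x|]; last by lra.
by rewrite wtD expr2.
Qed.

Lemma L2_abs f : L2 f -> L2 (fun x => `|f x|).
Proof.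
move=> Lf; apply: (L2_le _ Lf); last by move=> x; rewrite normr_id.
by apply: measurableT_comp => //; case: Lf.
Qed.

Lemma n2_abs f : L2 f -> n2 (fun x => `|f x|) = n2 f.
Proof.
move=> Lf; have La := L2_abs Lf.
by apply/eqP; rewrite eq_le; apply/andP; split; apply: n2_le => // x; rewrite normr_id.
Qed.

Definition K1 : R := n2 (wt (- 2^-1)).

Lemma K1_ge0 : 0 <= K1. Proof. exact: n2_ge0. Qed.

(** Cauchy-Schwarz against the square integrable weight; in physical variables
    this is the embedding of H^1 into bounded functions. *)
Lemma W_L1 h : W 2^-1 h -> L1 h /\ \int[mu]_x `|h x| <= K1 * nW 2^-1 h.
Proof.
move=> Wh; have L2w : L2 (wt (- 2^-1)) by apply: L2_wt; lra.
have E x : wt (- 2^-1) x * (wt 2^-1 x * h x) = h x.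
  by rewrite wtNp mulKf// gt_eqF ?wt_gt0.
have Lh : L1 h by apply: eq_L1 (L2M L2w Wh) => x; exact: E.
split=> //.
have La := L2_abs Wh.
have na : n2 (fun x => `|wt 2^-1 x * h x|) = nW 2^-1 h by exact: n2_abs.
rewrite -na (eq_Rint (g := fun x => wt (- 2^-1) x * `|wt 2^-1 x * h x|)); last first.
  by move=> x; rewrite -{1}(E x) normrM ger0_norm ?wt_ge0.
exact: le_trans (ler_norm _) (cauchy_schwarz L2w La).
Qed.

Definition K3 (q : R) : R := n2 (fun x => x * wt (- q) x).

(** The exponent 3 / 4 is the threshold s > 3 / 2 of the theorem: above it the
    derivative of a function in H^s has an integrable transform. *)
Lemma W_L1_id q h : 3 / 4 < q -> W q h ->
  L1 (fun x => x * h x) /\ \int[mu]_x `|x * h x| <= K3 q * nW q h.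
Proof.
move=> q34 Wh.
have L2w : L2 (fun x => x * wt (- q) x).
  have Lw : L2 (wt (2^-1 - q)) by apply: L2_wt; lra.
  apply: (L2_le _ Lw).
    by apply: measurable_funM => //; exact: measurable_wt.
  move=> x; rewrite wtD !normrM ler_wpM2r// [leRHS]ger0_norm ?wt_ge0//.
  rewrite -(@ler_pXn2r _ 2) ?nnegrE ?wt_ge0//.
  by rewrite wt_half_sqr normK lerDr.
have E x : (x * wt (- q) x) * (wt q x * h x) = x * h x.
  by rewrite wtNp -mulrA mulKf// gt_eqF ?wt_gt0.
have Lh : L1 (fun x => x * h x) by apply: eq_L1 (L2M L2w Wh) => x; exact: E.
split=> //.
rewrite /K3 /nW -(n2_abs L2w) -(n2_abs Wh).
rewrite (eq_Rint (g := fun x => `|x * wt (- q) x| * `|wt q x * h x|)); last first.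
  by move=> x; rewrite -{1}(E x) normrM.
exact: le_trans (ler_norm _) (cauchy_schwarz (L2_abs L2w) (L2_abs Wh)).
Qed.

(** * Differentiation *)

(** If h is the Hartley transform of f, this is the transform of the derivative
    of f: the reflection replaces the imaginary unit. *)
Definition dmul h x : R := - (x * h (- x)).

Lemma W_reflect p h : W p h -> W p (fun x => h (- x)).
Proof. by move=> /L2_reflect; apply: eq_L2 => x; rewrite wtN. Qed.

Lemma nW_reflect p h : W p h -> nW p (fun x => h (- x)) = nW p h.
Proof.
move=> Wh; rewrite /nW -[RHS](n2_reflect Wh); apply: eq_n2 => x; by rewrite wtN.
Qed.

Lemma W_L1_dmul q h : 3 / 4 < q -> W q h ->
  L1 (dmul h) /\ \int[mu]_x `|dmul h x| <= K3 q * nW q h.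
Proof.
move=> q34 Wh; have [L B] := W_L1_id q34 (W_reflect Wh).
rewrite -(nW_reflect Wh); split; first by apply: eq_L1 (L1Z (-1) L) => x; rewrite /dmul mulN1r.
by rewrite (eq_Rint (g := fun x => `|x * h (- x)|)) => [|x]; rewrite // /dmul normrN.
Qed.

Lemma W_L2_dmul h : W 2^-1 h -> L2 (dmul h).
Proof.
move=> /W_reflect Wh; apply: (L2_le _ Wh).
  by apply: measurableT_comp => //; apply: measurable_funM => //; exact: W_measurable Wh.
move=> x; rewrite /dmul normrN !normrM ler_wpM2r// [leRHS]ger0_norm ?wt_ge0//.
rewrite -(@ler_pXn2r _ 2) ?nnegrE ?wt_ge0//.
by rewrite wt_half_sqr normK lerDr.
Qed.

Lemma is_derive_cas c x : is_derive x 1 (fun y : R => cas (c * y)) (c * cas (- (c * x))).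
Proof.
have H0 : is_derive x 1 (fun y : R => c * y) c.
  by apply: is_derive_eq; rewrite /GRing.scale/=; ring.
have H2 : is_derive x 1 (fun y : R => sin (c * y)) (c * cos (c * x)).
  by apply: is_derive_eq; rewrite /GRing.scale/=; ring.
have H3 : is_derive x 1 (fun y : R => cos (c * y)) (c * - sin (c * x)).
  by apply: is_derive_eq; rewrite /GRing.scale/=; ring.
by rewrite /cas cosN sinN; apply: is_derive_eq; rewrite /GRing.scale/=; ring.
Qed.

Lemma is_derive_ihat h x : L1 h -> L1 (dmul h) -> is_derive x 1 (ihat h) (ihat (dmul h) x).
Proof.
move=> Lh Ld.
have Lx : L1 (fun y => y * h y).
  by apply: eq_L1 (L1_reflect Ld) => y; rewrite /dmul opprK mulNr opprK.
pose f (z y : R) := h y * cas (y * z).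
have df (z y : R) : is_derive z 1 (f ^~ y) (h y * (y * cas (- (y * z)))).
  have := is_derive_cas y z => H0.
  by apply: is_derive_eq; rewrite /GRing.scale/=; ring.
have I : (`]x - 1, x + 1[%classic : set R) x by rewrite /= in_itv/= ltrBlDr ltrDl ltr01.
have Lf (z : R) : (`]x - 1, x + 1[%classic : set R) z -> mu.-integrable setT (EFin \o f z).
  by move=> _; exact: L1_cas.
have derf (z y : R) : (`]x - 1, x + 1[%classic : set R) z -> [set: R] y -> derivable (f ^~ y) z 1.
  by move=> _ _; case: (df z y).
have LG : mu.-integrable setT (EFin \o (fun y => 2 * `|y * h y|)) by exact/L1Z/L1_abs.
have bd (z y : R) : (`]x - 1, x + 1[%classic : set R) z -> [set: R] y ->
    `|partial1of2 f z y| <= 2 * `|y * h y|.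
  move=> _ _; rewrite partial1of2E; case: (df z y) => _ ->.
  by rewrite mulrA normrM [h y * y]mulrC [leLHS]mulrC ler_wpM2r// cas_norm.
have G0 (y : R) : 0 <= 2 * `|y * h y| by rewrite mulr_ge0.
have D := @derivable_under_integral R _ _ mu f setT measurableT x _ _ I Lf derf _ G0 LG bd.
have E := @differentiation_under_integral R _ _ mu f setT measurableT x _ _ I Lf derf _ G0 LG bd.
have HD : is_derive x 1 (H h) (H (dmul h) x).
  split; first exact: D.
  rewrite -derive1E [LHS]E hartleyE.
  rewrite -(Rint_reflect (f := fun y => dmul h y * cas (y * x))); last exact: L1_cas.
  apply: eq_Rintegral => y _; rewrite partial1of2E; case: (df x y) => _ ->.
  by rewrite /dmul opprK !mulNr opprK mulrCA mulrA.
by rewrite /ihat; apply: is_derive_eq; rewrite /GRing.scale/=.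
Qed.

(** * Products *)

(** The addition formula cas (a + b) = cos a cas b + sin a cas (- b) leaves the
    even part of H h times H k and the odd part times the reflection of H k. *)
Lemma hartley_conv h k x : L1 h -> L2 h -> L1 k -> L2 k -> L1 (conv h k) /\
  H (conv h k) x = (H h x + H h (- x)) / 2 * H k x + (H h x - H h (- x)) / 2 * H k (- x).
Proof.
move=> Lh L2h Lk L2k.
have mh := L1_measurable Lh; have mk := L1_measurable Lk.
have key (c : R -> R) M : measurable_fun [set: R] c -> (forall y, `|c y| <= M) ->
    L1 (fun xi => \int[mu]_a (h a * (k (xi - a) * c xi))) /\
    \int[mu]_xi (\int[mu]_a (h a * (k (xi - a) * c xi))) =
    \int[mu]_a (h a * \int[mu]_b (k b * c (a + b))).
  move=> mc cM; pose F (z : R * R) : R := h z.1 * (k (z.2 - z.1) * c z.2).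
  have mF : measurable_fun setT F.
    apply: measurable_funM; first exact: (measurableT_comp mh).
    apply: measurable_funM; last exact: (measurableT_comp mc).
    by apply: (measurableT_comp mk); exact: measurable_funB.
  have Lks a : L1 (fun y => k (y - a)).
    by apply: eq_L1 (L1_shift (- a) Lk) => y; rewrite addrC.
  have Lkc a : L1 (fun y => k (y - a) * c y) by exact: L1M_bdd cM.
  have LF a : L1 (fun y => F (a, y)) by exact: (L1Z (h a) (Lkc a)).
  have [||_ _ LG E] := @fubiniR F (fun a => (M * \int[mu]_y `|k y|) * `|h a|) mF LF.
  - exact/L1Z/L1_abs.
  - move=> a; rewrite /F /= mulrC.
    rewrite (eq_Rint (g := fun y => `|h a| * `|k (y - a) * c y|)) => [|y]; last by rewrite normrM.
    rewrite RintZ; last exact/L1_abs/Lkc.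
    rewrite ler_wpM2l//.
    rewrite -(Rint_shift (- a) (L1_abs Lk)) -RintZ; last exact: L1_shift (L1_abs Lk).
    apply: Rint_le; [exact/L1_abs/Lkc|apply: L1Z; exact: (L1_shift (- a) (L1_abs Lk))|].
    by move=> y; rewrite normrM mulrC [- a + y]addrC ler_wpM2r.
  split; first exact: LG.
  rewrite -[LHS]E; apply: eq_Rint => a; rewrite /F /= RintZ; last exact: Lkc.
  congr (_ * _); rewrite -(Rint_shift a (Lkc a)); apply: eq_Rint => b.
  by rewrite addrAC subrr add0r.
split.
  have [||L _] := key (cst 1) 1 => //; first by move=> y; rewrite normr1.
  by apply: eq_L1 L => xi; apply: eq_Rint => a /=; rewrite mulr1.
have [||_ E] := key (fun xi => cas (xi * x)) 2.
- exact: measurable_casM.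
- by move=> y; exact: cas_norm.
have [Ec Es] := hartley_cos_sin x Lh.
have Lc : L1 (fun x0 => h x0 * cos (x0 * x)).
  by apply: (L1M_bdd (M := 1)) => // [|y]; [exact: measurable_cosM|exact: cos_norm].
have Ls : L1 (fun x0 => h x0 * sin (x0 * x)).
  by apply: (L1M_bdd (M := 1)) => // [|y]; [exact: measurable_sinM|exact: sin_norm].
rewrite hartleyE (eq_Rint (g := fun xi => \int[mu]_a (h a * (k (xi - a) * cas (xi * x))))).
  rewrite E -Ec -Es ![_ * H k _]mulrC -!RintZ// -RintD; [|exact: L1Z|exact: L1Z].
  apply: eq_Rint => a; rewrite ![H k _ * _]mulrC -!mulrA -mulrDr; congr (_ * _).
  rewrite !hartleyE -!RintZ; [|exact: L1_cas|exact: L1_cas].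
  rewrite -RintD; [|by apply: L1Z; exact: L1_cas|by apply: L1Z; exact: L1_cas].
  apply: eq_Rint => b; rewrite mulrDl /cas mulrN cosN sinN cosD sinD; ring.
move=> xi; rewrite /conv mulrC -RintZ; last by apply: L2M => //; exact: L2_shiftN.
by apply: eq_Rint => a; ring.
Qed.

Lemma convC h k x : L2 h -> L2 k -> conv h k x = conv k h x.
Proof.
move=> Lh Lk; rewrite /conv -(Rint_shiftN x (f := fun a => h a * k (x - a))).
  by apply: eq_Rint => a; rewrite subKr mulrC.
by apply: L2M => //; exact: L2_shiftN.
Qed.

(** One of y and x - y is at least half as large as x. *)
Lemma peetre p x y : 0 <= p -> wt p x <= 4 `^ p * (wt p y + wt p (x - y)).
Proof.
move=> p0.
have key z : 1 + x ^+ 2 <= 4 * (1 + z ^+ 2) -> wt p x <= 4 `^ p * wt p z.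
  move=> H; rewrite -powRM ?(ltW (onesqr_gt0 _))//.
  by apply: ge0_ler_powR => //; rewrite nnegrE ?mulr_ge0// ltW// onesqr_gt0.
have [H|H] := lerP ((x - y) ^+ 2) (y ^+ 2).
  apply: (le_trans (key y _)); first by nra.
  by rewrite ler_wpM2l ?powR_ge0// lerDl wt_ge0.
apply: (le_trans (key (x - y) _)); first by nra.
by rewrite ler_wpM2l ?powR_ge0// lerDr wt_ge0.
Qed.

(** The tame estimate: Peetre's inequality puts the weight on one factor, and
    Young's inequality puts the other factor in L^1, where it costs only the
    weight 1 / 2. *)
Lemma nW_conv p h k : 0 <= p -> W p h -> W p k -> W 2^-1 h -> W 2^-1 k ->
  W p (conv h k) /\
  nW p (conv h k) <= 4 `^ p * K1 * (nW 2^-1 h * nW p k + nW 2^-1 k * nW p h).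
Proof.
move=> p0 Wh Wk Wh1 Wk1.
have [L1h Bh] := W_L1 Wh1; have [L1k Bk] := W_L1 Wk1.
have L2h := W_L2 p0 Wh; have L2k := W_L2 p0 Wk.
pose ah x := `|h x|; pose ak x := `|k x|.
pose wh x := `|wt p x * h x|; pose wk x := `|wt p x * k x|.
have Lwh : L2 wh by exact: L2_abs.
have Lwk : L2 wk by exact: L2_abs.
have Lah : L2 ah by exact: L2_abs.
have Lak : L2 ak by exact: L2_abs.
have [Y1 Y1'] := young (L1_abs L1h) Lah Lwk.
have [Y2 Y2'] := young (L1_abs L1k) Lak Lwh.
have bd x : `|wt p x * conv h k x| <= `|4 `^ p * (conv ah wk x + conv ak wh x)|.
  rewrite (convC _ Lak)// /conv -RintD; last 2 first.
  - by apply: L2M => //; exact: L2_shiftN.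
  - by apply: L2M => //; exact: L2_shiftN.
  have LL : L1 (fun a => h a * k (x - a)) by apply: L2M => //; exact: L2_shiftN.
  have Lr : L1 (fun a => ah a * wk (x - a) + wh a * ak (x - a)).
    by apply: L1D; apply: L2M => //; exact: L2_shiftN.
  rewrite -!RintZ//; apply: le_trans (Rint_norm (L1Z _ LL)) _.
  apply: le_trans _ (ler_norm _); apply: Rint_le.
  - exact/L1_abs/L1Z.
  - exact: L1Z.
  - move=> a; rewrite !normrM [`|wt p x|]ger0_norm ?wt_ge0//.
    have := peetre x a p0 => /(ler_wpM2r (mulr_ge0 (normr_ge0 (h a)) (normr_ge0 (k (x - a))))).
    move=> /le_trans; apply; rewrite /wh /wk /ah /ak !normrM.
    rewrite [`|wt p a|]ger0_norm ?wt_ge0// [`|wt p (x - a)|]ger0_norm ?wt_ge0//.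
    rewrite le_eqVlt; apply/orP; left; apply/eqP; ring.
have LS : L2 (fun x => 4 `^ p * (conv ah wk x + conv ak wh x)) by exact/L2Z/L2D.
have Wc : W p (conv h k).
  apply: (L2_le _ LS bd); apply: measurable_funM; first exact: measurable_wt.
  by apply: measurable_conv; [exact: L2_measurable|exact: L2_measurable].
split=> //; apply: le_trans (n2_le Wc LS bd) _.
rewrite n2Z; last exact: L2D.
rewrite ger0_norm ?powR_ge0// -[leRHS]mulrA ler_wpM2l ?powR_ge0// mulrDr.
apply: le_trans (ler_n2D Y1 Y2) _; apply: lerD.
  apply: le_trans Y1' _; rewrite mulrA; apply: ler_pM.
  - by apply: Rint_ge0 => a; rewrite normr_ge0.
  - exact: n2_ge0.
  - by rewrite (eq_Rint (g := ah)) => [//|a]; rewrite normr_id.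
  - by rewrite (n2_abs Wk).
apply: le_trans Y2' _; rewrite mulrA; apply: ler_pM.
- by apply: Rint_ge0 => a; rewrite normr_ge0.
- exact: n2_ge0.
- by rewrite (eq_Rint (g := ak)) => [//|a]; rewrite normr_id.
- by rewrite (n2_abs Wh).
Qed.

Lemma conv_linl c h h' k x : L2 h -> L2 h' -> L2 k ->
  conv (fun y => c * h y + h' y) k x = c * conv h k x + conv h' k x.
Proof.
move=> Lh Lh' Lk.
have A : L1 (fun a => h a * k (x - a)) by apply: L2M => //; exact: L2_shiftN.
have B : L1 (fun a => h' a * k (x - a)) by apply: L2M => //; exact: L2_shiftN.
rewrite /conv -RintZ// -RintD//; last exact: L1Z.
by apply: eq_Rint => a; rewrite mulrDl mulrA.
Qed.

Lemma conv_linr c h h' k x : L2 h -> L2 h' -> L2 k ->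
  conv k (fun y => c * h y + h' y) x = c * conv k h x + conv k h' x.
Proof.
move=> Lh Lh' Lk; rewrite !(convC _ Lk)//; first exact: conv_linl.
by apply: L2D => //; exact: L2Z.
Qed.

(** The four terms recombine the even and odd parts in hartley_conv into the
    plain product, see ihatM. *)
Definition star h k x : R := (4 * pi)^-1 *
  (conv h k x + conv (fun y => h (- y)) k x + conv h (fun y => k (- y)) x
   - conv (fun y => h (- y)) (fun y => k (- y)) x).

Lemma ihatM h k x : L1 h -> L2 h -> L1 k -> L2 k ->
  ihat h x * ihat k x = ihat (star h k) x.
Proof.
move=> L1h L2h L1k L2k.
have L1h' := L1_reflect L1h; have L1k' := L1_reflect L1k.
have L2h' := L2_reflect L2h; have L2k' := L2_reflect L2k.
have [P1 Q1] := hartley_conv x L1h L2h L1k L2k; have [P2 Q2] := hartley_conv x L1h' L2h' L1k L2k.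
have [P3 Q3] := hartley_conv x L1h L2h L1k' L2k'; have [P4 Q4] := hartley_conv x L1h' L2h' L1k' L2k'.
rewrite /ihat /star hartleyZ; last by apply: L1B => //; apply: L1D => //; exact: L1D.
rewrite hartleyB//; last by apply: L1D => //; exact: L1D.
rewrite hartleyD//; last exact: L1D.
rewrite hartleyD// Q1 Q2 Q3 Q4 !hartley_reflect// !opprK.
have p0 := pi_gt0 R; move: p0; move: (pi : R) => P P0; field.
by rewrite !gt_eqF.
Qed.

Definition Cs p : R := 4 `^ p * K1 / pi.

Lemma Cs_ge0 p : 0 <= Cs p.
Proof. by rewrite !mulr_ge0 ?powR_ge0 ?K1_ge0// invr_ge0 pi_ge0. Qed.

(** H^s is an algebra, with one factor of each term measured in H^1 only. The
    continuation argument depends on this, since it first bounds the H^1 norm. *)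
Lemma nW_star p h k : 0 <= p -> W p h -> W p k -> W 2^-1 h -> W 2^-1 k ->
  W p (star h k) /\
  nW p (star h k) <= Cs p * (nW 2^-1 h * nW p k + nW 2^-1 k * nW p h).
Proof.
move=> p0 Wh Wk Wh1 Wk1.
have Wh' := W_reflect Wh; have Wk' := W_reflect Wk.
have Wh1' := W_reflect Wh1; have Wk1' := W_reflect Wk1.
have [P1] := nW_conv p0 Wh Wk Wh1 Wk1; have [P2] := nW_conv p0 Wh' Wk Wh1' Wk1.
have [P3] := nW_conv p0 Wh Wk' Wh1 Wk1'; have [P4] := nW_conv p0 Wh' Wk' Wh1' Wk1'.
rewrite !nW_reflect//; set B := 4 `^ p * K1 * _ => Q4 Q3 Q2 Q1.
have P5 := WD P1 P2; have P6 := WD P5 P3; have P7 := WB P6 P4.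
split; first exact: (WZ _ P7).
rewrite /star nWZ// ger0_norm; last by rewrite invr_ge0 mulr_ge0 ?pi_ge0.
have T1 := nWD P1 P2; have T2 := nWD P5 P3; have T3 := nWB P6 P4.
apply: (@le_trans _ _ ((4 * pi)^-1 * (4 * B))).
  rewrite ler_wpM2l ?invr_ge0 ?mulr_ge0 ?pi_ge0//.
  apply: (le_trans T3 (le_trans (lerD (le_trans T2 (lerD (le_trans T1 (lerD Q1 Q2)) Q3)) Q4) _)).
  by rewrite le_eqVlt; apply/orP; left; apply/eqP; ring.
rewrite /B /Cs; have p1 := pi_gt0 R; move: p1; move: (pi : R) => P P0.
rewrite le_eqVlt; apply/orP; left; apply/eqP.
move: (4 `^ p * K1) (_ + _) => a b; clear -P0; field; exact: lt0r_neq0.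
Qed.

Lemma star_linl c h h' k x : L2 h -> L2 h' -> L2 k ->
  star (fun y => c * h y + h' y) k x = c * star h k x + star h' k x.
Proof.
move=> Lh Lh' Lk; have Rh := L2_reflect Lh; have Rh' := L2_reflect Lh'.
by have Rk := L2_reflect Lk; rewrite /star !conv_linl//; ring.
Qed.

Lemma star_linr c h h' k x : L2 h -> L2 h' -> L2 k ->
  star k (fun y => c * h y + h' y) x = c * star k h x + star k h' x.
Proof.
move=> Lh Lh' Lk; have Rh := L2_reflect Lh; have Rh' := L2_reflect Lh'.
by have Rk := L2_reflect Lk; rewrite /star !conv_linr//; ring.
Qed.

Lemma starBl h h' k x : L2 h -> L2 h' -> L2 k ->
  star (fun y => h y - h' y) k x = star h k x - star h' k x.
Proof.
move=> Lh Lh' Lk; rewrite (_ : (fun y => _) = (fun y => -1 * h' y + h y)).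
  by rewrite star_linl// mulN1r addrC.
by apply/funext => y; rewrite mulN1r addrC.
Qed.

Lemma starBr h h' k x : L2 h -> L2 h' -> L2 k ->
  star k (fun y => h y - h' y) x = star k h x - star k h' x.
Proof.
move=> Lh Lh' Lk; rewrite (_ : (fun y => _) = (fun y => -1 * h' y + h y)).
  by rewrite star_linr// mulN1r addrC.
by apply/funext => y; rewrite mulN1r addrC.
Qed.

Local Opaque Cs.

(** * The vector field *)

(** The multiplier of - (1 - d^2)^-1 d, with the reflection of dmul. *)
Definition Mm h x : R := x / (1 + x ^+ 2) * h (- x).

Lemma Mm_W p h : W p h -> W p (Mm h) /\ nW p (Mm h) <= nW p h.
Proof.
move=> Wh; have Wh' := W_reflect Wh.
have bd x : `|wt p x * Mm h x| <= `|wt p x * h (- x)|.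
  rewrite /Mm !normrM ler_wpM2l// ler_piMl// normfV [`|1 + _|]gtr0_norm ?onesqr_gt0//.
  rewrite ler_pdivrMr ?onesqr_gt0// mul1r -(normK x).
  have := sqr_ge0 (`|x| - 1); have := normr_ge0 x; nra.
have WM : W p (Mm h).
  apply: (L2_le _ Wh' bd); apply: measurable_funM; first exact: measurable_wt.
  apply: measurable_funM; last exact: W_measurable Wh'.
  apply: measurable_funM => //.
  rewrite (_ : (fun x => (1 + x ^+ 2)^-1) = wt (-1)); first exact: measurable_wt.
  by apply/funext => x; rewrite wtNp wt1.
by split=> //; rewrite -(nW_reflect Wh); exact: n2_le.
Qed.

(** Both components of the vector field have this form: a linear term l and a
    multiple of one product. *)
Definition vfield l c f g : R -> R := Mm (fun x => l x + c * star f g x).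

Lemma vfield_W q l c f g : 2^-1 <= q -> W q l -> W q f -> W q g ->
  W q (vfield l c f g) /\
  nW q (vfield l c f g) <=
    nW q l + `|c| * (Cs q * (nW 2^-1 f * nW q g + nW 2^-1 g * nW q f)).
Proof.
move=> q12 Wl Wf Wg; have q0 : 0 <= q by lra.
have [Ws Bs] := nW_star q0 Wf Wg (W_le q12 Wf) (W_le q12 Wg).
have Wcs := WZ c Ws; have [WM BM] := Mm_W (WD Wl Wcs).
split=> //; apply: le_trans BM _; apply: le_trans (nWD Wl Wcs) _.
by rewrite lerD2l nWZ// ler_wpM2l.
Qed.

Lemma MmB h k x : Mm (fun y => h y - k y) x = Mm h x - Mm k x.
Proof. by rewrite /Mm mulrBr. Qed.

Lemma vfield_lip q l l' c f f' g g' : 2^-1 <= q ->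
  W q l -> W q l' -> W q f -> W q f' -> W q g -> W q g' ->
  nW q (fun x => vfield l c f g x - vfield l' c f' g' x) <=
    nW q (fun x => l x - l' x) +
    `|c| * (Cs q * 2 * (nW q (fun x => f x - f' x) * nW q g +
                        nW q f' * nW q (fun x => g x - g' x))).
Proof.
move=> q12 Wl Wl' Wf Wf' Wg Wg'; have q0 : 0 <= q by lra.
have WBl := WB Wl Wl'; have WBf := WB Wf Wf'; have WBg := WB Wg Wg'.
have L2f := W_L2 q0 Wf; have L2f' := W_L2 q0 Wf'.
have L2g := W_L2 q0 Wg; have L2g' := W_L2 q0 Wg'.
have S2 h k : W q h -> W q k ->
    W q (star h k) /\ nW q (star h k) <= Cs q * 2 * (nW q h * nW q k).
  move=> Wh Wk; have [Ws Bs] := nW_star q0 Wh Wk (W_le q12 Wh) (W_le q12 Wk).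
  split=> //; apply: le_trans Bs _; rewrite -mulrA ler_wpM2l ?Cs_ge0//.
  have H1 := nW_le q12 Wh; have H2 := nW_le q12 Wk.
  have := ler_wpM2r (nW_ge0 q k) H1; have := ler_wpM2r (nW_ge0 q h) H2.
  move: (nW q h) (nW q k) (nW _ h) (nW _ k) => A B C D; clear; nra.
have [P1 Q1] := S2 _ _ WBf Wg; have [P2 Q2] := S2 _ _ Wf' WBg.
have PD := WD P1 P2; have PZ := WZ c PD.
have -> : (fun x => vfield l c f g x - vfield l' c f' g' x) =
    Mm (fun x => (l x - l' x) + c * (star (fun y => f y - f' y) g x +
                                     star f' (fun y => g y - g' y) x)).
  apply/funext => x; rewrite /vfield -MmB; congr Mm; apply/funext => y.
  by rewrite starBl// starBr//; ring.
have [_ BM] := Mm_W (WD WBl PZ); apply: le_trans BM _.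
apply: le_trans (nWD WBl PZ) _; rewrite lerD2l nWZ// ler_wpM2l//.
by apply: le_trans (nWD P1 P2) _; rewrite mulrDr; exact: lerD.
Qed.

(** * Smooth bump functions *)

Lemma is_derive_epsI f x (d : R) :
  (forall e, 0 < e -> exists2 r, 0 < r &
     forall y, `|y - x| < r -> `|f y - f x - (y - x) * d| <= e * `|y - x|) ->
  is_derive x 1 f d.
Proof.
move=> H.
have C : (fun h : R => h^-1 *: (f (h *: (1 : R) + x) - f x)) @ 0^' --> d.
  apply/cvgrPdist_le => e e0; have [r r0 Hr] := H e e0.
  near=> h.
  have h0 : h != 0 by near: h; exact: nbhs_dnbhs_neq.
  have hr : `|h| < r.
    near: h; apply: dnbhs0_lt => //.
  rewrite /GRing.scale/= mulr1 distrC.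
  have -> : h^-1 * (f (h + x) - f x) - d = h^-1 * (f (h + x) - f x - h * d).
    by field.
  have := Hr (h + x); rewrite addrK => /(_ hr) B.
  by rewrite normrM normfV ler_pdivrMl ?normr_gt0// [leRHS]mulrC.
by split; [apply/cvg_ex; exists d|exact: (cvg_lim _ C)].
Unshelve. all: by end_near. Qed.

(** The functions x^(- n) exp (- 1 / x) for x > 0, extended by 0. *)
Definition flat (n : nat) x : R := if 0 < x then x^-1 ^+ n * expR (- x^-1) else 0.

Lemma flat_ge0 n x : 0 <= flat n x.
Proof.
rewrite /flat; case: ifP => // x0.
by rewrite mulr_ge0 ?expR_ge0// exprn_ge0// invr_ge0 ltW.
Qed.

(** The exponential series bounds y^(n+1) exp (- y), with y = 1 / x. *)
Lemma flat_le n x : flat n x <= n.+1`!%:R * `|x|.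
Proof.
rewrite /flat; case: ifP => [x0|_]; last by rewrite mulr_ge0.
have y0 : 0 < x^-1 by rewrite invr_gt0.
have := expR_ge1Dxn n (ltW y0); set F : R := (n.+1)`!%:R.
have F0 : 0 < F by rewrite ltr0n fact_gt0.
move=> H; have {}H : x^-1 ^+ n.+1 <= F * expR x^-1.
  by rewrite mulrC -ler_pdivrMr//; apply: le_trans H; rewrite lerDr.
rewrite gtr0_norm// expRN ler_pdivrMr ?expR_gt0// mulrAC -ler_pdivrMr//.
by rewrite -exprSr.
Qed.

(** At the origin flat n y = y * flat n.+1 y = O(y^2). *)
Lemma is_derive_flat n x : is_derive x 1 (flat n) (flat n.+2 x - n%:R * flat n.+1 x).
Proof.
have [x0|x0|->] := ltrgt0P x.
- apply: (@near_eq_is_derive _ R R (fun y : R => y^-1 ^+ n * expR (- y^-1))).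
    near=> y; rewrite /flat ifT//; near: y; exact: lt_nbhsr.
  have D1 : is_derive x 1 (fun y : R => y^-1) (- x ^- 2).
    have x1 : x != 0 by rewrite gt_eqF.
    by have := is_deriveV (f := fun y : R => y) x1 (is_derive_id x (1 : R)); rewrite /GRing.scale/= mulr1.
  have D2 : is_derive x 1 (fun y : R => expR (- y^-1)) (x ^- 2 * expR (- x^-1)).
    by apply: is_derive_eq; rewrite /GRing.scale/=; ring.
  have D3 : is_derive x 1 (fun y : R => y^-1 ^+ n) (- n%:R * x^-1 ^+ n.+1).
    have D := @is_deriveX _ _ _ n x 1 _ D1.
    have E : (fun y : R => y^-1) ^+ n = (fun y : R => y^-1 ^+ n).
      by apply/funext => y; rewrite fctE.
    rewrite E in D; apply: (is_derive_eq D); rewrite /GRing.scale/= -exprVn.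
    by case: (n) => [|j]; rewrite /= ?mul0r ?oppr0 ?mul0r// !exprS; ring.
  rewrite /flat x0; apply: is_derive_eq; rewrite /GRing.scale/= -!exprVn !exprS /=; ring.
- have -> : flat n.+2 x - n%:R * flat n.+1 x = 0.
    by rewrite /flat ltNge (ltW x0)/= mulr0 subr0.
  apply: (@near_eq_is_derive _ R R (cst 0)).
    near=> y; rewrite /flat ltNge ifF//; apply/negbTE; rewrite negbK; apply: ltW; near: y; exact: lt_nbhsl.
- have -> : flat n.+2 0 - n%:R * flat n.+1 0 = 0 by rewrite /flat ltxx mulr0 subr0.
  apply: is_derive_epsI => e e0; exists (e / n.+2`!%:R).
    by rewrite divr_gt0// ltr0n fact_gt0.
  move=> y; rewrite subr0 mulr0 subr0 {2}/flat ltxx subr0 => yr.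
  have -> : flat n y = y * flat n.+1 y.
    rewrite /flat; case: ifP => [y0|]; last by rewrite mulr0.
    by rewrite exprS !mulrA mulfV ?mul1r// gt_eqF.
  rewrite normrM mulrC ler_wpM2r// ger0_norm ?flat_ge0//.
  apply: le_trans (flat_le _ _) _.
  by rewrite mulrC -ler_pdivlMr ?ltr0n ?fact_gt0// ltW.
Unshelve. all: by end_near. Qed.

Lemma le_flat0 x y : x <= y -> flat 0 x <= flat 0 y.
Proof.
rewrite /flat; case: (ltrP 0 x) => x0 xy; last by case: ifP => _//; rewrite mulr_ge0 ?expR_ge0.
rewrite (lt_le_trans x0 xy) !mul1r ler_expR lerN2 lef_pV2// posrE//.
exact: lt_le_trans xy.
Qed.

(** The span of products of the two one-sided flat functions is stable under
    differentiation; this is what makes the bump infinitely differentiable. *)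
Inductive bumps c : (R -> R) -> Prop :=
| bumps_gen m n : bumps c (fun x => flat m (c + x) * flat n (c - x))
| bumps_lin a f g : bumps c f -> bumps c g -> bumps c (fun x => a * f x + g x).

Lemma bumps_derive c f : bumps c f ->
  exists2 g, bumps c g & forall x, is_derive x 1 f (g x).
Proof.
elim=> {f} [m n|a f g bf [f' bf' df] bg [g' bg' dg]]; last first.
  exists (fun x => a * f' x + g' x); first exact: bumps_lin.
  by move=> x; have := df x; have := dg x => d1 d2; apply: is_derive_eq; rewrite /GRing.scale/=.
pose b m n x := flat m (c + x) * flat n (c - x).
exists (fun x => (- m%:R) * b m.+1 n x + (n%:R * b m n.+1 x + (-1 * b m n.+2 x + b m.+2 n x))).
  by do 3 (apply: bumps_lin; first exact: bumps_gen); exact: bumps_gen.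
move=> x.
have D1 : is_derive x 1 (fun y => flat m (c + y)) (flat m.+2 (c + x) - m%:R * flat m.+1 (c + x)).
  have D0 : is_derive x 1 (fun y : R => c + y) 1.
    by apply: is_derive_eq; rewrite add0r mulr1.
  by have := is_derive_flat m (c + x) => D; apply: is_derive_eq; rewrite /GRing.scale/= mulr1.
have D2 : is_derive x 1 (fun y => flat n (c - y)) (- (flat n.+2 (c - x) - n%:R * flat n.+1 (c - x))).
  have D0 : is_derive x 1 (fun y : R => c - y) (-1).
    by apply: is_derive_eq; rewrite /GRing.scale/=; ring.
  by have := is_derive_flat n (c - x) => D; apply: is_derive_eq; rewrite /GRing.scale/= mulrN1.
by apply: is_derive_eq; rewrite /GRing.scale/= /b; ring.
Qed.

Lemma bumps_out c f x : bumps c f -> c < `|x| -> f x = 0.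
Proof.
elim=> {f} [m n|a f g _ Hf _ Hg] cx; last by rewrite Hf// Hg// mulr0 addr0.
move: cx; rewrite ltr_normr /flat => /orP[cx|cx].
  by rewrite subr_gt0 [x < c]ltNge (ltW cx) mulr0.
by rewrite [0 < c + x]ltNge -[c]opprK addrC subr_le0 lerNr (ltW cx) mul0r.
Qed.

Lemma bumps_continuous c f : bumps c f -> continuous f.
Proof.
move=> /bumps_derive[g _ df] x; apply: differentiable_continuous.
by apply/derivable1_diffP; case: (df x).
Qed.

(** * Test functions *)

Implicit Types (r q : R).

Definition csupp (r : R) f : Prop := forall x, r < `|x| -> f x = 0.

Lemma csupp_bdd r f : continuous f -> csupp r f ->
  exists2 M, 0 <= M & forall x, `|f x| <= M * box (- (`|r| + 1)) (`|r| + 1) x.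
Proof.
move=> cf sf; have r0 := normr_ge0 r.
have [||c _ Hc] := @EVT_max R (fun x => `|f x|) (- (`|r| + 1)) (`|r| + 1).
- by lra.
- apply: continuous_subspaceT => x; apply: (@continuous_comp _ _ _ f (fun y : R => `|y|)); first exact: cf.
  exact: norm_continuous.
exists `|f c| => // x; rewrite boxE; case: (boolP (_ && _)) => [/andP[H1 H2]|H].
  by rewrite mulr1 Hc// in_itv/= (ltW H1).
rewrite mulr0 sf ?normr0// ltNge; apply/negP => xr; move/negP: H; apply.
have := ler_norm r; move: xr; rewrite ler_norml => /andP[? ?] ?.
by apply/andP; split; lra.
Qed.

Lemma csupp_L12 r f : continuous f -> csupp r f -> L1 f /\ L2 f.
Proof.
move=> cf sf; have [M M0 HM] := csupp_bdd cf sf.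
have mf : measurable_fun [set: R] f by exact: continuous_measurable_fun.
split; first exact: (L1_le mf (L1Z M (L1_box _ _)) HM).
apply: (L2_le mf (L2Z M (L2_box (- (`|r| + 1)) (`|r| + 1)))) => x.
exact: le_trans (HM x) (ler_norm _).
Qed.

Lemma csupp_derive r f g : csupp r f -> (forall x, is_derive x 1 f (g x)) -> csupp r g.
Proof.
move=> sf df x rx; have [_ <-] := df x.
rewrite (near_eq_derive (g := cst 0) (1 : R)); first by rewrite derive_cst.
near=> y; rewrite sf//.
near: y; have C : `|y| @[y --> x] --> `|x| by exact: norm_continuous.
exact: (C _ (lt_nbhsr rx)).
Unshelve. all: by end_near. Qed.

(** The integral of x |-> f (t + x) does not depend on t: differentiate in t. *)
Lemma Rint_derive0 r f g : csupp r f -> (forall x, is_derive x 1 f (g x)) -> continuous g ->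
  \int[mu]_x g x = 0.
Proof.
move=> sf df cg; have sg := csupp_derive sf df.
have cf : continuous f.
  move=> x; apply: differentiable_continuous.
  by apply/derivable1_diffP; case: (df x).
have [Lf _] := csupp_L12 cf sf; have [Lg _] := csupp_L12 cg sg.
have [M M0 HM] := csupp_bdd cg sg.
pose F (z y : R) := f (z + y).
have dF (z y : R) : is_derive z 1 (F ^~ y) (g (z + y)).
  have D0 : is_derive z 1 (fun t : R => t + y) 1.
    by apply: is_derive_eq; rewrite /GRing.scale/=; ring.
  have := df (z + y) => D1.
  by rewrite /F; apply: is_derive_eq; rewrite /GRing.scale/= mulr1.
have I : (`]-1, 1[%classic : set R) 0 by rewrite /= in_itv/= ltrN10 ltr01.
have LF (z : R) : (`]-1, 1[%classic : set R) z -> mu.-integrable setT (EFin \o F z).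
  by move=> _; exact: (L1_shift z Lf).
have derF (z y : R) : (`]-1, 1[%classic : set R) z -> [set: R] y -> derivable (F ^~ y) z 1.
  by move=> _ _; case: (dF z y).
pose G y := M * box (- (`|r| + 2)) (`|r| + 2) y.
have LG : mu.-integrable setT (EFin \o G) by exact/L1Z/L1_box.
have G0 (y : R) : 0 <= G y by rewrite mulr_ge0// box_ge0.
have bd (z y : R) : (`]-1, 1[%classic : set R) z -> [set: R] y ->
    `|partial1of2 F z y| <= G y.
  rewrite /= in_itv/= => /andP[z1 z2] _; rewrite partial1of2E; case: (dF z y) => _ ->.
  apply: le_trans (HM _) _; rewrite /G ler_wpM2l// !boxE ler_nat.
  case: (boolP (_ && _)) => [/andP[h1 h2]|//]; rewrite lt0b; apply/andP; split; lra.
have E := @differentiation_under_integral R _ _ mu F setT measurableT 0 _ _ I LF derF _ G0 LG bd.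
have <- : \int[mu]_y partial1of2 F 0 y = \int[mu]_y g y.
  by apply: eq_Rint => y; rewrite partial1of2E; case: (dF 0 y) => _ ->; rewrite add0r.
rewrite -[LHS]E (_ : (fun z => _) = cst (\int[mu]_y f y)) ?derive1_cst//.
by apply/funext => z; exact: Rint_shift.
Qed.

(** Integrate the derivative of f * cas. *)
Lemma hartley_derive r f g x : csupp r f -> (forall x, is_derive x 1 f (g x)) -> continuous g ->
  H g x = - (x * H f (- x)).
Proof.
move=> sf df cg; have sg := csupp_derive sf df.
have cf : continuous f.
  move=> y; apply: differentiable_continuous.
  by apply/derivable1_diffP; case: (df y).
have [Lf _] := csupp_L12 cf sf; have [Lg _] := csupp_L12 cg sg.
have d (y : R) : is_derive y 1 (fun y => f y * cas (x * y)) (g y * cas (x * y) + x * (f y * cas (y * - x))).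
  have := is_derive_cas x y => D; have := df y => D'.
  by apply: is_derive_eq; rewrite /GRing.scale/= mulrN [y * x]mulrC; ring.
have s : csupp r (fun y => f y * cas (x * y)) by move=> y /sf ->; rewrite mul0r.
have cc (c : R) : continuous (fun y : R => cas (y * c)) by exact: continuous_casM.
have cx : continuous (fun y : R => cas (x * y)).
  move=> y; rewrite (_ : (fun y : R => cas (x * y)) = (fun y : R => cas (y * x))); first exact: cc.
  by apply/funext => z; rewrite mulrC.
have := Rint_derive0 s d _; rewrite RintD; last 2 first.
- by rewrite (_ : (fun _ => _) = (fun y => g y * cas (y * x))); [exact: L1_cas|apply/funext => y; rewrite mulrC [x * y]mulrC mulrC].
- by apply: L1Z; exact: L1_cas.
rewrite RintZ; last exact: L1_cas.
rewrite !hartleyE => H.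
rewrite (eq_Rint (g := fun y => g y * cas (x * y))) => [|y]; last by rewrite [x * y]mulrC.
apply/eqP; rewrite -addr_eq0; apply/eqP; apply: H => y.
apply: cvgD; first by apply: cvgM; [exact: cg|exact: cx].
by apply: cvgMr; apply: cvgM; [exact: cf|exact: cc].
Qed.

Lemma test_csupp (phi : R -> R) : test_function phi ->
  exists r, [/\ csupp r phi, csupp r (derive1 phi) & csupp r (derive1n 2 phi)] /\
  [/\ (forall x, is_derive x 1 phi (derive1 phi x)),
      (forall x, is_derive x 1 (derive1 phi) (derive1n 2 phi x)),
      continuous phi, continuous (derive1 phi) & continuous (derive1n 2 phi)].
Proof.
move=> [dphi /compact_bounded cphi].
have D n x : is_derive x 1 (derive1n n phi) (derive1n n.+1 phi x).
  by split; [exact: dphi|rewrite derive1nS derive1E].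
have C n : continuous (derive1n n phi).
  move=> y; apply: differentiable_continuous.
  by apply/derivable1_diffP; exact: dphi.
have [M [_ HM]] := cphi.
have s0 : csupp (M + 1) phi.
  move=> x Mx; apply/eqP; apply: contraTT Mx => px.
  by rewrite -leNgt; apply: (HM (M + 1)); [rewrite ltrDl|apply: subset_closure].
have s1 := csupp_derive s0 (D 0).
have s2 := csupp_derive s1 (D 1).
exists (M + 1); split; first exact: (And3 s0 s1 s2).
exact: (And5 (D 0) (D 1) (C 0) (C 1) (C 2)).
Qed.

(** The transform of phi - phi'', the function with which the weak formulation
    pairs the time derivatives. *)
Definition kern (phi : R -> R) : R -> R := H (fun x => phi x - derive1n 2 phi x).

Lemma L12_test (phi : R -> R) : test_function phi ->
  L1 (fun x => phi x - derive1n 2 phi x) /\ L2 (fun x => phi x - derive1n 2 phi x).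
Proof.
move=> /test_csupp[r [[s0 _ s2] [_ _ c0 _ c2]]].
have [L10 L20] := csupp_L12 c0 s0; have [L12 L22] := csupp_L12 c2 s2.
by split; [exact: L1B|exact: L2B].
Qed.

Lemma L2_kern (phi : R -> R) : test_function phi -> L2 (kern phi).
Proof. by move=> /L12_test[L1p L2p]; have [] := bessel L1p L2p. Qed.

Lemma kernE (phi : R -> R) x : test_function phi -> kern phi x = (1 + x ^+ 2) * H phi x.
Proof.
move=> /test_csupp[r [[s0 s1 s2] [d0 d1 c0 c1 c2]]].
have [L10 L20] := csupp_L12 c0 s0; have [L12 L22] := csupp_L12 c2 s2.
rewrite /kern hartleyB// (hartley_derive _ s1 d1 c2) (hartley_derive _ s0 d0 c1) !opprK.
by ring.
Qed.

Lemma pair_test (h phi : R -> R) : test_function phi -> L1 h -> L2 h ->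
  \int[mu]_x (ihat h x * (phi x - derive1n 2 phi x)) =
  (2 * pi)^-1 * \int[mu]_x (h x * kern phi x).
Proof.
move=> tphi L1h L2h; have [L1p L2p] := L12_test tphi.
have := parseval L2p (is_hartley_L1 L1p L2p) (L2_ihat L1h L2h) (is_hartley_inv L1h L2h) L1h.
rewrite -/(kern phi) => E.
rewrite [in RHS](eq_Rint (g := fun x => kern phi x * h x)) => [|x]; last by rewrite mulrC.
rewrite E mulKf; last by rewrite gt_eqF ?twopi_gt0.
by apply: eq_Rint => x; rewrite mulrC.
Qed.

(** The factor 1 + x^2 of kern phi cancels the denominator of Mm, so that both
    sides of the weak equation pair with the same function. *)
Lemma pair_test_derive (h phi : R -> R) : test_function phi -> L1 h -> L2 h ->
  \int[mu]_x (ihat h x * derive1 phi x) =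
  (2 * pi)^-1 * \int[mu]_x (Mm h x * kern phi x).
Proof.
move=> tphi L1h L2h; have K := fun x => kernE x tphi.
have W0h : W 0 h by apply: eq_L2 L2h => x; rewrite wt0 mul1r.
have Lk := L2_kern tphi; have [LM _] := Mm_W W0h.
have := tphi => /test_csupp[r [[s0 s1 s2] [d0 d1 c0 c1 c2]]].
have [L11 L21] := csupp_L12 c1 s1.
have := parseval L21 (is_hartley_L1 L11 L21) (L2_ihat L1h L2h) (is_hartley_inv L1h L2h) L1h.
rewrite (eq_Rint (g := fun x => Mm h (- x) * kern phi (- x))) => [|x]; last first.
  rewrite (hartley_derive _ s0 d0 c1) K /Mm opprK sqrrN.
  by have := onesqr_gt0 x; move: (1 + x ^+ 2) => D D0; field; rewrite gt_eqF.
rewrite (Rint_reflect (f := fun x => Mm h x * kern phi x)).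
  move=> ->; rewrite mulKf; last by rewrite gt_eqF ?twopi_gt0.
  by apply: eq_Rint => x; rewrite mulrC.
by apply: L2M => //; apply: eq_L2 LM => x; rewrite wt0 mul1r.
Qed.

(** * Density of the transforms of test functions *)

Definition bump c x : R := flat 0 (c + x) * flat 0 (c - x).

Lemma bumps_bump c : bumps c (bump c).
Proof. exact: bumps_gen. Qed.

Lemma bumpN c x : bump c (- x) = bump c x.
Proof. by rewrite /bump opprK mulrC. Qed.

Lemma bump_ge0 c x : 0 <= bump c x.
Proof. by rewrite mulr_ge0 ?flat_ge0. Qed.

Lemma bumps_L12 c f : bumps c f -> L1 f /\ L2 f.
Proof. by move=> bf; apply: (@csupp_L12 c); [exact: bumps_continuous bf|move=> x; exact: bumps_out bf]. Qed.

Lemma Rint_bump_gt0 c : 0 < c -> 0 < \int[mu]_x bump c x.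
Proof.
move=> c0; pose d := flat 0 (c / 2) ^+ 2.
have d0 : 0 < d by rewrite exprn_gt0// /flat ifT ?mulr_gt0 ?expR_gt0// divr_gt0.
have [Lb _] := bumps_L12 (bumps_bump c).
apply: (@lt_le_trans _ _ (\int[mu]_x (d * box (- (c / 2)) (c / 2) x))).
  rewrite RintZ; last exact: L1_box.
  rewrite mulr_gt0// -lte_fin (EFin_Rint (L1_box _ _)) /box integral_indic//= setIT.
  by rewrite lebesgue_measure_itv/= lte_fin ifT -?EFinB ?lte_fin; lra.
apply: Rint_le => //; first exact/L1Z/L1_box.
move=> x; rewrite boxE; case: (boolP (_ && _)) => [/andP[H1 H2]|_]; last by rewrite mulr0 bump_ge0.
by rewrite mulr1 /d /bump expr2; apply: ler_pM; rewrite ?flat_ge0// le_flat0//; lra.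
Qed.

Lemma hartley_bump_even c x : H (bump c) (- x) = H (bump c) x.
Proof.
have [Lb _] := bumps_L12 (bumps_bump c).
have E := hartley_reflect x Lb.
have F : (fun y => bump c (- y)) = bump c by apply/funext => y; exact: bumpN.
rewrite F in E; exact: (esym E).
Qed.

(** On the support of the bump and for these x the phase is at most 1, where
    cosine is at least cos 1 > 0. *)
Lemma hartley_bump_ge c x : 0 < c -> c * `|x| <= 1 ->
  cos 1 * \int[mu]_y bump c y <= H (bump c) x.
Proof.
move=> c0 cx; have [Lb _] := bumps_L12 (bumps_bump c).
have [Ec _] := hartley_cos_sin x Lb.
have -> : H (bump c) x = \int[mu]_y (bump c y * cos (y * x)).
  by rewrite Ec hartley_bump_even; field.
rewrite -RintZ//; apply: Rint_le; [exact: L1Z| |].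
  by apply: (L1M_bdd (M := 1)) => // [|y]; [exact: measurable_cosM|exact: cos_norm].
move=> y; have [yc|cy] := lerP `|y| c; last by rewrite (bumps_out (bumps_bump c) cy) mulr0 mul0r.
rewrite mulrC ler_wpM2l ?bump_ge0//.
have -> : cos (y * x) = cos `|y * x| by case: (ger0P (y * x)) => // _; rewrite cosN.
have p2 := @pi_ge2 R.
have yx : `|y * x| <= 1.
  by rewrite normrM; apply: le_trans cx; rewrite ler_wpM2r.
rewrite leNgt ltr_cos ?in_itv/= ?normr_ge0 ?ler01 ?andbT//; last 2 first.
- lra.
- lra.
by rewrite -leNgt.
Qed.

(** This is the transform of bump - bump'', and transforms of integrable
    functions are bounded. *)
Lemma hartley_bump_decay c : exists2 M, 0 <= M & forall x, `|(1 + x ^+ 2) * H (bump c) x| <= M.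
Proof.
have b0 := bumps_bump c; have [b1 B1 d1] := bumps_derive b0; have [b2 B2 d2] := bumps_derive B1.
have [L0 _] := bumps_L12 b0; have [L2' _] := bumps_L12 B2.
have LB := L1B L0 L2'.
exists (2 * \int[mu]_y `|bump c y - b2 y|).
  by rewrite mulr_ge0// Rint_ge0.
move=> x; suff -> : (1 + x ^+ 2) * H (bump c) x = H (fun y => bump c y - b2 y) x.
  exact: hartley_norm.
have s0 : csupp c (bump c) by move=> y; exact: bumps_out b0.
have s1 : csupp c b1 by move=> y; exact: bumps_out B1.
rewrite hartleyB// (hartley_derive _ s1 d2 (bumps_continuous B2)).
by rewrite (hartley_derive _ s0 d1 (bumps_continuous B1)) !opprK; ring.
Qed.

Lemma is_derive_conv c k f : L1 k -> bumps c f ->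
  exists2 g, bumps c g & forall x, is_derive x 1 (conv k f) (conv k g x).
Proof.
move=> Lk bf; have [g bg df] := bumps_derive bf; exists g => // x.
have cf := bumps_continuous bf; have cg := bumps_continuous bg.
have [Mf Mf0 HMf] := csupp_bdd cf (fun x => bumps_out bf).
have [Mg Mg0 HMg] := csupp_bdd cg (fun x => bumps_out bg).
pose F (z y : R) := k y * f (z - y).
have dF (z y : R) : is_derive z 1 (F ^~ y) (k y * g (z - y)).
  have D0 : is_derive z 1 (fun t : R => t - y) 1.
    by apply: is_derive_eq; rewrite /GRing.scale/=; ring.
  have := df (z - y) => D1.
  have D2 : is_derive z 1 (fun t : R => f (t - y)) (g (z - y)).
    by apply: is_derive_eq; rewrite /GRing.scale/= mulr1.
  by rewrite /F; apply: is_derive_eq; rewrite /GRing.scale/=.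
have I : (`]x - 1, x + 1[%classic : set R) x by rewrite /= in_itv/= ltrBlDr ltrDl ltr01.
have LF (z : R) : (`]x - 1, x + 1[%classic : set R) z -> mu.-integrable setT (EFin \o F z).
  move=> _; apply: (@L1_le _ (fun y => Mf * `|k y|)).
  - apply: measurable_funM; first exact: L1_measurable.
    apply: (@measurableT_comp _ _ _ _ _ _ f); first exact: continuous_measurable_fun.
    exact: measurable_funB.
  - exact/L1Z/L1_abs.
  - move=> y; rewrite /F normrM mulrC ler_wpM2r//; apply: le_trans (HMf _) _.
    by rewrite ler_piMr// box_le1.
have derF (z y : R) : (`]x - 1, x + 1[%classic : set R) z -> [set: R] y -> derivable (F ^~ y) z 1.
  by move=> _ _; case: (dF z y).
pose G y := Mg * `|k y|.
have LG : mu.-integrable setT (EFin \o G) by exact/L1Z/L1_abs.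
have G0 (y : R) : 0 <= G y by rewrite mulr_ge0.
have bd (z y : R) : (`]x - 1, x + 1[%classic : set R) z -> [set: R] y ->
    `|partial1of2 F z y| <= G y.
  move=> _ _; rewrite partial1of2E; case: (dF z y) => _ ->.
  rewrite /G normrM mulrC ler_wpM2r//; apply: le_trans (HMg _) _.
  by rewrite ler_piMr// box_le1.
have D := @derivable_under_integral R _ _ mu F setT measurableT x _ _ I LF derF _ G0 LG bd.
have E := @differentiation_under_integral R _ _ mu F setT measurableT x _ _ I LF derF _ G0 LG bd.
split; first exact: D.
rewrite -derive1E [LHS]E; apply: eq_Rint => y; rewrite partial1of2E.
by case: (dF x y) => _ ->.
Qed.

Lemma test_conv c n f : L2 f -> test_function (conv (cut n f) (bump c)).
Proof.
move=> Lf; have Lc := L2_cut_L1 n Lf.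
have D j : exists2 g, bumps c g & derive1n j (conv (cut n f) (bump c)) = conv (cut n f) g.
  elim: j => [|j [g bg Eg]]; first by exists (bump c) => //; exact: bumps_bump.
  have [h bh dh] := is_derive_conv Lc bg; exists h => //.
  by rewrite derive1nS Eg; apply/funext => x; rewrite derive1E; case: (dh x).
split.
  move=> j x; have [g bg ->] := D j; have [h _ dh] := is_derive_conv Lc bg.
  by case: (dh x).
apply: (@subclosed_compact _ _ `[- (n%:R + `|c|), n%:R + `|c|]%classic).
- exact: closed_closure.
- exact: segment_compact.
rewrite [X in _ `<=` X](closure_id _).1; last exact: interval_closed.
apply: closure_subset => x /= /eqP; apply: contra_notP => Hx.
rewrite /conv (eq_Rint (g := cst 0)) ?Rint0// => a /=; rewrite cutE.
case: ifPn => [/andP[a1 a2]|_]; last by rewrite mul0r.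
rewrite (bumps_out (bumps_bump c)) ?mulr0// ltNge; apply/negP => xa; apply: Hx.
have := ler_norm c; move: xa; rewrite ler_norml in_itv/= => /andP[? ?] ?.
by apply/andP; split; lra.
Qed.

(** Mollifying by an even bump multiplies the transform by that of the bump. *)
Lemma kern_conv c n f x : L2 f ->
  kern (conv (cut n f) (bump c)) x = (1 + x ^+ 2) * H (bump c) x * H (cut n f) x.
Proof.
move=> Lf; have L1c := L2_cut_L1 n Lf; have L2c := L2_cut n Lf.
have [L1b L2b] := bumps_L12 (bumps_bump c).
rewrite kernE; last exact: test_conv.
rewrite -mulrA; congr (_ * _).
have -> : conv (cut n f) (bump c) = conv (bump c) (cut n f) by apply/funext => y; exact: convC.
have [_ ->] := hartley_conv x L1b L2b L1c L2c.
by rewrite hartley_bump_even; field.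
Qed.

(** Dividing by the transform of a bump that does not vanish on [-m, m], any
    function cut to [-m, m] is a limit of transforms of test functions; the decay
    of that transform controls the rest of the line. Choosing wt q * D cut to
    [-m, m] turns the hypothesis into a bound for its own norm. *)
Lemma kern_dense q D S : 0 <= q -> W q D -> 0 <= S ->
  (forall phi : R -> R, test_function phi ->
     `|\int[mu]_x (D x * kern phi x)| <= S * n2 (fun x => wt (- q) x * kern phi x)) ->
  nW q D <= S.
Proof.
move=> q0 WD S0 HS; set w := fun x => wt q x * D x.
have Lw : L2 w by [].
suff cutS (m : nat) : (0 < m)%N -> n2 (cut m w) <= S.
  apply/ler_addgt0Pr => e e0.
  have /cvgrPdist_lt/(_ e e0)[N _ HN] := n2_cut_cvg Lw.
  have := HN (maxn N 1) (leq_maxl N 1); rewrite sub0r normrN ger0_norm ?n2_ge0// n2BC => He.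
  have Lc := L2_cut (maxn N 1) Lw.
  have -> : nW q D = n2 (fun x => cut (maxn N 1) w x + (w x - cut (maxn N 1) w x)).
    by apply: eq_n2 => x; rewrite addrC subrK.
  apply: le_trans (ler_n2D Lc (L2B Lw Lc)) _.
  by apply: lerD; [apply: cutS; rewrite leq_max orbT|exact: ltW].
move=> m0; have M0 : 0 < m%:R :> R by rewrite ltr0n.
(* a bump of this width has a positive transform on [-m, m] *)
pose c : R := m%:R^-1; have c0 : 0 < c by rewrite invr_gt0.
pose B := H (bump c).
pose d : R := cos 1 * \int[mu]_y bump c y.
have d0 : 0 < d.
  by rewrite mulr_gt0 ?Rint_bump_gt0 ?cos1_gt0.
have Bd x : `|x| <= m%:R -> d <= B x.
  by move=> xm; apply: hartley_bump_ge => //; rewrite mulrC ler_pdivrMr// mul1r.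
have [Mb Mb0 HMb] := hartley_bump_decay c.
have [L1b L2b] := bumps_L12 (bumps_bump c).
have mB : measurable_fun [set: R] B by apply: measurable_hartley; exact: L1_measurable.
pose P x : R := wt (1 - q) x * B x.
have mP : measurable_fun [set: R] P by apply: measurable_funM => //; exact: measurable_wt.
have HP x : `|P x| <= Mb.
  apply: le_trans (HMb x); rewrite /P !normrM ler_wpM2r// ger0_norm ?wt_ge0//.
  by rewrite -wt1 ger0_norm ?wt_ge0// le_wt// gerBl.
(* the real power -1 is measurable without a case on the zeros of P *)
pose k x := P x `^ (-1) * cut m w x.
have Px x : - m%:R < x <= m%:R -> d <= B x /\ P x `^ (-1) = (P x)^-1.
  move=> /andP[H1 H2]; have dB : d <= B x by rewrite Bd// ler_norml (ltW H1).
  by split=> //; rewrite powR_inv1// mulr_ge0 ?wt_ge0// (le_trans (ltW d0)).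
have Pk x : P x * k x = cut m w x.
  rewrite /k cutE; case: ifPn => [/Px[dB ->]|_]; last by rewrite !mulr0.
  by rewrite mulVKf// gt_eqF// mulr_gt0 ?wt_gt0// (lt_le_trans d0).
have L2k : L2 k.
  pose C : R := wt `|q - 1| m%:R / d.
  apply: (@L2_le _ (fun x => C * cut m w x)).
  - apply: measurable_funM; last by apply: L2_measurable; exact: L2_cut.
    exact: (measurableT_comp (@measurable_powR R (-1)) mP).
  - by apply: L2Z; exact: L2_cut.
  - move=> x; rewrite /k cutE; case: ifPn => [/[dup] /Px[_ ->] /andP[H1 H2]|_]; last by rewrite !mulr0.
    have xm : `|x| <= m%:R by rewrite ler_norml (ltW H1).
    rewrite normrM [leRHS]normrM ler_wpM2r// [leRHS]ger0_norm; last by rewrite mulr_ge0 ?wt_ge0// invr_ge0 ltW.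
    have Bx := Bd x xm; have Bx0 := lt_le_trans d0 Bx.
    rewrite invfM normrM -wtNp opprB ger0_norm ?wt_ge0//.
    apply: ler_pM => //; first exact: wt_ge0.
      apply: (@le_trans _ _ (wt `|q - 1| x)); first by apply: le_wt; exact: ler_norm.
      apply: ge0_ler_powR => //; rewrite ?nnegrE ?(ltW (onesqr_gt0 _))// lerD2l.
      by rewrite -(normK x) lerXn2r// nnegrE ltW.
    by rewrite normfV gtr0_norm// lef_pV2// posrE.
have L1k : L1 k.
  apply: eq_L1 (L2_cut_L1 m L2k) => x; rewrite cutE.
  by case: ifPn => // /negbTE H; rewrite /k cutE H mulr0.
pose g := ihat k; have Lg : L2 g by exact: L2_ihat.
have [_ Cg] := is_hartley_inv L1k L2k.
pose dn n := n2 (fun x => k x - H (cut n g) x).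
have LH n := L2_hartley_cut n Lg.
pose E := cut m w; have LE : L2 E by exact: L2_cut.
have LPH n : L2 (fun x => P x * H (cut n g) x) by exact: L2M_bdd HP.
have Edn n : n2 (fun x => E x - P x * H (cut n g) x) <= Mb * dn n.
  rewrite (eq_n2 (g := fun x => P x * (k x - H (cut n g) x))); last first.
    by move=> x; rewrite mulrBr Pk.
  by apply: n2M_bdd => //; apply: L2B.
have key n : n2 E ^+ 2 <= S * n2 E + (S + n2 w) * (Mb * dn n).
  have -> : n2 E ^+ 2 = \int[mu]_x (w x * (P x * H (cut n g) x)) +
                        \int[mu]_x (w x * (E x - P x * H (cut n g) x)).
    rewrite -RintD; [|exact: L2M|by apply: L2M => //; exact: L2B].
    rewrite sqr_n2; apply: eq_Rint => x; rewrite -mulrDr addrC subrK.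
    by rewrite /E cutE; case: ifP => _; rewrite ?expr2// mul0r mulr0.
  have -> : S * n2 E + (S + n2 w) * (Mb * dn n) =
            S * (n2 E + Mb * dn n) + n2 w * (Mb * dn n) by ring.
  apply: lerD; last first.
    apply: le_trans (ler_norm _) _; apply: le_trans (cauchy_schwarz Lw (L2B LE (LPH n))) _.
    by rewrite ler_wpM2l ?n2_ge0.
  have T := test_conv c n Lg.
  have wk x : wt (- q) x * kern (conv (cut n g) (bump c)) x = P x * H (cut n g) x.
    by rewrite kern_conv// /P wtD wt1 -/B; ring.
  have -> : \int[mu]_x (w x * (P x * H (cut n g) x)) =
            \int[mu]_x (D x * kern (conv (cut n g) (bump c)) x).
    apply: eq_Rint => x; rewrite -wk /w mulrACA -wtD subrr wt0 mul1r.
    by [].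
  apply: le_trans (ler_norm _) _; apply: le_trans (HS _ T) _.
  rewrite (eq_n2 wk) ler_wpM2l// -lerBlDl.
  apply: le_trans (Edn n); rewrite lerBlDl.
  rewrite n2BC -[leLHS](@eq_n2 (fun x => E x + (P x * H (cut n g) x - E x))).
    exact: (ler_n2D LE (L2B (LPH n) LE)).
  by move=> x; rewrite addrC subrK.
have EE : n2 E ^+ 2 <= S * n2 E.
  apply/ler_addgt0Pr => e e0.
  pose K := (S + n2 w) * Mb; have K0 : 0 <= K by rewrite mulr_ge0// addr_ge0 ?n2_ge0.
  have /cvgrPdist_lt/(_ (e / (K + 1)))[|N _ HN] := Cg.
    by rewrite divr_gt0// ltr_wpDl.
  have := HN N (leqnn N); rewrite sub0r normrN ger0_norm ?n2_ge0// => He.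
  apply: le_trans (key N) _; rewrite lerD2l mulrA -/K.
  apply: (@le_trans _ _ (K * (e / (K + 1)))); first by rewrite ler_wpM2l// ltW.
  rewrite mulrCA ler_piMr ?(ltW e0)// ler_pdivrMr ?mul1r ?lerDl// ltr_wpDl//.
have [->//|nE] := eqVneq (n2 E) 0.
move: EE; rewrite expr2 ler_pM2r// lt_neqAle eq_sym nE n2_ge0//.
Qed.

(** * From weak to strong derivatives *)

Implicit Types (A B F X Y : R -> R -> R) (t lo hi : R).

Lemma pairW q f k : 0 <= q -> W q f -> L2 k ->
  [/\ L1 (fun x => f x * k x),
      `|\int[mu]_x (f x * k x)| <= nW q f * n2 (fun x => wt (- q) x * k x)
    & `|\int[mu]_x (f x * k x)| <= nW q f * n2 k].
Proof.
move=> q0 Wf Lk.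
have bd x : `|wt (- q) x * k x| <= `|k x|.
  rewrite normrM ler_piMl// ger0_norm ?wt_ge0//.
  by rewrite wtNp invf_le1 ?wt_gt0// wt_ge1.
have Lwk : L2 (fun x => wt (- q) x * k x).
  apply: (L2_le _ Lk bd); apply: measurable_funM; first exact: measurable_wt.
  exact: L2_measurable.
have E : (fun x => f x * k x) = (fun x => (wt q x * f x) * (wt (- q) x * k x)).
  by apply/funext => x; rewrite mulrACA -wtD subrr wt0 mul1r.
have CS := cauchy_schwarz Wf Lwk.
rewrite E; split; [exact: L2M|exact: CS|].
by apply: le_trans CS _; rewrite ler_wpM2l ?nW_ge0// n2_le.
Qed.

Lemma within_eps f a b : a < b ->
  (forall x, a <= x <= b -> forall e, 0 < e -> exists2 r, 0 < r &
     forall y, a <= y <= b -> `|y - x| < r -> `|f y - f x| <= e) ->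
  {within `[a, b], continuous f}.
Proof.
move=> ab H; apply/continuous_within_itvP => //; split.
- move=> x; rewrite in_itv/= => /andP[ax xb]; apply/cvgrPdist_le => e e0.
  have [|r r0 Hr] := H x _ e e0; first by rewrite !ltW.
  near=> y; rewrite distrC; apply: Hr.
    apply/andP; split; apply: ltW; near: y; [exact: lt_nbhsr|exact: lt_nbhsl].
  by rewrite ltr_norml; apply/andP; split; rewrite ?ltrBlDl ?ltrBrDl; near: y; [apply: lt_nbhsr|apply: lt_nbhsl]; lra.
- apply/cvgrPdist_le => e e0; have [|r r0 Hr] := H a _ e e0; first by rewrite lexx ltW.
  near=> y; rewrite distrC; apply: Hr.
    apply/andP; split; apply: ltW; near: y; [exact: nbhs_right_gt|exact: nbhs_right_lt].
  have ay : a < y by near: y; exact: nbhs_right_gt.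
  rewrite gtr0_norm ?subr_gt0// ltrBlDr; near: y.
  by apply: nbhs_right_lt; rewrite ltrDr.
- apply/cvgrPdist_le => e e0; have [|r r0 Hr] := H b _ e e0; first by rewrite lexx ltW.
  near=> y; rewrite distrC; apply: Hr.
    apply/andP; split; apply: ltW; near: y; [exact: nbhs_left_gt|exact: nbhs_left_lt].
  have ay : y < b by near: y; exact: nbhs_left_lt.
  rewrite distrC gtr0_norm ?subr_gt0// ltrBlDl addrC -ltrBlDl; near: y.
  by apply: nbhs_left_gt; rewrite gtrBl.
Unshelve. all: by end_near. Qed.

Definition Wcont q X lo hi : Prop := forall t, lo <= t < hi -> W q (X t) /\
  forall e, 0 < e -> exists2 r, 0 < r &
    forall t', lo <= t' < hi -> `|t' - t| < r -> nW q (fun x => X t' x - X t x) <= e.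

Definition weakd X F t : Prop := forall phi : R -> R, test_function phi ->
  is_derive t 1 (fun t' => \int[mu]_x (X t' x * kern phi x)) (\int[mu]_x (F t x * kern phi x)).

Definition Wderiv q X t (D : R -> R) : Prop := forall e, 0 < e -> exists2 r, 0 < r &
  forall t', `|t' - t| < r -> W q (X t') /\
    nW q (fun x => X t' x - X t x - (t' - t) * D x) <= e * `|t' - t|.

(** For each test function the mean value theorem applies to a scalar function;
    kern_dense then takes all test functions at once. This replaces the
    integration of functions with values in W q. *)
Lemma mean_value q X F lo hi a b (P : R -> R) S : 0 <= q -> Wcont q X lo hi ->
  lo <= a -> a < b -> b < hi -> W q P -> 0 <= S ->
  (forall t, a < t < b -> [/\ weakd X F t, W q (F t) & nW q (fun x => F t x - P x) <= S]) ->
  nW q (fun x => X b x - X a x - (b - a) * P x) <= (b - a) * S.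
Proof.
move=> q0 cX la ab bh WP S0 HF.
have ba0 : 0 < b - a by rewrite subr_gt0.
have aI : lo <= a < hi by rewrite la (lt_trans ab).
have bI : lo <= b < hi by rewrite bh (le_trans la)// ltW.
have [Wa _] := cX a aI; have [Wb _] := cX b bI.
have Wba := WB Wb Wa; have WcP := WZ (b - a) WP.
apply: kern_dense => //; [exact: WB|by rewrite mulr_ge0// ltW|].
move=> phi tphi; set k := kern phi; have Lk : L2 k := L2_kern tphi.
have [||c] := @MVT R (fun t => \int[mu]_x (X t x * k x)) (fun t => \int[mu]_x (F t x * k x)) a b ab.
- by move=> t; rewrite in_itv/= => tab; have [wd _ _] := HF t tab; exact: wd.
- apply: within_eps => // t /andP[at_ tb] e e0.
  have tI : lo <= t < hi by rewrite (le_trans la)// (le_lt_trans tb).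
  have [Wt Ct] := cX t tI.
  have [r r0 Hr] := Ct (e / (n2 k + 1)) (divr_gt0 e0 (ltr_wpDl (n2_ge0 k) ltr01)).
  exists r => // t' /andP[at' t'b] t't.
  have t'I : lo <= t' < hi by rewrite (le_trans la)// (le_lt_trans t'b).
  have [Wt' _] := cX t' t'I.
  have [L1 _ _] := pairW q0 Wt Lk; have [L1' _ _] := pairW q0 Wt' Lk.
  rewrite -RintB// (eq_Rint (g := fun x => (X t' x - X t x) * k x)) => [|x]; last by rewrite mulrBl.
  have [_ _ B] := pairW q0 (WB Wt' Wt) Lk; apply: le_trans B _.
  apply: le_trans (ler_wpM2r (n2_ge0 k) (Hr t' t'I t't)) _.
  rewrite mulrAC -mulrA ler_piMr ?(ltW e0)// ler_pdivrMr ?mul1r ?lerDl//.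
  by rewrite ltr_wpDl ?n2_ge0.
rewrite in_itv/= => cab E; have [_ WFc BFc] := HF c cab.
have [La _ _] := pairW q0 Wa Lk; have [Lb _ _] := pairW q0 Wb Lk.
have [LF _ _] := pairW q0 WFc Lk; have [LP _ _] := pairW q0 WP Lk.
have WFP := WB WFc WP; have [LFP BFP _] := pairW q0 WFP Lk.
have -> : \int[mu]_x ((X b x - X a x - (b - a) * P x) * k x) =
          (b - a) * \int[mu]_x ((F c x - P x) * k x).
  rewrite (eq_Rint (g := fun x => X b x * k x - X a x * k x - (b - a) * (P x * k x))) => [|x]; last by ring.
  rewrite RintB; [|exact: L1B|exact: L1Z].
  rewrite RintB// E RintZ// [in RHS](eq_Rint (g := fun x => F c x * k x - P x * k x)) => [|x]; last by ring.
  by rewrite RintB//; ring.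
rewrite normrM gtr0_norm// -mulrA ler_pM2l//; apply: le_trans BFP _.
by rewrite ler_wpM2r// n2_ge0.
Qed.

(** mean_value on short intervals ending at t. Nothing is asked at t itself, which
    allows gluing two solutions at an instant. *)
Lemma weakd_Wderiv q X F lo hi t : 0 <= q -> Wcont q X lo hi -> Wcont q F lo hi ->
  (forall s, lo < s < hi -> s != t -> weakd X F s) -> lo < t < hi -> Wderiv q X t (F t).
Proof.
move=> q0 cX cF wd /andP[lot thi] e e0.
have tI : lo <= t < hi by rewrite (ltW lot).
have [WFt /(_ e e0)[r1 r10 Hr1]] := cF t tI.
pose r := Num.min r1 (Num.min (t - lo) (hi - t)).
exists r; first by rewrite !lt_min r10 !subr_gt0 lot.
move=> t'; rewrite !lt_min => /and3P[t'r1 t'lo t'hi].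
have t'I : lo <= t' < hi.
  move: t'lo t'hi; rewrite !ltr_norml => /andP[? _] /andP[_ ?].
  by apply/andP; split; [apply: ltW|]; lra.
have [Wt' _] := cX _ t'I; split => //.
have FI s : `|s - t| < r1 -> s != t -> lo < s < hi ->
    [/\ weakd X F s, W q (F s) & nW q (fun x => F s x - F t x) <= e].
  move=> st snt /[dup] sI /andP[s1 s2]; have sI' : lo <= s < hi by rewrite (ltW s1).
  by split; [exact: wd|have [] := cF s sI'|exact: Hr1].
have [/andP[lt' t'h]] := t'I.
have [tt'|tt'|->] := ltgtP t t'.
- rewrite mulrC ger0_norm ?subr_ge0 ?(ltW tt')//.
  apply: (mean_value q0 cX (ltW lot) tt' t'h WFt (ltW e0)) => s /andP[s1 s2].
  apply: FI; [|by rewrite gt_eqF|by rewrite (lt_trans lot)// (lt_trans s2)].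
  apply: le_lt_trans t'r1; rewrite !ger0_norm ?subr_ge0 ?(ltW tt') ?(ltW s1)//.
  by rewrite lerD2r ltW.
- rewrite (@eq_nW q _ (fun x => -1 * (X t x - X t' x - (t - t') * F t x))); last by move=> x; ring.
  have [Wt _] := cX _ tI.
  rewrite nWZ; last by apply: WB; [exact: WB|exact: WZ].
  rewrite normrN1 mul1r mulrC distrC ger0_norm ?subr_ge0 ?(ltW tt')//.
  apply: (mean_value q0 cX lt' tt' thi WFt (ltW e0)) => s /andP[s1 s2].
  apply: FI; [|by rewrite lt_eqF|by rewrite (le_lt_trans lt')// (lt_trans s2)].
  apply: le_lt_trans t'r1; rewrite distrC [leRHS]distrC !ger0_norm ?subr_ge0 ?(ltW tt') ?(ltW s2)//.
  by rewrite lerD2l lerN2 ltW.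
- rewrite subrr normr0 mulr0 (@eq_nW q _ (cst 0)) ?nW_0// => x /=.
  by rewrite subrr mul0r subr0.
Qed.

Lemma Wcont_vfield q X Y F c lo hi : 2^-1 <= q -> Wcont q X lo hi -> Wcont q Y lo hi ->
  Wcont q F lo hi -> Wcont q (fun t => vfield (F t) c (X t) (Y t)) lo hi.
Proof.
move=> q12 cX cY cF t tI.
have [WX HX] := cX t tI; have [WY HY] := cY t tI; have [WF HF] := cF t tI.
split; first by have [] := vfield_W c q12 WF WX WY.
move=> e e0.
pose K := 1 + `|c| * (Cs q * 2) * ((nW q (Y t) + 1) + nW q (X t)).
have K0 : 1 <= K.
  rewrite lerDl; apply: mulr_ge0.
    by apply: mulr_ge0 => //; apply: mulr_ge0 => //; exact: Cs_ge0.
  apply: addr_ge0; last exact: nW_ge0.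
  by apply: addr_ge0 => //; exact: nW_ge0.
pose d := Num.min 1 (e / K).
have d0 : 0 < d by rewrite lt_min ltr01 divr_gt0// (lt_le_trans ltr01).
have d1 : d <= 1 by rewrite ge_min lexx.
have [r1 r10 H1] := HX d d0; have [r2 r20 H2] := HY d d0; have [r3 r30 H3] := HF d d0.
exists (Num.min r1 (Num.min r2 r3)); first by rewrite !lt_min r10 r20.
move=> t' t'I; rewrite !lt_min => /and3P[t1 t2 t3].
have [WX' _] := cX t' t'I; have [WY' _] := cY t' t'I; have [WF' _] := cF t' t'I.
apply: le_trans (vfield_lip c q12 WF' WF WX' WX WY' WY) _.
have {}H1 := H1 t' t'I t1; have {}H2 := H2 t' t'I t2; have {}H3 := H3 t' t'I t3.
have BY : nW q (Y t') <= nW q (Y t) + 1.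
  rewrite (@eq_nW q _ (fun x => Y t x + (Y t' x - Y t x))); last by move=> x; rewrite addrC subrK.
  by apply: le_trans (nWD WY (WB WY' WY)) _; rewrite lerD2l (le_trans H2).
apply: (@le_trans _ _ (d * K)); last first.
  rewrite -ler_pdivlMr ?(lt_le_trans ltr01)//.
  by rewrite /d ge_min lexx orbT.
have -> : d * K = d + `|c| * (Cs q * 2 * (d * (nW q (Y t) + 1) + nW q (X t) * d)).
  by rewrite /K; ring.
apply: lerD => //; rewrite ler_wpM2l// (ler_wpM2l (mulr_ge0 (Cs_ge0 q) (ler0n _ 2)))//.
by apply: lerD; apply: ler_pM => //; exact: nW_ge0.
Qed.

Lemma Wderiv_weakd q X F t : 0 <= q -> W q (X t) -> W q (F t) -> Wderiv q X t (F t) ->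
  weakd X F t.
Proof.
move=> q0 WX WF dX phi tphi; set k := kern phi; have Lk : L2 k := L2_kern tphi.
apply: is_derive_epsI => e e0.
have [r r0 Hr] := dX (e / (n2 k + 1)) (divr_gt0 e0 (ltr_wpDl (n2_ge0 k) ltr01)).
exists r => // t' /Hr[WX' B].
have [L _ _] := pairW q0 WX Lk; have [L' _ _] := pairW q0 WX' Lk.
have [LF _ _] := pairW q0 WF Lk.
rewrite -RintZ// -RintB// -RintB; [|exact: L1B|exact: L1Z].
rewrite (eq_Rint (g := fun x => (X t' x - X t x - (t' - t) * F t x) * k x)) => [|x]; last by ring.
have [_ _ CS] := pairW q0 (WB (WB WX' WX) (WZ (t' - t) WF)) Lk; apply: le_trans CS _.
apply: le_trans (ler_wpM2r (n2_ge0 k) B) _.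
have -> : e / (n2 k + 1) * `|t' - t| * n2 k = e * `|t' - t| * (n2 k / (n2 k + 1)) by ring.
rewrite ler_piMr//; first by rewrite mulr_ge0// ltW.
by rewrite ler_pdivrMr ?mul1r ?lerDl// ltr_wpDl ?n2_ge0.
Qed.

(** * Derivatives of weighted norms *)

Definition dotW (p : R) f g : R := \int[mu]_x ((wt p x * f x) * (wt p x * g x)).

Lemma dotW_le p f g : W p f -> W p g -> `|dotW p f g| <= nW p f * nW p g.
Proof. by move=> Wf Wg; exact: cauchy_schwarz. Qed.

Lemma sqr_nWD p f g : W p f -> W p g ->
  nW p (fun x => f x + g x) ^+ 2 = nW p f ^+ 2 + 2 * dotW p f g + nW p g ^+ 2.
Proof.
move=> Wf Wg; rewrite /nW !sqr_n2 /dotW -RintZ; last exact: L2M.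
rewrite -RintD; [|by case: Wf|by apply: L1Z; exact: L2M].
rewrite -RintD; [|by apply: L1D; [case: Wf|apply: L1Z; exact: L2M]|by case: Wg].
by apply: eq_Rint => x; ring.
Qed.

Lemma dotWD p f g h : W p f -> W p g -> W p h ->
  dotW p f (fun x => g x + h x) = dotW p f g + dotW p f h.
Proof.
move=> Wf Wg Wh; rewrite /dotW -RintD; [|exact: L2M|exact: L2M].
by apply: eq_Rint => x; ring.
Qed.

Lemma dotWZ p c f g : W p f -> W p g -> dotW p f (fun x => c * g x) = c * dotW p f g.
Proof.
move=> Wf Wg; rewrite /dotW -RintZ; last exact: L2M.
by apply: eq_Rint => x; ring.
Qed.

Lemma is_derive_sqr_nW p q X t D : 0 <= p -> p <= q -> W q (X t) -> W q D -> Wderiv q X t D ->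
  is_derive t 1 (fun t' => nW p (X t') ^+ 2) (2 * dotW p (X t) D).
Proof.
move=> p0 pq WqX WqD dX; have WX := W_le pq WqX; have WD_ := W_le pq WqD.
apply: is_derive_epsI => e e0.
pose N := nW p (X t); pose M := nW p D.
have N0 : 0 <= N by exact: nW_ge0.
have M0 : 0 <= M by exact: nW_ge0.
pose d := Num.min 1 (e / (4 * (N + 1))).
have d0 : 0 < d by rewrite lt_min ltr01 divr_gt0// mulr_gt0// ltr_wpDl.
have d1 : d <= 1 by rewrite ge_min lexx.
have dN : 2 * N * d <= e / 2.
  have H : d <= e / (4 * (N + 1)) by rewrite ge_min lexx orbT.
  apply: le_trans (ler_wpM2l _ H) _; first by rewrite mulr_ge0.
  rewrite mulrA ler_pdivrMr ?mulr_gt0// ?ltr_wpDl//; nra.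
have [r0 r00 Hr] := dX d d0.
exists (Num.min r0 (e / (2 * (M + 1) ^+ 2))).
  by rewrite lt_min r00 divr_gt0// mulr_gt0// exprn_gt0// ltr_wpDl.
move=> t'; rewrite lt_min => /andP[t1 t2]; have [WqX' B] := Hr t' t1.
have WX' := W_le pq WqX'.
set h := t' - t in t1 t2 B *.
have WhD := WZ h WD_; have WR := WB (WB WX' WX) WhD.
have {}B : nW p (fun x => X t' x - X t x - h * D x) <= d * `|h|.
  apply: le_trans B; apply: nW_le => //; apply: WB; [exact: WB|exact: WZ].
set rho := fun x => X t' x - X t x - h * D x in B WR.
have E1 : (X t' : R -> R) = (fun x => X t x + (h * D x + rho x)).
  by apply/funext => x; rewrite /rho; ring.
have WS := WD WhD WR.
rewrite {1}E1 sqr_nWD// dotWD// dotWZ//.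
have -> : nW p (X t) ^+ 2 + 2 * (h * dotW p (X t) D + dotW p (X t) rho) +
    nW p (fun x => h * D x + rho x) ^+ 2 - nW p (X t) ^+ 2 - h * (2 * dotW p (X t) D) =
    2 * dotW p (X t) rho + nW p (fun x => h * D x + rho x) ^+ 2 by ring.
apply: le_trans (ler_normD _ _) _.
rewrite normrM [`|2|]gtr0_norm// [`|_ ^+ 2|]ger0_norm ?sqr_ge0//.
have T1 : 2 * `|dotW p (X t) rho| <= e / 2 * `|h|.
  apply: (@le_trans _ _ (2 * (N * (d * `|h|)))).
    rewrite ler_wpM2l//; apply: le_trans (dotW_le WX WR) _; by rewrite ler_wpM2l.
  have -> : 2 * (N * (d * `|h|)) = 2 * N * d * `|h| by ring.
  by rewrite ler_wpM2r.
have T2 : nW p (fun x => h * D x + rho x) <= `|h| * (M + 1).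
  apply: le_trans (nWD WhD WR) _; rewrite nWZ// mulrDr lerD2l mulr1.
  by apply: le_trans B _; rewrite ler_piMl.
have T3 : nW p (fun x => h * D x + rho x) ^+ 2 <= e / 2 * `|h|.
  apply: (@le_trans _ _ ((`|h| * (M + 1)) ^+ 2)).
    by rewrite lerXn2r// nnegrE ?nW_ge0// mulr_ge0// addr_ge0.
  rewrite exprMn expr2 -mulrA mulrC ler_wpM2r//.
  have M1 : 0 < 2 * (M + 1) ^+ 2 by rewrite mulr_gt0// exprn_gt0// ltr_wpDl.
  by move: (ltW t2); rewrite ler_pdivlMr// mulrCA; lra.
by apply: le_trans (lerD T1 T3) _; rewrite -mulrDl -splitr.
Qed.

(** * A priori bounds *)

Lemma W_L12 q h : 2^-1 <= q -> W q h -> L1 h /\ L2 h.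
Proof.
move=> q12 Wh; have W12 := W_le q12 Wh; split; first by have [] := W_L1 W12.
by apply: W_L2 W12; rewrite invr_ge0.
Qed.

Lemma dmul_L12 q h : 3 / 4 < q -> W q h -> L1 (dmul h) /\ L2 (dmul h).
Proof.
move=> q34 Wh; have [Ld _] := W_L1_dmul q34 Wh; split=> //.
by apply: W_L2_dmul; apply: W_le Wh; lra.
Qed.

Lemma dmul_skew a b : W 2^-1 a -> W 2^-1 b ->
  \int[mu]_x (dmul a x * b x) = - \int[mu]_x (a x * dmul b x).
Proof.
move=> Wa Wb; have h0 : 0 <= 2^-1 :> R by rewrite invr_ge0.
have La := W_L2 h0 Wa; have Lb := W_L2 h0 Wb.
have Lda := W_L2_dmul Wa; have Ldb := W_L2_dmul Wb.
rewrite -(Rint_reflect (f := fun x => dmul a x * b x)); last exact: L2M.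
rewrite -mulN1r -RintZ; last exact: L2M.
by apply: eq_Rint => x; rewrite /dmul opprK; ring.
Qed.

Lemma dotW_Mm a g : W 2^-1 a -> W 2^-1 g ->
  dotW 2^-1 a (Mm g) = \int[mu]_x (dmul a x * g x).
Proof.
move=> Wa Wg; have h0 : 0 <= 2^-1 :> R by rewrite invr_ge0.
rewrite -(Rint_reflect (f := fun x => dmul a x * g x)); last first.
  by apply: L2M; [exact: W_L2_dmul|exact: W_L2 Wg].
apply: eq_Rint => x; rewrite mulrACA -expr2 wt_half_sqr /Mm /dmul opprK.
have := onesqr_gt0 x; move: (1 + x ^+ 2) => D D0; field; exact: lt0r_neq0.
Qed.

(** The integral of f' f g is minus one half of that of f^2 g', for f and g the
    inverse transforms of a and b. With a = b both vanish. *)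
Lemma star_parts q a b : 3 / 4 < q -> W q a -> W q b ->
  \int[mu]_x (dmul a x * star a b x) = - 2^-1 * \int[mu]_x (dmul b x * star a a x).
Proof.
move=> q34 Wa Wb; have q12 : 2^-1 <= q by lra.
have q0 : 0 <= q by lra.
have Wa1 := W_le q12 Wa; have Wb1 := W_le q12 Wb.
have [Waa _] := nW_star q0 Wa Wa Wa1 Wa1; have [Wab _] := nW_star q0 Wa Wb Wa1 Wb1.
have Waa1 := W_le q12 Waa.
have [L1a L2a] := W_L12 q12 Wa; have [L1b L2b] := W_L12 q12 Wb.
have [L1aa L2aa] := W_L12 q12 Waa; have [L1ab L2ab] := W_L12 q12 Wab.
have [L1da L2da] := dmul_L12 q34 Wa.
have [L1daa L2daa] := dmul_L12 q34 Waa.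
rewrite (dmul_skew Wb1 Waa1) mulrN mulNr opprK (ihat_parseval L1da L2da L1ab L2ab).
rewrite (ihat_parseval L1b L2b L1daa L2daa) [RHS]mulrCA; congr (_ * _).
rewrite -RintZ; last by apply: L2M; exact: L2_ihat.
apply: eq_Rint => x; rewrite -ihatM//.
have -> : ihat (dmul (star a a)) x = 2 * (ihat a x * ihat (dmul a) x).
  have [_ <-] := is_derive_ihat x L1aa L1daa.
  have D := is_derive_ihat x L1a L1da.
  have DD : is_derive x 1 (fun y => ihat a y * ihat a y) (2 * (ihat a x * ihat (dmul a) x)).
    by apply: is_derive_eq; rewrite /GRing.scale/=; ring.
  have E : ihat (star a a) = (fun y => ihat a y * ihat a y).
    by apply/funext => y; rewrite ihatM.
  by rewrite E; case: DD.
by field.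
Qed.

(** The H^1 energy identity. The multiplier Mm cancels the weight of H^1, the
    linear terms cancel by skewness, the integral of v^2 v_x vanishes, and the
    only remaining term is minus the integral of v_x eta^2, which a lower bound
    for v_x controls. *)
Lemma energy_le q a b M : 3 / 4 < q -> W q a -> W q b -> 0 <= M ->
  (forall x, - M <= ihat (dmul b) x) ->
  2 * dotW 2^-1 a (vfield b 1 a b) + 2 * dotW 2^-1 b (vfield a 2^-1 b b) <=
  M * (nW 2^-1 a ^+ 2 + nW 2^-1 b ^+ 2).
Proof.
move=> q34 Wa Wb M0 Mb; have q12 : 2^-1 <= q by lra.
have q0 : 0 <= q by lra.
have Wa1 := W_le q12 Wa; have Wb1 := W_le q12 Wb.
have [Waa _] := nW_star q0 Wa Wa Wa1 Wa1; have [Wab _] := nW_star q0 Wa Wb Wa1 Wb1.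
have [Wbb _] := nW_star q0 Wb Wb Wb1 Wb1.
have Waa1 := W_le q12 Waa; have Wab1 := W_le q12 Wab; have Wbb1 := W_le q12 Wbb.
have [L1a L2a] := W_L12 q12 Wa; have [L1b L2b] := W_L12 q12 Wb.
have [L1aa L2aa] := W_L12 q12 Waa; have [L1ab L2ab] := W_L12 q12 Wab.
have [_ L2bb] := W_L12 q12 Wbb.
have [L1da L2da] := dmul_L12 q34 Wa; have [L1db L2db] := dmul_L12 q34 Wb.
rewrite /vfield !dotW_Mm//; [|exact/WD/WZ|exact/WD/WZ].
have -> : \int[mu]_x (dmul a x * (b x + 1 * star a b x)) =
    \int[mu]_x (dmul a x * b x) + \int[mu]_x (dmul a x * star a b x).
  rewrite -RintD; [|exact: L2M|exact: L2M].
  by apply: eq_Rint => x; ring.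
have -> : \int[mu]_x (dmul b x * (a x + 2^-1 * star b b x)) =
    \int[mu]_x (dmul b x * a x) + 2^-1 * \int[mu]_x (dmul b x * star b b x).
  rewrite -RintZ; last exact: L2M.
  rewrite -RintD; [|exact: L2M|by apply: L1Z; exact: L2M].
  by apply: eq_Rint => x; ring.
have Z : \int[mu]_x (dmul b x * star b b x) = 0 by have := star_parts q34 Wb Wb; lra.
rewrite Z (star_parts q34 Wa Wb) (dmul_skew Wa1 Wb1) mulr0 addr0.
have -> : \int[mu]_x (dmul b x * a x) = \int[mu]_x (a x * dmul b x).
  by apply: eq_Rint => x; rewrite mulrC.
have -> : 2 * (- (\int[mu]_x (a x * dmul b x)) + - 2^-1 * \int[mu]_x (dmul b x * star a a x)) +
   2 * \int[mu]_x (a x * dmul b x) = - (\int[mu]_x (dmul b x * star a a x)) by field.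
apply: (@le_trans _ _ (M * \int[mu]_x (a x * a x))); last first.
  rewrite ler_wpM2l//; apply: (@le_trans _ _ (nW 2^-1 a ^+ 2)); last by rewrite lerDl sqr_ge0.
  rewrite /nW sqr_n2; apply: Rint_le; [exact: L2M|by case: Wa1|] => x.
  rewrite -expr2 exprMn ler_peMl ?sqr_ge0// wt_half_sqr; exact: onesqr_ge1.
have p0 := twopi_gt0.
have [IA IB] := (L2_ihat L1db L2db, L2_ihat L1aa L2aa).
have IC := L2_ihat L1a L2a.
rewrite (ihat_parseval L1db L2db L1aa L2aa) (ihat_parseval L1a L2a L1a L2a) -mulrN mulrCA ler_pM2l// -mulN1r -!RintZ; [|exact: L2M|exact: L2M].
apply: Rint_le; [by apply: L1Z; exact: L2M|by apply: L1Z; exact: L2M|] => x.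
rewrite -ihatM// mulrA ler_wpM2r ?mulN1r 1?lerNl//.
by rewrite -expr2 sqr_ge0.
Qed.

(** By the tame estimate, the H^s energy grows at a linear rate with a
    coefficient that involves the H^1 norm only. *)
Lemma tame_le q a b K : 2^-1 <= q -> W q a -> W q b -> nW 2^-1 a <= K -> nW 2^-1 b <= K ->
  2 * dotW q a (vfield b 1 a b) + 2 * dotW q b (vfield a 2^-1 b b) <=
  (2 + 3 * Cs q * K) * (nW q a ^+ 2 + nW q b ^+ 2).
Proof.
move=> q12 Wa Wb aK bK.
have [WF1 B1] := vfield_W 1 q12 Wb Wa Wb; have [WF2 B2] := vfield_W 2^-1 q12 Wa Wb Wb.
have D1 := le_trans (ler_norm _) (dotW_le Wa WF1).
have D2 := le_trans (ler_norm _) (dotW_le Wb WF2).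
have C0 := Cs_ge0 q; have a0 := nW_ge0 q a; have b0 := nW_ge0 q b.
move: B1 B2; rewrite normr1 mul1r [`|2^-1|]ger0_norm// => B1 B2.
have {}B1 : nW q (vfield b 1 a b) <= nW q b + Cs q * (K * nW q b + K * nW q a).
  by apply: le_trans B1 _; rewrite lerD2l ler_wpM2l//; apply: lerD; rewrite ler_wpM2r.
have {}B2 : nW q (vfield a 2^-1 b b) <= nW q a + Cs q * (K * nW q b).
  apply: le_trans B2 _; rewrite lerD2l mulrCA ler_wpM2l//.
  have -> : K * nW q b = 2^-1 * (K * nW q b + K * nW q b) by field.
  by rewrite ler_wpM2l//; apply: lerD; rewrite ler_wpM2r.
have K0 : 0 <= K := le_trans (nW_ge0 _ _) aK.
have := ler_wpM2l a0 B1; have := ler_wpM2l b0 B2.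
move: D1 D2; move: (dotW _ _ _) (dotW _ _ _) (nW q (vfield _ _ _ _)) (nW q (vfield _ _ _ _)) => d1 d2 f1 f2.
have CK : 0 <= Cs q * K by rewrite mulr_ge0.
move: CK a0 b0; rewrite -[3 * Cs q * K]mulrA.
move: (nW q a) (nW q b) => x y; have -> : x * (y + Cs q * (K * y + K * x)) = x * y + (Cs q * K) * (x * y + x * x) by ring.
have -> : y * (x + Cs q * (K * y)) = x * y + (Cs q * K) * (y * y) by ring.
move: (Cs q * K) => c c0 x0 y0 H1 H2 H3 H4.
have := sqr_ge0 (x - y); have := mulr_ge0 c0 (sqr_ge0 (x - y)); clear -H1 H2 H3 H4; nra.
Qed.

(** N t * exp (- C t) is nonincreasing. *)
Lemma gronwall (N dN : R -> R) (C : R) t0 hi :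
  (forall t, t0 <= t < hi -> is_derive t 1 N (dN t) /\ dN t <= C * N t) ->
  forall t, t0 <= t < hi -> N t <= N t0 * expR (C * (t - t0)).
Proof.
move=> HN t /andP[]; rewrite le_eqVlt => /orP[/eqP <- _|t0t thi].
  by rewrite subrr mulr0 expR0 mulr1.
pose g s := N s * expR (- C * (s - t0)).
have dg s : t0 <= s < hi -> is_derive s 1 g ((dN s - C * N s) * expR (- C * (s - t0))).
  move=> sI; have [D _] := HN s sI.
  have D1 : is_derive s 1 (fun s : R => - C * (s - t0)) (- C).
    by apply: is_derive_eq; rewrite /GRing.scale/=; ring.
  have D2 : is_derive s 1 (fun s : R => expR (- C * (s - t0))) (- C * expR (- C * (s - t0))).
    by apply: is_derive_eq; rewrite /GRing.scale/=; ring.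
  by rewrite /g; apply: is_derive_eq; rewrite /GRing.scale/=; ring.
have sI s : s \in `]t0, t[ -> t0 <= s < hi.
  by rewrite in_itv/= => /andP[s1 s2]; rewrite (ltW s1) (lt_trans s2).
have [||c cI E] := @MVT R g (fun s => (dN s - C * N s) * expR (- C * (s - t0))) t0 t t0t.
- by move=> s /sI; exact: dg.
- apply: derivable_within_continuous => s; rewrite in_itv/= => /andP[s1 s2].
  have sH : t0 <= s < hi by rewrite s1 (le_lt_trans s2).
  by case: (dg s sH).
have [_ H] := HN c (sI c cI).
have : g t <= g t0.
  rewrite -subr_le0 E; apply: mulr_le0_ge0; last by rewrite subr_ge0 ltW.
  by apply: mulr_le0_ge0; rewrite ?expR_ge0// subr_le0.
rewrite /g subrr mulr0 expR0 mulr1 mulNr expRN.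
by rewrite ler_pdivrMr ?expR_gt0.
Qed.

(** * Solutions on the transform side *)

(** The equation is asked on the open interval only, where both sides of each
    instant are available. *)
Definition hsol q lo hi A B : Prop :=
  [/\ Wcont q A lo hi, Wcont q B lo hi &
      forall t, lo < t < hi -> weakd A (fun t => vfield (B t) 1 (A t) (B t)) t /\
                               weakd B (fun t => vfield (A t) 2^-1 (B t) (B t)) t].

Lemma gronwall_bdd (N dN : R -> R) (C : R) t0 hi : 0 <= C -> 0 <= N t0 ->
  (forall t, t0 <= t < hi -> is_derive t 1 N (dN t) /\ dN t <= C * N t) ->
  forall t, t0 <= t < hi -> N t <= N t0 * expR (C * (hi - t0)).
Proof.
move=> C0 N0 HN t tI; apply: le_trans (gronwall HN tI) _.
rewrite ler_wpM2l// ler_expR ler_wpM2l// lerD2r.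
by case/andP: tI => _ /ltW.
Qed.

(** Gronwall's inequality, first for the H^1 energy, then for the H^s energy,
    whose growth rate the first bound controls. *)
Lemma hsol_bounded q lo hi A B t0 M : 3 / 4 < q -> hsol q lo hi A B -> lo < t0 < hi ->
  0 <= M -> (forall t, t0 <= t < hi -> forall x, - M <= ihat (dmul (B t)) x) ->
  exists2 K, 0 <= K & forall t, t0 <= t < hi -> nW q (A t) <= K /\ nW q (B t) <= K.
Proof.
move=> q34 [cA cB wd] /andP[lt0 t0h] M0 HM.
have q12 : 2^-1 <= q by lra.
have q0 : 0 <= q by lra.
have h0 : 0 <= 2^-1 :> R by rewrite invr_ge0.
have cFA := Wcont_vfield 1 q12 cA cB cB; have cFB := Wcont_vfield 2^-1 q12 cB cB cA.
pose FA t := vfield (B t) 1 (A t) (B t); pose FB t := vfield (A t) 2^-1 (B t) (B t).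
have tI t : t0 <= t < hi -> lo <= t < hi.
  by move=> /andP[h1 h2]; rewrite h2 (le_trans (ltW lt0)).
have tI' t : t0 <= t < hi -> lo < t < hi.
  by move=> /andP[h1 h2]; rewrite h2 (lt_le_trans lt0).
have WA t : t0 <= t < hi -> W q (A t) by move=> /tI /cA [].
have WB_ t : t0 <= t < hi -> W q (B t) by move=> /tI /cB [].
have dA t : t0 <= t < hi -> Wderiv q A t (FA t).
  by move=> /tI'; apply: (weakd_Wderiv q0 cA cFA) => s sI _; have [] := wd s sI.
have dB t : t0 <= t < hi -> Wderiv q B t (FB t).
  by move=> /tI'; apply: (weakd_Wderiv q0 cB cFB) => s sI _; have [] := wd s sI.
pose N p t := nW p (A t) ^+ 2 + nW p (B t) ^+ 2.
pose dN p t := 2 * dotW p (A t) (FA t) + 2 * dotW p (B t) (FB t).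
have N0 p t : 0 <= N p t by rewrite addr_ge0 ?sqr_ge0.
have ND p t : 0 <= p -> p <= q -> t0 <= t < hi -> is_derive t 1 (N p) (dN p t).
  move=> p0 pq tt; have [WFA _] := cFA t (tI t tt); have [WFB _] := cFB t (tI t tt).
  have D1 := is_derive_sqr_nW p0 pq (WA t tt) WFA (dA t tt).
  have D2 := is_derive_sqr_nW p0 pq (WB_ t tt) WFB (dB t tt).
  by rewrite /N /dN; apply: is_derive_eq.
have Nsq p t (K : R) : N p t <= K -> nW p (A t) <= Num.sqrt K /\ nW p (B t) <= Num.sqrt K.
  move=> H; have K0 := le_trans (N0 p t) H.
  by split; rewrite -[leLHS]ger0_norm ?nW_ge0// -sqrtr_sqr ler_wsqrtr//; apply: le_trans H; rewrite ?lerDl ?lerDr sqr_ge0.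
pose K1 := Num.sqrt (N 2^-1 t0 * expR (M * (hi - t0))).
have HK1 t : t0 <= t < hi -> nW 2^-1 (A t) <= K1 /\ nW 2^-1 (B t) <= K1.
  move=> tt; apply: Nsq; apply: (gronwall_bdd (dN := dN 2^-1)) tt => // s ss.
  by split; [exact: ND|apply: (energy_le q34); [exact: WA|exact: WB_| |exact: HM]].
(* the growth rate of the H^s energy involves the H^1 bound K1 only *)
pose C := 2 + 3 * Cs q * K1.
have C0 : 0 <= C.
  rewrite addr_ge0// mulr_ge0 ?sqrtr_ge0//; apply: mulr_ge0 => //; exact: Cs_ge0.
exists (Num.sqrt (N q t0 * expR (C * (hi - t0)))); first exact: sqrtr_ge0.
move=> t tt; apply: Nsq; apply: (gronwall_bdd (dN := dN q)) tt => // s ss.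
split; first exact: ND.
by have [HA HB] := HK1 s ss; apply: tame_le => //; [exact: WA|exact: WB_].
Qed.

(** A bounded derivative makes the solution Lipschitz, hence Cauchy at hi. *)
Lemma Wcont_limit q X F lo hi t0 S : 0 <= q -> Wcont q X lo hi -> lo <= t0 < hi -> 0 <= S ->
  (forall t, t0 < t < hi -> [/\ weakd X F t, W q (F t) & nW q (F t) <= S]) ->
  exists2 a, W q a & forall t, t0 <= t < hi -> nW q (fun x => X t x - a x) <= S * (hi - t).
Proof.
move=> q0 cX /andP[lt0 t0h] S0 HF.
have tI t : t0 <= t < hi -> lo <= t < hi.
  by move=> /andP[h1 h2]; rewrite h2 (le_trans lt0).
have WX t : t0 <= t < hi -> W q (X t) by move=> /tI /cX [].
have lip t1 t2 : t0 <= t1 -> t1 <= t2 -> t2 < hi ->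
    nW q (fun x => X t2 x - X t1 x) <= S * (t2 - t1).
  move=> h1; rewrite le_eqVlt => /orP[/eqP <- h3|h2 h3].
    rewrite subrr mulr0 (@eq_nW q _ (cst 0)) ?nW_0// => x /=; exact: subrr.
  have := @mean_value q X F lo hi t1 t2 (cst 0) S q0 cX (le_trans lt0 h1) h2 h3 (W_0 q) S0 _.
  rewrite mulrC (@eq_nW q _ (fun x => X t2 x - X t1 x)); last by move=> x; rewrite /= mulr0 subr0.
  apply=> s /andP[s1 s2]; have sI : t0 < s < hi.
    by rewrite (le_lt_trans h1)// (lt_trans s2).
  have [w Ws Bs] := HF s sI.
  by split=> //; rewrite (@eq_nW q _ (F s))// => x; rewrite /= subr0.
pose d := hi - t0; have d0 : 0 < d by rewrite subr_gt0.
pose tau (n : nat) : R := hi - d / n.+1%:R.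
have n1 (n : nat) : 0 < n.+1%:R :> R by rewrite ltr0n.
have tauI n : t0 <= tau n < hi.
  rewrite /tau gtrBl divr_gt0// andbT lerBrDl -lerBrDr ler_pdivrMr// ler_peMr ?(ltW d0)//.
  by rewrite ler1n.
have tau_le n m : (n <= m)%N -> tau n <= tau m.
  by move=> nm; rewrite lerD2l lerN2 ler_pM2l// lef_pV2 ?posrE// ler_nat.
have small e : 0 < e -> exists N, hi - tau N < e.
  move=> e0; have [n _ Hn] := @near_infty_natSinv_lt R (PosNum (divr_gt0 e0 d0)).
  exists n; have := Hn n (leqnn n) => /=; rewrite ltr_pdivlMr// => H.
  by rewrite /tau subKr mulrC.
have [|e e0|a [Wa Ca]] := @W_complete q (fun n => X (tau n)).
- by move=> n; exact: WX.
- have [N HN] := small (e / (S + 1)) (divr_gt0 e0 (ltr_wpDl S0 ltr01)).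
  have aux m n : (N <= m)%N -> (m <= n)%N -> nW q (fun x => X (tau n) x - X (tau m) x) <= e.
    move=> Nm mn; have /andP[h1 h2] := tauI m; have /andP[h3 h4] := tauI n.
    apply: le_trans (lip _ _ h1 (tau_le _ _ mn) h4) _.
    have : tau n - tau m <= e / (S + 1).
      have := tau_le _ _ Nm; lra.
    move=> /(ler_wpM2l S0)/le_trans; apply.
    by rewrite mulrCA ler_piMr ?(ltW e0)// ler_pdivrMr ?mul1r ?lerDl// ltr_wpDl.
  exists N => m n Nm Nn; case: (leqP m n) => [mn|/ltnW nm]; last exact: aux.
  by rewrite nWBC; exact: aux.
exists a => // t tt; apply/ler_addgt0Pr => e e0.
have /andP[h1 h2] := tt.
have /cvgrPdist_lt/(_ e e0)[N1 _ HN1] := Ca.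
have ht : 0 < hi - t by rewrite subr_gt0.
have [N2 HN2] := small _ ht.
pose n := maxn N1 N2; have /andP[h3 h4] := tauI n.
have tn : t <= tau n.
  have := tau_le _ _ (leq_maxr N1 N2); rewrite -/n; lra.
have := HN1 n (leq_maxl N1 N2); rewrite sub0r normrN ger0_norm ?nW_ge0// => Hn.
apply: le_trans (nW_tri (WX t tt) (WX _ (tauI n)) Wa) _.
apply: lerD; last exact: ltW.
rewrite nWBC; apply: le_trans (lip _ _ h1 tn h4) _.
by rewrite ler_wpM2l// lerD2r ltW.
Qed.

(** * Local solutions by power series *)

Implicit Types (xs ls fs gs : nat -> R -> R) (tau : R).

Definition psum xs (N : nat) tau y : R := \sum_(n < N) tau ^+ n * xs n y.

Lemma psumS xs N tau : psum xs N.+1 tau = (fun y => tau ^+ N * xs N y + psum xs N tau y).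
Proof. by apply/funext => y; rewrite /psum big_ord_recr addrC. Qed.

Lemma W_psum q xs N tau : (forall n, W q (xs n)) -> W q (psum xs N tau).
Proof. by move=> Wx; apply: W_sum => n; exact: WZ. Qed.

Lemma psum_tail q xs C tau (N d : nat) : (forall n, W q (xs n)) -> 0 <= C ->
  (forall n, `|tau| ^+ n * nW q (xs n) <= C * 2^-1 ^+ n) ->
  nW q (fun y => psum xs (N + d) tau y - psum xs N tau y) <= 2 * C * 2^-1 ^+ N.
Proof.
move=> Wx C0 Hx.
have -> : (fun y => psum xs (N + d) tau y - psum xs N tau y) =
    (fun y => \sum_(j < d) tau ^+ (N + j) * xs (N + j)%N y).
  by apply/funext => y; rewrite /psum big_split_ord/= addrAC subrr add0r.
apply: le_trans (nW_sum (fun j => WZ _ (Wx _))) _.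
apply: (@le_trans _ _ (\sum_(j < d) C * 2^-1 ^+ N * 2^-1 ^+ j)).
  apply: ler_sum => j _; rewrite nWZ// normrX; apply: le_trans (Hx _) _.
  by rewrite exprD mulrA.
rewrite -mulr_sumr -[2 * C * _]mulrA [leRHS]mulrC ler_wpM2l ?geo_sum//.
by rewrite mulr_ge0// exprn_ge0// invr_ge0.
Qed.

Lemma psum_ex q xs C tau : (forall n, W q (xs n)) -> 0 <= C ->
  (forall n, `|tau| ^+ n * nW q (xs n) <= C * 2^-1 ^+ n) ->
  exists f, W q f /\ forall N, nW q (fun y => psum xs N tau y - f y) <= 2 * C * 2^-1 ^+ N.
Proof.
move=> Wx C0 Hx.
have geo : (fun N : nat => 2 * C * 2^-1 ^+ N : R) @ \oo --> (0 : R).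
  have := @cvg_geometric R (2 * C) 2^-1; rewrite ger0_norm// invf_lt1// ltr1n.
  by apply.
have C2 N : 0 <= 2 * C * 2^-1 ^+ N :> R.
  by rewrite !mulr_ge0// exprn_ge0// invr_ge0.
have T := fun N d => psum_tail N d Wx C0 Hx.
have [|e e0|f [Wf Cf]] := @W_complete q (fun N => psum xs N tau).
- by move=> N; exact: W_psum.
- have /cvgrPdist_lt/(_ e e0)[N _ HN] := geo; exists N => m n Nm Nn.
  have B (k : nat) : (N <= k)%N -> 2 * C * 2^-1 ^+ k <= e.
    by move=> Nk; have := HN k Nk; rewrite sub0r normrN ger0_norm// => /ltW.
  case: (leqP m n) => [mn|/ltnW nm].
    by rewrite nWBC -(subnKC mn); apply: le_trans (T _ _) (B _ _).
  by rewrite -(subnKC nm); apply: le_trans (T _ _) (B _ _).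
exists f; split=> // N; apply/ler_addgt0Pr => e e0.
have /cvgrPdist_lt/(_ e e0)[M _ HM] := Cf.
have := HM (N + M)%N (leq_addl N M); rewrite sub0r normrN ger0_norm ?nW_ge0// => He.
apply: le_trans (nW_tri (W_psum N tau Wx) (W_psum (N + M) tau Wx) Wf) _.
by apply: lerD; [rewrite nWBC; exact: T|exact: ltW].
Qed.

Lemma triangleE (F : nat -> nat -> R) (N : nat) :
  \sum_(n < N) \sum_(k < n.+1) F k (n - k)%N = \sum_(k < N) \sum_(j < N - k) F k j.
Proof.
elim: N => [|N IH]; first by rewrite !big_ord0.
rewrite big_ord_recr IH /= [in RHS]big_ord_recr/= subSnn big_ord1.
rewrite [X in _ + X = _]big_ord_recr/= subnn addrA -big_split/=; congr (_ + _).
by apply: eq_bigr => k _; rewrite subSn ?(ltnW (ltn_ord k))// big_ord_recr.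
Qed.

(** Square and triangular partial sums of a double series with geometric bounds
    have the same limit: this is the Cauchy product. *)
Lemma square_triangle (F : nat -> nat -> R) C (N : nat) : 0 <= C ->
  (forall i j, `|F i j| <= C * 8^-1 ^+ (i + j)) ->
  `|\sum_(i < N) \sum_(j < N) F i j - \sum_(n < N) \sum_(k < n.+1) F k (n - k)%N|
    <= C * 2^-1 ^+ N.
Proof.
move=> C0 HF; rewrite triangleE -sumrB.
apply: le_trans (ler_norm_sum _ _ _) _.
have N2 : N%:R <= 2 ^+ N :> R by rewrite -natrX ler_nat ltnW// ltn_expl.
have h8 : 0 <= 8^-1 :> R by rewrite invr_ge0.
(* at most N * N terms are missing, each of them at most C * 8^-N *)
apply: (@le_trans _ _ (\sum_(i < N) 2 ^+ N * (C * 8^-1 ^+ N))).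
  apply: ler_sum => i _.
  have iN := ltnW (ltn_ord i).
  have -> : \sum_(j < N) F i j - \sum_(j < N - i) F i j = \sum_(j < i) F i (N - i + j)%N.
    have -> : \sum_(j < N) F i j = \sum_(j < N - i + i) F i j by rewrite subnK.
    by rewrite big_split_ord/= addrAC subrr add0r.
  apply: le_trans (ler_norm_sum _ _ _) _.
  apply: (@le_trans _ _ (\sum_(j < i) C * 8^-1 ^+ N)).
    apply: ler_sum => j _; apply: le_trans (HF _ _) _; rewrite ler_wpM2l//.
    by rewrite addnA (subnKC iN) ler_wiXn2l// ?leq_addr// invf_le1// ler1n.
  rewrite sumr_const card_ord -[X in X <= _]mulr_natl ler_wpM2r ?mulr_ge0 ?exprn_ge0//.
  by apply: le_trans N2; rewrite ler_nat.
rewrite sumr_const card_ord -[X in X <= _]mulr_natl.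
apply: (@le_trans _ _ (2 ^+ N * (2 ^+ N * (C * 8^-1 ^+ N)))).
  by rewrite ler_wpM2r// !mulr_ge0 ?exprn_ge0.
rewrite mulrA mulrCA -!exprMn ler_wpM2l// le_eqVlt; apply/orP; left; apply/eqP.
by congr (_ ^+ _); field.
Qed.

(** Convergence is stated with its rate, which the Cauchy product uses. *)
Definition is_psum q C xs tau (f : R -> R) : Prop :=
  W q f /\ forall N, nW q (fun y => psum xs N tau y - f y) <= 2 * C * 2^-1 ^+ N.

Lemma cvg_half C : (fun N : nat => C * 2^-1 ^+ N : R) @ \oo --> (0 : R).
Proof.
have := @cvg_geometric R C 2^-1; rewrite ger0_norm// invf_lt1// ltr1n.
by apply.
Qed.

Lemma cvg_half_le (u : nat -> R) (v C : R) :
  (forall n, `|u n - v| <= C * 2^-1 ^+ n) -> u @ \oo --> v.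
Proof.
move=> H; apply/cvgrPdist_le => e e0.
have /cvgrPdist_le/(_ e e0)[N _ HN] := cvg_half C.
exists N => // n Nn; rewrite distrC; apply: le_trans (H n) _.
by apply: le_trans (HN n Nn); rewrite sub0r normrN ler_norm.
Qed.

Lemma cvgn_half (u : nat -> R) C : (forall n, `|u n| <= C * 2^-1 ^+ n) -> cvgn (series u).
Proof.
move=> H; apply: normed_cvg; apply: (@series_le_cvg _ _ (geometric C 2^-1)).
- by move=> n; exact: normr_ge0.
- by move=> n; exact: le_trans (normr_ge0 _) (H n).
- exact: H.
- by apply: is_cvg_geometric_series; rewrite ger0_norm// invf_lt1// ltr1n.
Qed.

Lemma star_psum q fs g (M : nat) tau y : 0 <= q -> (forall n, W q (fs n)) -> W q g ->
  star (psum fs M tau) g y = \sum_(i < M) tau ^+ i * star (fs i) g y.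
Proof.
move=> q0 Wf Wg; have Lg := W_L2 q0 Wg.
elim: M => [|M IH]; last first.
  rewrite psumS star_linl ?big_ord_recr/= ?IH 1?addrC//; apply: W_L2 q0 _ => //.
  exact: W_psum.
rewrite big_ord0 (_ : psum fs 0 tau = (fun y => g y - g y)).
  by rewrite starBl// subrr.
by apply/funext => z; rewrite /psum big_ord0 subrr.
Qed.

Lemma star_psumr q f gs (M : nat) tau y : 0 <= q -> (forall n, W q (gs n)) -> W q f ->
  star f (psum gs M tau) y = \sum_(i < M) tau ^+ i * star f (gs i) y.
Proof.
move=> q0 Wg Wf; have Lf := W_L2 q0 Wf.
elim: M => [|M IH]; last first.
  rewrite psumS star_linr ?big_ord_recr/= ?IH 1?addrC//; apply: W_L2 q0 _ => //.
  exact: W_psum.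
rewrite big_ord0 (_ : psum gs 0 tau = (fun y => f y - f y)).
  by rewrite starBr// subrr.
by apply/funext => z; rewrite /psum big_ord0 subrr.
Qed.

Lemma pair_psum q xs N tau k : 0 <= q -> (forall n, W q (xs n)) -> L2 k ->
  \int[mu]_y (psum xs N tau y * k y) = \sum_(n < N) tau ^+ n * \int[mu]_y (xs n y * k y).
Proof.
move=> q0 Wx Lk; elim: N => [|N IH].
  rewrite big_ord0 (eq_Rint (g := cst 0)) ?Rint0// => y.
  by rewrite /psum big_ord0 mul0r.
have [L _ _] := pairW q0 (Wx N) Lk; have [L' _ _] := pairW q0 (W_psum N tau Wx) Lk.
rewrite big_ord_recr/= -IH -RintZ// -RintD//; last exact: L1Z.
by apply: eq_Rint => y; rewrite psumS; ring.
Qed.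

Lemma pair_psum_cvg q C xs f tau k : 0 <= q -> (forall n, W q (xs n)) -> L2 k ->
  is_psum q C xs tau f ->
  pseries (fun n => \int[mu]_y (xs n y * k y)) tau @ \oo --> \int[mu]_y (f y * k y).
Proof.
move=> q0 Wx Lk [Wf Hf]; apply: (@cvg_half_le _ _ (2 * C * n2 k)) => N.
have -> : pseries (fun n => \int[mu]_y (xs n y * k y)) tau N = \int[mu]_y (psum xs N tau y * k y).
  rewrite (pair_psum N tau q0 Wx Lk) /pseries /series /= big_mkord.
  by apply: eq_bigr => i _; rewrite mulrC.
have WN := W_psum N tau Wx.
have [L _ _] := pairW q0 WN Lk; have [L' _ _] := pairW q0 Wf Lk.
rewrite -RintB// (eq_Rint (g := fun y => (psum xs N tau y - f y) * k y)) => [|y]; last by rewrite mulrBl.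
have [_ _ B] := pairW q0 (WB WN Wf) Lk; apply: le_trans B _.
by rewrite mulrAC ler_wpM2r ?n2_ge0.
Qed.

Section PowerSeries.
Context (q C r c : R) (xs ls fs gs : nat -> R -> R).
Context (q12 : 2^-1 <= q) (C0 : 0 <= C) (r0 : 0 < r).
Context (Wx : forall n, W q (xs n)) (Wl : forall n, W q (ls n)).
Context (Wf : forall n, W q (fs n)) (Wg : forall n, W q (gs n)).
Context (Bx : forall n, nW q (xs n) <= C * r ^+ n) (Bf : forall n, nW q (fs n) <= C * r ^+ n).
Context (Bg : forall n, nW q (gs n) <= C * r ^+ n).
Context (rec : forall n y, n.+1%:R * xs n.+1 y =
  Mm (ls n) y + c * \sum_(k < n.+1) Mm (star (fs k) (gs (n - k)%N)) y).

Let q0 : 0 <= q. Proof. by apply: le_trans q12; rewrite invr_ge0. Qed.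

Lemma Mm_star i j : W q (Mm (star (fs i) (gs j))) /\
  nW q (Mm (star (fs i) (gs j))) <= 2 * Cs q * C ^+ 2 * r ^+ (i + j).
Proof.
have [Ws Bs] := nW_star q0 (Wf i) (Wg j) (W_le q12 (Wf i)) (W_le q12 (Wg j)).
have [WM BM] := Mm_W Ws; split=> //; apply: le_trans BM _; apply: le_trans Bs _.
have -> : 2 * Cs q * C ^+ 2 * r ^+ (i + j) =
    Cs q * (C * r ^+ i * (C * r ^+ j) + C * r ^+ j * (C * r ^+ i)) by rewrite exprD; ring.
rewrite (ler_wpM2l (Cs_ge0 q))//; apply: lerD; apply: ler_pM; rewrite ?nW_ge0//.
  exact: le_trans (nW_le q12 (Wf i)) _.
exact: le_trans (nW_le q12 (Wg j)) _.
Qed.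

(** Substituting the series in the quadratic vector field: the recursion gives
    the triangular partial sums, the field of the partial sums gives the square
    ones. *)
Lemma psum_vfield_cvg tau (L F G : R -> R) k : L2 k -> r * `|tau| <= 8^-1 ->
  is_psum q C ls tau L -> is_psum q C fs tau F -> is_psum q C gs tau G ->
  pseries (pseries_diffs (fun n => \int[mu]_y (xs n y * k y))) tau @ \oo -->
    \int[mu]_y (vfield L c F G y * k y).
Proof.
move=> Lk rt [WL HL] [WF HF] [WG HG].
pose Q i j := \int[mu]_y (Mm (star (fs i) (gs j)) y * k y).
pose D := 2 * Cs q * C ^+ 2 * n2 k.
have D0 : 0 <= D.
  rewrite mulr_ge0 ?n2_ge0// mulr_ge0 ?exprn_ge0//; apply: mulr_ge0 => //; exact: Cs_ge0.
have QB i j : `|tau ^+ (i + j) * Q i j| <= D * 8^-1 ^+ (i + j).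
  have [WM BM] := Mm_star i j; have [_ _ B] := pairW q0 WM Lk.
  rewrite normrM normrX.
  apply: (@le_trans _ _ (`|tau| ^+ (i + j) * (2 * Cs q * C ^+ 2 * r ^+ (i + j) * n2 k))).
    rewrite ler_wpM2l ?exprn_ge0//; apply: le_trans B _.
    by rewrite ler_wpM2r ?n2_ge0.
  have -> : `|tau| ^+ (i + j) * (2 * Cs q * C ^+ 2 * r ^+ (i + j) * n2 k) =
     D * (r * `|tau|) ^+ (i + j) by rewrite exprMn /D; ring.
  by rewrite ler_wpM2l// lerXn2r ?nnegrE ?invr_ge0 ?mulr_ge0// ltW.
pose V N := \int[mu]_y (vfield (psum ls N tau) c (psum fs N tau) (psum gs N tau) y * k y).
have WS (hs : nat -> R -> R) N : (forall n, W q (hs n)) -> W q (psum hs N tau) by exact: W_psum.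
have LM h : W q h -> L1 (fun y => Mm h y * k y).
  by move=> Wh; have [WM _] := Mm_W Wh; have [] := pairW q0 WM Lk.
have VE N : V N = \sum_(n < N) tau ^+ n * \int[mu]_y (Mm (ls n) y * k y) +
    c * \sum_(i < N) \sum_(j < N) tau ^+ (i + j) * Q i j.
  rewrite /V; have WlN := WS ls N Wl; have WfN := WS fs N Wf; have WgN := WS gs N Wg.
  have [Wst _] := nW_star q0 WfN WgN (W_le q12 WfN) (W_le q12 WgN).
  rewrite (eq_Rint (g := fun y => Mm (psum ls N tau) y * k y +
      c * (Mm (star (psum fs N tau) (psum gs N tau)) y * k y))) => [|y]; last first.
    by rewrite /vfield /Mm; ring.
  rewrite RintD; [|exact: LM|by apply: L1Z; exact: LM].
  rewrite RintZ; last exact: LM.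
  congr (_ + c * _).
    have WMl n : W q (Mm (ls n)) by have [] := Mm_W (Wl n).
    rewrite -(pair_psum N tau q0 WMl Lk); apply: eq_Rint => y; congr (_ * _).
    rewrite /Mm /psum mulr_sumr; apply: eq_bigr => i _; ring.
  rewrite (eq_Rint (g := fun y => \sum_(i < N) \sum_(j < N) tau ^+ (i + j) * (Mm (star (fs i) (gs j)) y * k y))); last first.
    move=> y; rewrite /Mm (star_psum _ _ _ q0 Wf WgN) mulr_sumr mulr_suml; apply: eq_bigr => i _.
    rewrite (star_psumr _ _ _ q0 Wg (Wf i)) !mulr_sumr mulr_suml; apply: eq_bigr => j _.
    by rewrite exprD; ring.
  have LMs i j : L1 (fun y => tau ^+ (i + j) * (Mm (star (fs i) (gs j)) y * k y)).
    by apply: L1Z; have [WM _] := Mm_star i j; have [] := pairW q0 WM Lk.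
  rewrite Rint_sum; last by move=> i; apply: L1_sum => j; exact: LMs.
  apply: eq_bigr => i _; rewrite Rint_sum; last by move=> j; exact: LMs.
  apply: eq_bigr => j _; rewrite RintZ//.
  by have [WM _] := Mm_star i j; have [] := pairW q0 WM Lk.
have PE N : pseries (pseries_diffs (fun n => \int[mu]_y (xs n y * k y))) tau N =
    \sum_(n < N) tau ^+ n * \int[mu]_y (Mm (ls n) y * k y) +
    c * \sum_(n < N) \sum_(i < n.+1) tau ^+ (i + (n - i)) * Q i (n - i)%N.
  rewrite /pseries /series /= big_mkord mulr_sumr -big_split/=; apply: eq_bigr => n _.
  have [Lx _ _] := pairW q0 (Wx n.+1) Lk.
  rewrite /pseries_diffs -RintZ//.
  have LMs (i : 'I_n.+1) : L1 (fun y => Mm (star (fs i) (gs (n - i)%N)) y * k y).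
    by have [WM _] := Mm_star i (n - i); have [] := pairW q0 WM Lk.
  rewrite (eq_Rint (g := fun y => Mm (ls n) y * k y +
     c * \sum_(i < n.+1) Mm (star (fs i) (gs (n - i)%N)) y * k y)) => [|y]; last first.
    by rewrite mulrA rec mulrDl -mulrA mulr_suml.
  rewrite RintD; [|exact: LM|by apply: L1Z; apply: L1_sum].
  rewrite RintZ; last by apply: L1_sum.
  rewrite Rint_sum// mulrDl mulrC; congr (_ + _).
  rewrite -mulrA mulr_suml; congr (_ * _); apply: eq_bigr => i _.
  rewrite subnKC; last by rewrite -ltnS.
  exact: mulrC.
have [Wst _] := vfield_W c q12 WL WF WG.
pose K := 2 * C * (1 + `|c| * (Cs q * 2 * (2 * C + nW q G + nW q F))) * n2 k.
apply: (@cvg_half_le _ _ (K + `|c| * D)) => N.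
rewrite PE; set tri := (X in c * X); set P1 := (X in X + c * tri).
have -> : P1 + c * tri - \int[mu]_y (vfield L c F G y * k y) =
    (V N - \int[mu]_y (vfield L c F G y * k y)) -
    c * (\sum_(i < N) \sum_(j < N) tau ^+ (i + j) * Q i j - tri).
  by rewrite VE -/P1; ring.
apply: le_trans (ler_normB _ _) _; rewrite mulrDl; apply: lerD; last first.
  rewrite normrM -mulrA ler_wpM2l//.
  exact: (square_triangle (F := fun i j => tau ^+ (i + j) * Q i j)).
have WlN := WS ls N Wl; have WfN := WS fs N Wf; have WgN := WS gs N Wg.
have [WVN _] := vfield_W c q12 WlN WfN WgN.
have [LV _ _] := pairW q0 WVN Lk; have [LV' _ _] := pairW q0 Wst Lk.
rewrite /V -RintB// (eq_Rint (g := fun y => (vfield (psum ls N tau) c (psum fs N tau) (psum gs N tau) y - vfield L c F G y) * k y)) => [|y]; last by rewrite mulrBl.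
have [_ _ B] := pairW q0 (WB WVN Wst) Lk; apply: le_trans B _.
rewrite /K mulrAC ler_wpM2r ?n2_ge0//.
apply: le_trans (vfield_lip c q12 WlN WL WfN WF WgN WG) _.
pose d : R := 2 * C * 2^-1 ^+ N.
have hN : 0 <= 2^-1 ^+ N :> R by rewrite exprn_ge0// invr_ge0.
have d0 : 0 <= d by rewrite mulr_ge0// mulr_ge0.
have -> : 2 * C * (1 + `|c| * (Cs q * 2 * (2 * C + nW q G + nW q F))) * 2^-1 ^+ N =
  d + `|c| * (Cs q * 2 * (d * (2 * C + nW q G) + nW q F * d)) by rewrite /d; ring.
apply: lerD; first exact: HL.
rewrite ler_wpM2l// (ler_wpM2l (mulr_ge0 (Cs_ge0 q) (ler0n _ 2)))//.
apply: lerD; apply: ler_pM; rewrite ?nW_ge0//.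
rewrite (@eq_nW q _ (fun y => (psum gs N tau y - G y) + G y)); last by move=> y; rewrite subrK.
apply: le_trans (nWD (WB WgN WG) WG) _; rewrite lerD2r; apply: le_trans (HG N) _.
by rewrite ler_piMr ?mulr_ge0// exprn_ile1// ?invr_ge0// invf_le1// ler1n.
Qed.

(** Pairings with a fixed function are scalar power series, which can be
    differentiated termwise. *)
Lemma psum_weak (X : R -> R -> R) tau (L F G : R -> R) k : L2 k -> r * `|tau| < 8^-1 ->
  (forall s : R, r * `|s| <= 8^-1 -> is_psum q C xs s (X s)) ->
  is_psum q C ls tau L -> is_psum q C fs tau F -> is_psum q C gs tau G ->
  is_derive tau 1 (fun s => \int[mu]_y (X s y * k y)) (\int[mu]_y (vfield L c F G y * k y)).
Proof.
move=> Lk rt HX HL HF HG.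
pose p n := \int[mu]_y (xs n y * k y).
(* the factor 8 absorbs the two polynomial factors of the second derived series *)
pose K := (8 * r)^-1; have K0 : 0 < K by rewrite invr_gt0 mulr_gt0.
have rK : r * K = 8^-1 by rewrite /K; field; exact: lt0r_neq0.
have tK : `|tau| < `|K|.
  by rewrite [`|K|]gtr0_norm// -(ltr_pM2l r0) rK.
have Bp n : `|p n| <= C * n2 k * r ^+ n.
  have [_ _ B] := pairW q0 (Wx n) Lk; apply: le_trans B _.
  by rewrite mulrAC ler_wpM2r ?n2_ge0.
have B0 : 0 <= C * n2 k by rewrite mulr_ge0 ?n2_ge0.
have n2n n : n.+1%:R <= 2 ^+ n :> R by rewrite -natrX ler_nat ltn_expl.
have E8 n : 8^-1 ^+ n = 2^-1 ^+ n * 2^-1 ^+ n * 2^-1 ^+ n :> R.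
  by rewrite -!exprMn; congr (_ ^+ _); field.
have h1 n : 0 <= 2^-1 ^+ n :> R by rewrite exprn_ge0// invr_ge0.
have h2 n : 2 ^+ n * 2^-1 ^+ n = 1 :> R by rewrite -exprMn mulfV ?expr1n.
have h3 n : 2^-1 ^+ n <= 1 :> R by rewrite exprn_ile1// ?invr_ge0// invf_le1// ler1n.
have KX n : `|K ^+ n| = K ^+ n by rewrite ger0_norm// exprn_ge0// ltW.
have rKX n : r ^+ n * K ^+ n = 8^-1 ^+ n by rewrite -exprMn rK.
have c0 : cvgn (pseries p K).
  apply: (@cvgn_half _ (C * n2 k)) => n; rewrite normrM KX.
  apply: le_trans (ler_wpM2r _ (Bp n)) _; first by rewrite exprn_ge0// ltW.
  rewrite -[leLHS]mulrA rKX ler_wpM2l// E8 -mulrA ler_piMr//.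
  by rewrite mulr_ile1.
have c1 : cvgn (pseries (pseries_diffs p) K).
  apply: (@cvgn_half _ (C * n2 k * r)) => n; rewrite normrM KX /pseries_diffs normrM ger0_norm//.
  apply: (@le_trans _ _ (2 ^+ n * (C * n2 k * r ^+ n.+1) * K ^+ n)).
    rewrite ler_wpM2r ?exprn_ge0 ?(ltW K0)//; apply: ler_pM => //.
  have -> : 2 ^+ n * (C * n2 k * r ^+ n.+1) * K ^+ n =
      C * n2 k * r * (2 ^+ n * (r ^+ n * K ^+ n)) by rewrite exprS; ring.
  have -> : 2 ^+ n * (r ^+ n * K ^+ n) = 2^-1 ^+ n * 2^-1 ^+ n.
    by rewrite rKX -!exprMn; congr (_ ^+ _); field.
  rewrite ler_wpM2l//; first by rewrite mulr_ge0// ltW.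
  by rewrite ler_piMr.
have c2 : cvgn (pseries (pseries_diffs (pseries_diffs p)) K).
  apply: (@cvgn_half _ (C * n2 k * r ^+ 2 * 2)) => n.
  rewrite normrM KX /pseries_diffs !normrM [`|n.+1%:R|]ger0_norm// [`|n.+2%:R|]ger0_norm//.
  apply: (@le_trans _ _ (2 ^+ n * (2 ^+ n.+1 * (C * n2 k * r ^+ n.+2)) * K ^+ n)).
    rewrite ler_wpM2r ?exprn_ge0 ?(ltW K0)//; apply: ler_pM => //.
    by apply: ler_pM.
  have -> : 2 ^+ n * (2 ^+ n.+1 * (C * n2 k * r ^+ n.+2)) * K ^+ n =
      C * n2 k * r ^+ 2 * 2 * (2 ^+ n * 2 ^+ n * (r ^+ n * K ^+ n)) by rewrite !exprS; ring.
  rewrite rKX E8 (_ : 2 ^+ n * 2 ^+ n * _ = (2 ^+ n * 2^-1 ^+ n) * (2 ^+ n * 2^-1 ^+ n) * 2^-1 ^+ n).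
    by rewrite !h2 !mul1r.
  by ring.
have D := pseries_snd_diffs c0 c1 c2 tK.
rewrite (cvg_lim _ (psum_vfield_cvg Lk (ltW rt) HL HF HG)) in D; last exact: Rhausdorff.
apply: near_eq_is_derive D.
near=> s; apply: cvg_lim; first exact: Rhausdorff.
apply: (pair_psum_cvg q0 Wx Lk); apply: HX; apply: ltW.
rewrite mulrC -ltr_pdivlMr//; near: s.
have Cn : `|y| @[y --> tau] --> `|tau| by exact: norm_continuous.
by apply: (Cn _ (lt_nbhsl _)); rewrite ltr_pdivlMr// mulrC.
Unshelve. all: by end_near. Qed.

End PowerSeries.

(** The recursion for the Taylor coefficients of a solution. *)
Definition pstep c (l : R -> R) fs gs (n : nat) y : R :=
  n.+1%:R^-1 * (Mm l y + c * \sum_(k < n.+1) Mm (star (fs k) (gs (n - k)%N)) y).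

(** The factor 1 / (n + 1) offsets the number of terms of the sum, so that a
    geometric bound is preserved once the ratio is large enough. *)
Lemma pstep_W q C r c l fs gs n : 2^-1 <= q -> 0 <= C -> 0 <= r -> `|c| <= 1 ->
  W q l -> nW q l <= C * r ^+ n ->
  (forall k : nat, (k <= n)%N -> W q (fs k) /\ nW q (fs k) <= C * r ^+ k) ->
  (forall k : nat, (k <= n)%N -> W q (gs k) /\ nW q (gs k) <= C * r ^+ k) ->
  1 + 2 * Cs q * C <= r ->
  W q (pstep c l fs gs n) /\ nW q (pstep c l fs gs n) <= C * r ^+ n.+1.
Proof.
move=> q12 C0 r0 c1 Wl Bl Hf Hg Hr; have q0 : 0 <= q by apply: le_trans q12; rewrite invr_ge0.
pose m (k : 'I_n.+1) := Mm (star (fs k) (gs (n - k)%N)).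
have Hm (k : 'I_n.+1) : W q (m k) /\ nW q (m k) <= 2 * Cs q * C * (C * r ^+ n).
  have kn : (k <= n)%N by rewrite -ltnS.
  have [Wf Bf] := Hf k kn; have [Wg Bg] := Hg (n - k)%N (leq_subr _ _).
  have [Ws Bs] := nW_star q0 Wf Wg (W_le q12 Wf) (W_le q12 Wg).
  have [WM BM] := Mm_W Ws; split=> //; apply: le_trans BM _; apply: le_trans Bs _.
  have -> : 2 * Cs q * C * (C * r ^+ n) =
    Cs q * (C * r ^+ k * (C * r ^+ (n - k)) + C * r ^+ (n - k) * (C * r ^+ k)).
    by rewrite -[in LHS](subnKC kn) exprD; ring.
  have Af := le_trans (nW_le q12 Wf) Bf; have Ag := le_trans (nW_le q12 Wg) Bg.
  apply: (ler_wpM2l (Cs_ge0 q)).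
  exact: (lerD (ler_pM (nW_ge0 _ _) (nW_ge0 _ _) Af Bg) (ler_pM (nW_ge0 _ _) (nW_ge0 _ _) Ag Bf)).
have [WMl BMl] := Mm_W Wl.
have WS : W q (fun y => \sum_(k < n.+1) m k y) by apply: W_sum => k; have [] := Hm k.
have WT := WD WMl (WZ c WS).
split; first exact: (WZ _ WT).
rewrite /pstep nWZ//; have n0 : 0 < n.+1%:R :> R by rewrite ltr0n.
rewrite gtr0_norm ?invr_gt0// ler_pdivrMl//.
apply: le_trans (nWD WMl (WZ c WS)) _; rewrite nWZ//.
have Cr0 : 0 <= C * r ^+ n by rewrite mulr_ge0// exprn_ge0.
have CsC : 0 <= 2 * Cs q * C.
  by rewrite mulr_ge0//; apply: mulr_ge0 => //; exact: Cs_ge0.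
have BS : nW q (fun y => \sum_(k < n.+1) m k y) <= n.+1%:R * (2 * Cs q * C * (C * r ^+ n)).
  apply: le_trans (nW_sum _) _; first by move=> k; have [] := Hm k.
  apply: (@le_trans _ _ (\sum_(k < n.+1) 2 * Cs q * C * (C * r ^+ n))).
    by apply: ler_sum => k _; have [] := Hm k.
  by rewrite sumr_const card_ord -[X in X <= _]mulr_natl.
apply: (@le_trans _ _ (n.+1%:R * ((C * r ^+ n) + 2 * Cs q * C * (C * r ^+ n)))).
  rewrite mulrDr; apply: lerD.
    apply: le_trans BMl _; apply: le_trans Bl _.
    by rewrite ler_peMl// ler1n.
  apply: le_trans BS; rewrite ler_piMl// nW_ge0//.
rewrite ler_wpM2l// exprS.
have -> : C * (r * r ^+ n) = r * (C * r ^+ n) by ring.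
by rewrite -[X in X + _]mul1r -mulrDl ler_wpM2r.
Qed.

Section Coefficients.
Context (a b : R -> R).
Let dflt : (R -> R) * (R -> R) := (cst 0, cst 0).

(** The recursion for the coefficients needs all the previous ones. *)
Fixpoint hist (n : nat) : seq ((R -> R) * (R -> R)) :=
  if n is n'.+1 then
    let s := hist n' in
    let f (k : nat) := (nth dflt s k).1 in
    let g (k : nat) := (nth dflt s k).2 in
    rcons s (pstep 1 (g n') f g n', pstep 2^-1 (f n') g g n')
  else [:: (a, b)].

Definition coef n := nth dflt (hist n) n.

Lemma size_hist n : size (hist n) = n.+1.
Proof. by elim: n => //= n IH; rewrite size_rcons IH. Qed.

Lemma nth_hist n (k : nat) : (k <= n)%N -> nth dflt (hist n) k = coef k.
Proof.
elim: n => [|n IH]; first by rewrite leqn0 => /eqP ->.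
rewrite leq_eqVlt => /orP[/eqP -> //|kn].
by rewrite /= nth_rcons size_hist kn IH.
Qed.

Lemma coefS n : coef n.+1 =
  (pstep 1 (coef n).2 (fun k : nat => (coef k).1) (fun k : nat => (coef k).2) n,
   pstep 2^-1 (coef n).1 (fun k : nat => (coef k).2) (fun k : nat => (coef k).2) n).
Proof.
rewrite /coef /= nth_rcons size_hist ltnn eqxx -!/(coef _).
have E c l (f g f' g' : nat -> R -> R) : (forall k : nat, (k <= n)%N -> f k = f' k) ->
    (forall k : nat, (k <= n)%N -> g k = g' k) -> pstep c l f g n = pstep c l f' g' n.
  move=> Hf Hg; apply/funext => y; rewrite /pstep; congr (_ * (_ + _ * _)).
  apply: eq_bigr => k _; have kn : (k <= n)%N by rewrite -ltnS.
  by rewrite (Hf _ kn) (Hg _ (leq_subr _ _)).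
by congr pair; apply: E => k kn; rewrite nth_hist.
Qed.

End Coefficients.

Lemma coef_bound q a b : 2^-1 <= q -> W q a -> W q b ->
  exists C r, [/\ 0 <= C, 0 < r &
    forall n, [/\ W q (coef a b n).1, nW q (coef a b n).1 <= C * r ^+ n,
                  W q (coef a b n).2 & nW q (coef a b n).2 <= C * r ^+ n]].
Proof.
move=> q12 Wa Wb; pose C := nW q a + nW q b; pose r := 1 + 2 * Cs q * C.
have C0 : 0 <= C by rewrite addr_ge0 ?nW_ge0.
have r0 : 0 < r.
  by rewrite ltr_wpDr// mulr_ge0//; apply: mulr_ge0 => //; exact: Cs_ge0.
exists C, r; split=> //.
suff H n : forall k : nat, (k <= n)%N ->
  [/\ W q (coef a b k).1, nW q (coef a b k).1 <= C * r ^+ k,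
      W q (coef a b k).2 & nW q (coef a b k).2 <= C * r ^+ k] by move=> n; exact: H (leqnn n).
elim: n => [|n IH] k.
  by rewrite leqn0 => /eqP ->; rewrite expr0 mulr1; split=> //=; rewrite ?lerDl ?lerDr nW_ge0.
rewrite leq_eqVlt => /orP[/eqP ->|]; last exact: IH.
have [W1 B1 W2 B2] := IH n (leqnn n).
have H1 j : (j <= n)%N -> W q (coef a b j).1 /\ nW q (coef a b j).1 <= C * r ^+ j.
  by move=> /IH[].
have H2 j : (j <= n)%N -> W q (coef a b j).2 /\ nW q (coef a b j).2 <= C * r ^+ j.
  by move=> /IH[].
rewrite coefS /=.
have h2 : `|2^-1| <= 1 :> R by rewrite ger0_norm ?invr_ge0// invf_le1// ler1n.
have h1 : `|1| <= 1 :> R by rewrite normr1.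
have [P1 Q1] := pstep_W q12 C0 (ltW r0) h1 W2 B2 H1 H2 (lexx r).
have [P2 Q2] := pstep_W q12 C0 (ltW r0) h2 W1 B1 H2 H2 (lexx r).
exact: (And4 P1 Q1 P2 Q2).
Qed.

(** The vector field is a bounded quadratic map of H^s, so the equation has
    analytic solutions. *)
Lemma local_solution q a b T : 2^-1 <= q -> W q a -> W q b ->
  exists2 d, 0 < d & exists A B, [/\ hsol q T (T + d) A B,
    nW q (fun y => A T y - a y) = 0 & nW q (fun y => B T y - b y) = 0].
Proof.
move=> q12 Wa Wb; have q0 : 0 <= q by apply: le_trans q12; rewrite invr_ge0.
have [C [r [C0 r0 Hc]]] := coef_bound q12 Wa Wb.
pose fs n := (coef a b n).1; pose gs n := (coef a b n).2.
have Wf n : W q (fs n) by case: (Hc n).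
have Wg n : W q (gs n) by case: (Hc n).
have Bf n : nW q (fs n) <= C * r ^+ n by case: (Hc n).
have Bg n : nW q (gs n) <= C * r ^+ n by case: (Hc n).
pose S (hs : nat -> R -> R) tau := xget (cst 0) [set f | is_psum q C hs tau f].
have HS (hs : nat -> R -> R) tau : (forall n, W q (hs n)) -> (forall n, nW q (hs n) <= C * r ^+ n) ->
    r * `|tau| <= 8^-1 -> is_psum q C hs tau (S hs tau).
  move=> Wh Bh rt; have [|f Hf] := @psum_ex q hs C tau Wh C0.
    move=> n; apply: le_trans (ler_wpM2l _ (Bh n)) _; first by rewrite exprn_ge0.
    have -> : `|tau| ^+ n * (C * r ^+ n) = C * (r * `|tau|) ^+ n by rewrite exprMn; ring.
    rewrite ler_wpM2l// lerXn2r ?nnegrE ?mulr_ge0 ?invr_ge0 ?(ltW r0)//.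
    by apply: le_trans rt _; rewrite lef_pV2 ?posrE// ler_nat.
  by apply: (xgetPex (cst 0)); exists f.
pose d := (8 * r)^-1; have d0 : 0 < d by rewrite invr_gt0 mulr_gt0.
have rd : r * d = 8^-1 by rewrite /d; field; exact: lt0r_neq0.
exists d => //; exists (fun t => S fs (t - T)), (fun t => S gs (t - T)).
have tI t : T <= t < T + d -> r * `|t - T| < 8^-1.
  by move=> /andP[h1 h2]; rewrite -rd ltr_pM2l// ger0_norm ?subr_ge0// ltrBlDl.
have cont (hs : nat -> R -> R) : (forall n, W q (hs n)) -> (forall n, nW q (hs n) <= C * r ^+ n) ->
    Wcont q (fun t => S hs (t - T)) T (T + d).
  move=> Wh Bh t tT; have [WS HSt] := HS hs _ Wh Bh (ltW (tI t tT)); split=> // e e0.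
  have e3 : 0 < e / 3 by rewrite divr_gt0.
  have /cvgrPdist_le/(_ _ e3)[N _ HN] := cvg_half (2 * C).
  have {}HN : 2 * C * 2^-1 ^+ N <= e / 3.
    by apply: le_trans (HN N (leqnn N)); rewrite sub0r normrN ler_norm.
  pose P s := \sum_(n < N) `|(s - T) ^+ n - (t - T) ^+ n| * nW q (hs n).
  have cP : P @ t --> (0 : R).
    rewrite /P; elim: (N) => [|n IH].
      under eq_fun do rewrite big_ord0; exact: cvg_cst.
    under eq_fun do rewrite big_ord_recr/=.
    have Cn : (fun s => `|(s - T) ^+ n - (t - T) ^+ n| * nW q (hs n)) @ t --> (0 : R).
      have C1 : (fun s => (s - T) ^+ n - (t - T) ^+ n) @ t --> (t - T) ^+ n - (t - T) ^+ n.
        apply: cvgB; last exact: cvg_cst.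
        apply: (@continuous_comp _ _ _ (fun s : R => s - T) (fun y : R => y ^+ n)).
          by apply: cvgB; [exact: cvg_id|exact: cvg_cst].
        exact: exprn_continuous.
      rewrite subrr in C1; have C2 := cvg_norm C1; rewrite normr0 in C2.
      have C3 := cvg0Z (nW q (hs n)) (C2 (nbhs_filter t)).
      rewrite (_ : (fun s => _) = (fun s => nW q (hs n) * `|(s - T) ^+ n - (t - T) ^+ n|)).
        by apply: C3.
      by apply/funext => s; rewrite mulrC.
    exact: (cvg0D IH Cn).
  have /cvgrPdist_le/(_ _ e3)/nbhs_ballP[rr rr0 Hrr] := cP.
  exists rr => // t' t'T tt'.
  have [WS' HSt'] := HS hs _ Wh Bh (ltW (tI t' t'T)).
  have W1 := W_psum N (t - T) Wh; have W2 := W_psum N (t' - T) Wh.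
  apply: le_trans (nW_tri WS' W2 WS) _.
  have H1 : nW q (fun x => S hs (t' - T) x - psum hs N (t' - T) x) <= e / 3.
    by rewrite nWBC; apply: le_trans (HSt' N) HN.
  have H2 : nW q (fun x => psum hs N (t - T) x - S hs (t - T) x) <= e / 3.
    exact: le_trans (HSt N) HN.
  have H3 : nW q (fun x => psum hs N (t' - T) x - psum hs N (t - T) x) <= e / 3.
    have /Hrr : ball t rr t' by rewrite /ball/= distrC.
    rewrite /= sub0r normrN => HP; apply: le_trans (le_trans (ler_norm _) HP).
    have -> : (fun x => psum hs N (t' - T) x - psum hs N (t - T) x) =
        (fun x => \sum_(n < N) ((t' - T) ^+ n - (t - T) ^+ n) * hs n x).
      by apply/funext => x; rewrite /psum -sumrB; apply: eq_bigr => n _; rewrite mulrBl.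
    apply: le_trans (nW_sum (fun n => WZ _ (Wh n))) _.
    by apply: ler_sum => n _; rewrite nWZ.
  apply: le_trans (lerD H1 (le_trans (nW_tri W2 W1 WS) (lerD H3 H2))) _.
  by rewrite le_eqVlt; apply/orP; left; apply/eqP; field.
have weak (c : R) (xs ls hs : nat -> R -> R) : (forall n, W q (xs n)) -> (forall n, W q (ls n)) ->
   (forall n, W q (hs n)) -> (forall n, nW q (xs n) <= C * r ^+ n) ->
   (forall n, nW q (ls n) <= C * r ^+ n) -> (forall n, nW q (hs n) <= C * r ^+ n) ->
   (forall n, xs n.+1 = pstep c (ls n) hs gs n) -> forall t, T < t < T + d ->
   weakd (fun t => S xs (t - T))
     (fun t => vfield (S ls (t - T)) c (S hs (t - T)) (S gs (t - T))) t.
  move=> Wx Wl Wh Bx Bl Bh Ex t tT phi tphi.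
  have tT' : T <= t < T + d by case/andP: tT => /ltW -> ->.
  have rt := tI t tT'.
  have D0 : is_derive t 1 (fun s : R => s - T) 1.
    by apply: is_derive_eq; rewrite /GRing.scale/=; ring.
  have rec n y : n.+1%:R * xs n.+1 y =
      Mm (ls n) y + c * \sum_(k < n.+1) Mm (star (hs k) (gs (n - k)%N)) y.
    by rewrite Ex /pstep mulrA mulfV ?mul1r.
  have := @psum_weak q C r c xs ls hs gs q12 C0 r0 Wx Wl Wh Wg Bx Bh Bg rec
     (S xs) (t - T) (S ls (t - T)) (S hs (t - T)) (S gs (t - T)) (kern phi)
     (L2_kern tphi) rt (fun s => HS xs s Wx Bx) (HS ls _ Wl Bl (ltW rt))
     (HS hs _ Wh Bh (ltW rt)) (HS gs _ Wg Bg (ltW rt)) => D.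
  have := @is_derive1_comp _ (fun s => \int[mu]_y (S xs s y * kern phi y)) (fun s : R => s - T) _ _ _ D D0.
  by rewrite mulr1.
have init (hs : nat -> R -> R) : (forall n, W q (hs n)) -> (forall n, nW q (hs n) <= C * r ^+ n) ->
    nW q (fun y => S hs (T - T) y - hs 0%N y) = 0.
  move=> Wh Bh; have rT : r * `|T - T| <= 8^-1 by rewrite subrr normr0 mulr0 invr_ge0.
  have [WS HST] := HS hs _ Wh Bh rT.
  apply/eqP; rewrite eq_le nW_ge0 andbT; apply/ler_addgt0Pr => e e0; rewrite add0r.
  have /cvgrPdist_le/(_ _ e0)[N _ HN] := cvg_half (2 * C).
  have := HN N.+1 (leqnSn N); rewrite sub0r normrN => /(le_trans (ler_norm _)); apply: le_trans.
  apply: le_trans (HST N.+1); rewrite nWBC le_eqVlt; apply/orP; left; apply/eqP.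
  apply: eq_nW => y; congr (_ - _); rewrite /psum big_ord_recl/= expr0 mul1r big1 ?addr0// => i _.
  by rewrite subrr exprS !mul0r.
split; [split|exact: (init fs)|exact: (init gs)].
- exact: cont.
- exact: cont.
- move=> t tT; split.
    by apply: (weak 1 fs gs fs) => // n; rewrite /fs coefS.
  by apply: (weak 2^-1 gs fs gs) => // n; rewrite /gs coefS.
Qed.

(** * The system in physical variables *)

Lemma c2pi_gt0 : 0 < c2pi.
Proof. by rewrite sqrtr_gt0 twopi_gt0. Qed.

Lemma Hs_hat s (f : R -> R) : Hs s f -> L2 f /\ W (s / 2) (hat f).
Proof.
move=> [/Lfun2P Lf Nf]; split=> //.
by have [E _] := Hs_normP s Lf (hatP Lf); apply/E.
Qed.

Lemma Hs_normB s (f g h k : R -> R) : L2 f -> L2 g -> is_hartley f h -> is_hartley g k ->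
  W (s / 2) h -> W (s / 2) k ->
  Hs_norm s (f - g) = (nW (s / 2) (fun x => h x - k x) / c2pi)%:E.
Proof.
move=> Lf Lg hf hg Wh Wk.
have [_ E] := Hs_normP s (L2B Lf Lg) (is_hartleyB Lf Lg hf hg).
exact: E (WB Wh Wk).
Qed.

Lemma Hs_ihat s (h : R -> R) : 3 / 2 < s -> W (s / 2) h -> Hs s (ihat h).
Proof.
move=> s32 Wh; have q12 : 2^-1 <= s / 2 by lra.
have [L1h L2h] := W_L12 q12 Wh; split; first by apply/Lfun2P; exact: L2_ihat.
have [E _] := Hs_normP s (L2_ihat L1h L2h) (is_hartley_inv L1h L2h).
exact/E.
Qed.

Implicit Types (u : R -> (R -> R) * (R -> R)).

Definition represents u A B lo hi : Prop :=
  forall t, lo <= t < hi -> u t = (ihat (A t), ihat (B t)).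

(** The continuous representative of each class is the inverse transform. *)
Lemma continuous_in_Xs_hat s T u : 3 / 2 < s -> continuous_in_Xs s T u ->
  exists A B, [/\ Wcont (s / 2) A 0 T, Wcont (s / 2) B 0 T & represents u A B 0 T].
Proof.
move=> s32 cu; have q12 : 2^-1 <= s / 2 by lra.
have HX t : 0 <= t < T -> [/\ L2 (u t).1, W (s / 2) (hat (u t).1), L2 (u t).2 & W (s / 2) (hat (u t).2)].
  move=> tI; have [[/Hs_hat[P1 P2] /Hs_hat[P3 P4]] _ _ _] := cu t tI.
  exact: (And4 P1 P2 P3 P4).
have key t e : 0 <= t < T -> 0 < e -> exists2 r, 0 < r & forall t', 0 <= t' < T -> `|t' - t| < r ->
    nW (s / 2) (fun x => hat (u t').1 x - hat (u t).1 x) <= e /\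
    nW (s / 2) (fun x => hat (u t').2 x - hat (u t).2 x) <= e.
  move=> tI e0; have [_ _ _ Cu] := cu t tI; have [L1t W1t L2t W2t] := HX t tI.
  have ec : 0 < e / c2pi by rewrite divr_gt0// c2pi_gt0.
  have [_ /cvgrPdist_lt/(_ _ ec)] := iffLR (fine_cvgP _ _) Cu.
  rewrite near_withinE => /nbhs_ballP[r r0 Hr]; exists r => // t' t'I tt'.
  have [L1t' W1t' L2t' W2t'] := HX t' t'I.
  have D : `[0, T[%classic t' by rewrite /= in_itv.
  have bt : ball t r t' by rewrite /ball/= distrC.
  have := Hr t' bt D.
  rewrite /= /Xs_norm (Hs_normB L1t' L1t (hatP L1t') (hatP L1t) W1t' W1t).
  rewrite (Hs_normB L2t' L2t (hatP L2t') (hatP L2t) W2t' W2t) -EFinD/= sub0r normrN.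
  rewrite -mulrDl normrM [X in _ * X]gtr0_norm ?invr_gt0 ?c2pi_gt0//.
  rewrite ltr_pM2r ?invr_gt0 ?c2pi_gt0// ger0_norm ?addr_ge0 ?nW_ge0// => H.
  split; apply: le_trans (ltW H); [rewrite lerDl|rewrite lerDr]; exact: nW_ge0.
exists (fun t => hat (u t).1), (fun t => hat (u t).2); split.
- move=> t tI; split; first by have [] := HX t tI.
  move=> e e0; have [r r0 Hr] := key t e tI e0; exists r => // t' t'I tt'.
  by have [] := Hr t' t'I tt'.
- move=> t tI; split; first by have [] := HX t tI.
  move=> e e0; have [r r0 Hr] := key t e tI e0; exists r => // t' t'I tt'.
  by have [] := Hr t' t'I tt'.
- move=> t tI; have [L1t W1t L2t W2t] := HX t tI; have [_ c1 c2 _] := cu t tI.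
  have [LA _] := W_L12 q12 W1t; have [LB _] := W_L12 q12 W2t.
  rewrite [LHS]surjective_pairing; congr pair; apply/funext => x.
    exact: (ihat_hat L1t c1 (hatP L1t) LA).
  exact: (ihat_hat L2t c2 (hatP L2t) LB).
Qed.

Lemma continuous_in_Xs_ihat s T u A B : 3 / 2 < s -> Wcont (s / 2) A 0 T -> Wcont (s / 2) B 0 T ->
  represents u A B 0 T -> continuous_in_Xs s T u.
Proof.
move=> s32 cA cB Eu t tI; have q12 : 2^-1 <= s / 2 by lra.
have HX t' : 0 <= t' < T -> [/\ L1 (A t'), L2 (A t'), L1 (B t') & L2 (B t')].
  move=> t'I; have [WA _] := cA t' t'I; have [WB_ _] := cB t' t'I.
  by have [? ?] := W_L12 q12 WA; have [? ?] := W_L12 q12 WB_.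
have [WA HA] := cA t tI; have [WB_ HB] := cB t tI.
have [L1a L2a L1b L2b] := HX t tI.
rewrite (Eu t tI); split.
- by split; exact: Hs_ihat.
- exact: continuous_ihat.
- exact: continuous_ihat.
have E t' : 0 <= t' < T -> Xs_norm s (u t' - (ihat (A t), ihat (B t))) =
    ((nW (s / 2) (fun x => A t' x - A t x) + nW (s / 2) (fun x => B t' x - B t x)) / c2pi)%:E.
  move=> t'I; have [WA' _] := cA t' t'I; have [WB' _] := cB t' t'I.
  have [L1a' L2a' L1b' L2b'] := HX t' t'I.
  rewrite (Eu t' t'I) /Xs_norm /=.
  rewrite (Hs_normB (L2_ihat L1a' L2a') (L2_ihat L1a L2a) (is_hartley_inv L1a' L2a') (is_hartley_inv L1a L2a) WA' WA).
  rewrite (Hs_normB (L2_ihat L1b' L2b') (L2_ihat L1b L2b) (is_hartley_inv L1b' L2b') (is_hartley_inv L1b L2b) WB' WB_).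
  by rewrite -EFinD mulrDl.
apply/fine_cvgP; split.
  by rewrite near_withinE; apply: nearW => t'; rewrite /= in_itv/= => t'I; rewrite E.
apply/cvgrPdist_le => e e0; have ec : 0 < e * c2pi / 2 by rewrite divr_gt0// mulr_gt0// c2pi_gt0.
have [r1 r10 H1] := HA _ ec; have [r2 r20 H2] := HB _ ec.
rewrite near_withinE; apply/nbhs_ballP; exists (Num.min r1 r2); first by rewrite /= lt_min r10.
move=> t'; rewrite /ball/= distrC lt_min => /andP[d1 d2]; rewrite in_itv/= => t'I.
rewrite E//= sub0r normrN ger0_norm; last by rewrite divr_ge0 ?(ltW c2pi_gt0)// addr_ge0 ?nW_ge0.
rewrite ler_pdivrMr ?c2pi_gt0// [e * _]splitr; apply: lerD; [exact: H1|exact: H2].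
Qed.

(** The weak form of one equation is the same on both sides of the transform. *)
Lemma weak_transfer q (w X : R -> R -> R) t (G l f g : R -> R) c (phi : R -> R) : 2^-1 <= q ->
  test_function phi -> (\forall t' \near t, w t' = ihat (X t') /\ W q (X t')) ->
  W q l -> W q f -> W q g -> (forall x, G x = ihat l x + c * (ihat f x * ihat g x)) ->
  is_derive t 1 (fun t' => \int[mu]_x (w t' x * (phi x - derive1n 2 phi x)))
    (\int[mu]_x (G x * derive1 phi x)) <->
  is_derive t 1 (fun t' => \int[mu]_x (X t' x * kern phi x))
    (\int[mu]_x (vfield l c f g x * kern phi x)).
Proof.
move=> q12 tphi nw Wl Wf Wg HG; have q0 : 0 <= q by apply: le_trans q12; rewrite invr_ge0.
have p0 := twopi_gt0.
have [L1l L2l] := W_L12 q12 Wl; have [L1f L2f] := W_L12 q12 Wf; have [L1g L2g] := W_L12 q12 Wg.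
have [Ws _] := nW_star q0 Wf Wg (W_le q12 Wf) (W_le q12 Wg).
have [L1s L2s] := W_L12 q12 Ws.
have [L1t L2t] := W_L12 q12 (WD Wl (WZ c Ws)).
have -> : \int[mu]_x (G x * derive1 phi x) = (2 * pi)^-1 * \int[mu]_x (vfield l c f g x * kern phi x).
  rewrite -pair_test_derive//; apply: eq_Rint => x; rewrite HG ihatM//; congr (_ * _).
  rewrite /ihat hartleyD//; last exact: L1Z.
  by rewrite hartleyZ//; ring.
have Ew : \forall t' \near t, \int[mu]_x (w t' x * (phi x - derive1n 2 phi x)) =
    (2 * pi)^-1 * \int[mu]_x (X t' x * kern phi x).
  near=> t'; have [-> WX] : w t' = ihat (X t') /\ W q (X t') by near: t'.
  by have [L1x L2x] := W_L12 q12 WX; exact: pair_test.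
set I := \int[mu]_x (vfield _ _ _ _ x * _).
split=> D.
  have D1 : is_derive t 1 (fun t' => 2 * pi * \int[mu]_x (w t' x * (phi x - derive1n 2 phi x))) I.
    by apply: is_derive_eq; rewrite /GRing.scale/= mulrA divff ?mul1r// gt_eqF.
  apply: near_eq_is_derive D1; near=> t'.
  rewrite (_ : \int[mu]_x (w t' x * _) = (2 * pi)^-1 * \int[mu]_x (X t' x * kern phi x)).
    by rewrite mulrA divff ?mul1r// gt_eqF.
  by near: t'.
have D1 : is_derive t 1 (fun t' => (2 * pi)^-1 * \int[mu]_x (X t' x * kern phi x)) ((2 * pi)^-1 * I).
  by apply: is_derive_eq; rewrite /GRing.scale/=.
apply: near_eq_is_derive D1; near=> t'; apply/esym; by near: t'.
Unshelve. all: by end_near. Qed.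

Lemma weak_system_transfer q T u A B : 2^-1 <= q -> Wcont q A 0 T -> Wcont q B 0 T ->
  represents u A B 0 T ->
  weak_system T u <-> forall t, 0 < t < T ->
    weakd A (fun t => vfield (B t) 1 (A t) (B t)) t /\
    weakd B (fun t => vfield (A t) 2^-1 (B t) (B t)) t.
Proof.
move=> q12 cA cB Eu.
have key t (phi : R -> R) : 0 < t < T -> test_function phi ->
  (is_derive t 1 (fun t' => \int[mu]_x ((u t').1 x * (phi x - derive1n 2 phi x)) : R)
      (\int[mu]_x (((u t).2 x + (u t).1 x * (u t).2 x) * derive1 phi x)) <->
   is_derive t 1 (fun t' => \int[mu]_x (A t' x * kern phi x))
      (\int[mu]_x (vfield (B t) 1 (A t) (B t) x * kern phi x))) /\
  (is_derive t 1 (fun t' => \int[mu]_x ((u t').2 x * (phi x - derive1n 2 phi x)) : R)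
      (\int[mu]_x (((u t).1 x + (u t).2 x ^+ 2 / 2) * derive1 phi x)) <->
   is_derive t 1 (fun t' => \int[mu]_x (B t' x * kern phi x))
      (\int[mu]_x (vfield (A t) 2^-1 (B t) (B t) x * kern phi x))).
  move=> /andP[t0 tT] tphi; have tI : 0 <= t < T by rewrite (ltW t0).
  have [WA _] := cA t tI; have [WB_ _] := cB t tI.
  have nI : \forall t' \near t, 0 <= t' < T.
    near=> t'; apply/andP; split; first by apply: ltW; near: t'; exact: lt_nbhsr.
    by near: t'; exact: lt_nbhsl.
  split.
    apply: (weak_transfer (w := fun t => (u t).1) q12) => //.
      near=> t'; have t'I : 0 <= t' < T by near: t'.
      by rewrite (Eu t' t'I); have [] := cA t' t'I.
    by move=> x; rewrite (Eu t tI)/= mul1r.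
  apply: (weak_transfer (w := fun t => (u t).2) q12) => //.
    near=> t'; have t'I : 0 <= t' < T by near: t'.
    by rewrite (Eu t' t'I); have [] := cB t' t'I.
  by move=> x; rewrite (Eu t tI)/= mulrC expr2.
split=> [H t tI|H phi tphi t tI].
  by split=> phi tphi; have [K1 K2] := key t phi tI tphi; have [H1 H2] := H phi tphi t tI; [apply/K1|apply/K2].
have [K1 K2] := key t phi tI tphi; have [H1 H2] := H t tI.
by split; [apply/K1; exact: H1|apply/K2; exact: H2].
Unshelve. all: by end_near. Qed.

(** * Continuation and the blow-up criterion *)

Definition glue T X Y t : R -> R := if t < T then X t else Y t.

(** Y starts at the limit a of X. *)
Lemma Wcont_glue q X Y (a : R -> R) lo t0 T hi S : 0 <= q -> Wcont q X lo T -> Wcont q Y T hi ->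
  lo <= t0 < T -> T < hi -> 0 <= S -> W q a -> nW q (fun x => Y T x - a x) = 0 ->
  (forall t, t0 <= t < T -> nW q (fun x => X t x - a x) <= S * (T - t)) ->
  Wcont q (glue T X Y) lo hi.
Proof.
move=> q0 cX cY /andP[lt0 t0T] Th S0 Wa Ya Xa t /andP[lot thi].
have [tT|tT|tT] := ltgtP t T.
- have tI : lo <= t < T by rewrite lot.
  have [WX HX] := cX t tI; rewrite /glue tT; split=> // e e0.
  have [r r0 Hr] := HX e e0; exists (Num.min r (T - t)); first by rewrite lt_min r0 subr_gt0.
  move=> t' /andP[lot' _]; rewrite lt_min => /andP[d1]; rewrite ltr_norml => /andP[_ d2].
  have t'T : t' < T by lra.
  by rewrite t'T; apply: Hr => //; rewrite lot'.
- have tI : T <= t < hi by rewrite (ltW tT).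
  have [WY HY] := cY t tI; rewrite /glue ltNge (ltW tT)/=; split=> // e e0.
  have [r r0 Hr] := HY e e0; exists (Num.min r (t - T)); first by rewrite lt_min r0 subr_gt0.
  move=> t' /andP[_ t'hi]; rewrite lt_min => /andP[d1]; rewrite ltr_norml => /andP[d2 _].
  have t'T : T <= t' by lra.
  by rewrite ltNge t'T/=; apply: Hr => //; rewrite t'T.
rewrite tT; have TI : T <= T < hi by rewrite lexx.
have [WY HY] := cY T TI; rewrite /glue ltxx; split=> // e e0.
have [r r0 Hr] := HY e e0.
exists (Num.min r (Num.min (T - t0) (e / (S + 1)))).
  by rewrite !lt_min r0 subr_gt0 t0T divr_gt0// ltr_wpDl.
move=> t' /andP[lot' t'hi]; rewrite !lt_min => /and3P[d1 d2 d3].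
case: ltrP => t'T; last by apply: Hr => //; rewrite t'T.
have t'0 : t0 <= t' by move: d2; rewrite ltr_norml => /andP[d2 _]; lra.
have t'I : t0 <= t' < T by rewrite t'0.
have t'I' : lo <= t' < T by rewrite lot'.
have [WX' _] := cX t' t'I'.
apply: le_trans (nW_tri WX' Wa WY) _; rewrite [X in _ + X]nWBC Ya addr0.
apply: le_trans (Xa t' t'I) _.
move: d3; rewrite distrC gtr0_norm ?subr_gt0// ltr_pdivlMr; last by rewrite ltr_wpDl.
by move/ltW => d3; apply: le_trans d3; rewrite mulrC ler_wpM2l ?lerDl// subr_ge0 ltW.
Qed.

(** A lower bound for the slope gives bounds in H^s, hence a limit at T, from
    which a local solution restarts. At T itself the equation holds because it
    holds on both sides and the vector field is continuous. *)
Lemma hsol_extend q A B T t0 M : 3 / 4 < q -> hsol q 0 T A B -> 0 < t0 < T -> 0 <= M ->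
  (forall t, t0 <= t < T -> forall x, - M <= ihat (dmul (B t)) x) ->
  exists2 d, 0 < d & exists A' B', hsol q 0 (T + d) A' B' /\
    forall t, t < T -> A' t = A t /\ B' t = B t.
Proof.
move=> q34 hAB t0I M0 HM; have [cA cB wd] := hAB.
have q12 : 2^-1 <= q by lra.
have q0 : 0 <= q by lra.
have [K K0 HK] := hsol_bounded q34 hAB t0I M0 HM.
have /andP[t00 t0T] := t0I.
pose S := K + Cs q * (K * K + K * K).
have S0 : 0 <= S by rewrite addr_ge0//; apply: mulr_ge0; [exact: Cs_ge0|rewrite addr_ge0 ?mulr_ge0].
have FS c l f g : W q l -> W q f -> W q g -> nW q l <= K -> nW q f <= K -> nW q g <= K -> `|c| <= 1 ->
    W q (vfield l c f g) /\ nW q (vfield l c f g) <= S.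
  move=> Wl Wf Wg lK fK gK c1; have [WF BF] := vfield_W c q12 Wl Wf Wg; split=> //.
  apply: le_trans BF _; apply: lerD => //.
  have f12 := le_trans (nW_le q12 Wf) fK; have g12 := le_trans (nW_le q12 Wg) gK.
  have P0 : 0 <= Cs q * (nW 2^-1 f * nW q g + nW 2^-1 g * nW q f).
    by apply: mulr_ge0; [exact: Cs_ge0|apply: addr_ge0; apply: mulr_ge0; exact: nW_ge0].
  apply: le_trans (ler_piMl P0 c1) _; apply: (ler_wpM2l (Cs_ge0 q)).
  exact: (lerD (ler_pM (nW_ge0 _ _) (nW_ge0 _ _) f12 gK) (ler_pM (nW_ge0 _ _) (nW_ge0 _ _) g12 fK)).
have tI t : t0 <= t < T -> 0 <= t < T.
  by move=> /andP[h1 h2]; rewrite h2 (le_trans (ltW t00)).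
have tI' t : t0 < t < T -> t0 <= t < T by move=> /andP[h1 h2]; rewrite h2 ltW.
have h1 : `|1| <= 1 :> R by rewrite normr1.
have h2 : `|2^-1| <= 1 :> R by rewrite ger0_norm ?invr_ge0// invf_le1// ler1n.
have t0J : 0 <= t0 < T by rewrite (ltW t00).
have [|a Wa Ha] := @Wcont_limit q A (fun t => vfield (B t) 1 (A t) (B t)) 0 T t0 S q0 cA t0J S0.
  move=> t /[dup] /tI' tt /andP[s1 s2]; have [KA KB] := HK t tt.
  have [WA _] := cA t (tI t tt); have [WB_ _] := cB t (tI t tt).
  have [w _] := wd t ltac:(by rewrite (lt_trans t00)).
  by have [WF BF] := FS 1 _ _ _ WB_ WA WB_ KB KA KB h1; split.
have [|b Wb Hb] := @Wcont_limit q B (fun t => vfield (A t) 2^-1 (B t) (B t)) 0 T t0 S q0 cB t0J S0.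
  move=> t /[dup] /tI' tt /andP[s1 s2]; have [KA KB] := HK t tt.
  have [WA _] := cA t (tI t tt); have [WB_ _] := cB t (tI t tt).
  have [_ w] := wd t ltac:(by rewrite (lt_trans t00)).
  by have [WF BF] := FS 2^-1 _ _ _ WA WB_ WB_ KA KB KB h2; split.
have [d d0 [A2 [B2 [[cA2 cB2 wd2] A2T B2T]]]] := local_solution T q12 Wa Wb.
exists d => //; exists (glue T A A2), (glue T B B2).
have Td : T < T + d by rewrite ltrDl.
have cA' := Wcont_glue q0 cA cA2 t0J Td S0 Wa A2T Ha.
have cB' := Wcont_glue q0 cB cB2 t0J Td S0 Wb B2T Hb.
set A' := glue T A A2 in cA' *; set B' := glue T B B2 in cB' *.
split; last by move=> t tT; rewrite /A' /B' /glue tT.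
have cFA := Wcont_vfield 1 q12 cA' cB' cB'; have cFB := Wcont_vfield 2^-1 q12 cB' cB' cA'.
have wdl (X X2 F F2 : R -> R -> R) t : t < T -> F t = glue T F F2 t -> weakd X F t -> weakd (glue T X X2) (glue T F F2) t.
  move=> tT EF w phi tphi; rewrite -EF; apply: near_eq_is_derive (w phi tphi).
  by near=> s; rewrite /glue ifT//; near: s; exact: lt_nbhsl.
have wdr (X X2 F F2 : R -> R -> R) t : T < t -> F2 t = glue T F F2 t -> weakd X2 F2 t -> weakd (glue T X X2) (glue T F F2) t.
  move=> tT EF w phi tphi; rewrite -EF; apply: near_eq_is_derive (w phi tphi).
  near=> s; rewrite /glue ltNge ifN// negbK; apply: ltW; near: s; exact: lt_nbhsr.
have EA : (fun t => vfield (B' t) 1 (A' t) (B' t)) =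
    glue T (fun t => vfield (B t) 1 (A t) (B t)) (fun t => vfield (B2 t) 1 (A2 t) (B2 t)).
  by apply/funext => t; rewrite /A' /B' /glue; case: ifP.
have EB : (fun t => vfield (A' t) 2^-1 (B' t) (B' t)) =
    glue T (fun t => vfield (A t) 2^-1 (B t) (B t)) (fun t => vfield (A2 t) 2^-1 (B2 t) (B2 t)).
  by apply/funext => t; rewrite /A' /B' /glue; case: ifP.
have wne s : 0 < s < T + d -> s != T ->
    weakd A' (fun t => vfield (B' t) 1 (A' t) (B' t)) s /\
    weakd B' (fun t => vfield (A' t) 2^-1 (B' t) (B' t)) s.
  move=> /andP[s0 sTd]; rewrite neq_lt => /orP[sT|Ts].
    have [w1 w2] := wd s ltac:(by rewrite s0).
    by rewrite EA EB; split; apply: wdl => //; rewrite /glue sT.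
  have [w1 w2] := wd2 s ltac:(by rewrite Ts).
  by rewrite EA EB; split; apply: wdr => //; rewrite /glue ltNge (ltW Ts).
(* at T, strong differentiability follows from the equation on both sides *)
split=> // t tI0; have [->|tT] := eqVneq t T; last exact: wne.
have TI : 0 < T < T + d by rewrite Td (lt_trans t00).
have TI' : 0 <= T < T + d by rewrite Td (ltW (lt_trans t00 t0T)).
have [WAT _] := cA' T TI'; have [WBT _] := cB' T TI'.
have [WFA _] := cFA T TI'; have [WFB _] := cFB T TI'.
split; apply: (Wderiv_weakd q0) => //.
  by apply: (weakd_Wderiv q0 cA' cFA) => // s sI sT; have [] := wne s sI sT.
by apply: (weakd_Wderiv q0 cB' cFB) => // s sI sT; have [] := wne s sI sT.
Unshelve. all: by end_near. Qed.

Lemma derive1_ihat q h x : 3 / 4 < q -> W q h -> derive1 (ihat h) x = ihat (dmul h) x.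
Proof.
move=> q34 Wh; have q12 : 2^-1 <= q by lra.
have [L1h _] := W_L12 q12 Wh; have [L1d _] := dmul_L12 q34 Wh.
by rewrite derive1E; case: (is_derive_ihat x L1h L1d).
Qed.

Lemma slope_inf q h (b : R) : 3 / 4 < q -> W q h ->
  (b%:E <= ereal_inf (range (fun x => (derive1 (ihat h) x)%:E)))%E <->
  forall x, b <= ihat (dmul h) x.
Proof.
move=> q34 Wh; split=> [H x|H].
  rewrite -lee_fin -(derive1_ihat x q34 Wh); apply: le_trans H _.
  by apply: ereal_inf_lbound; exists x.
by apply: le_ereal_inf_tmp => _ [x _ <-]; rewrite lee_fin (derive1_ihat x q34 Wh).
Qed.

Lemma blowup_criterion s (u0 : (R -> R) * (R -> R)) T u : 3 / 2 < s -> 0 < T ->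
  is_solution s T u0 u ->
  blows_up_at s T u0 u <->
  limf_einf (fun t => ereal_inf (range (fun x => (derive1 (u t).2 x)%:E))) T^'- = -oo%E.
Proof.
move=> s32 T0 [cu wu u01 u02].
have q34 : 3 / 4 < s / 2 by lra.
have q12 : 2^-1 <= s / 2 by lra.
have [A [B [cA cB Eu]]] := continuous_in_Xs_hat s32 cu.
have wd := iffLR (weak_system_transfer q12 cA cB Eu) wu.
rewrite limf_einfE; set f := fun t => ereal_inf _.
split=> [blow|Einf [T' [u' [TT' [cu' wu' _ _] Euu']]]].
  (* otherwise the solution continues past T *)
  apply/eqP; rewrite -leeNy_eq; apply: ub_ereal_sup => _ [V VT <-].
  rewrite leNgt; apply/negP => Vinf; apply: blow.
  have [b Hb] : exists b : R, (b%:E <= ereal_inf (f @` V))%E.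
    move: Vinf; case: (ereal_inf _) => [b _|_|]; last by rewrite ltxx.
    - by exists b.
    - by exists 0; rewrite leey.
  have [r r0 Hr] : exists2 r, 0 < r & forall t, T - r < t < T -> V t.
    move: VT => /nbhs_ballP[r r0 Hr]; exists r => // t /andP[t1 t2].
    apply: Hr => //; rewrite /ball/= gtr0_norm ?subr_gt0//; lra.
  pose t0 := T - Num.min (r / 2) (T / 2).
  have t0I : 0 < t0 < T.
    rewrite /t0 subr_gt0 gtrBl lt_min; apply/and3P; split; [|lra|lra].
    by rewrite gt_min; apply/orP; right; lra.
  have t0r : T - r < t0.
    by rewrite /t0 ltrD2l ltrN2 gt_min; apply/orP; left; lra.
  have HM t : t0 <= t < T -> forall x, - `|b| <= ihat (dmul (B t)) x.
    move=> /andP[t1 t2] x; have /andP[t00 _] := t0I.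
    have tI : 0 <= t < T by rewrite t2 (le_trans (ltW t00)).
    apply: (@le_trans _ _ b); first by rewrite lerNl -normrN ler_norm.
    have [WBt _] := cB t tI; move: x; apply/(slope_inf b q34 WBt).
    have <- : f t = ereal_inf (range (fun x => (derive1 (ihat (B t)) x)%:E)) by rewrite /f (Eu t tI).
    apply: le_trans Hb _; apply: ereal_inf_lbound.
    by exists t => //; apply: Hr; rewrite t2 (lt_le_trans t0r).
  have hAB : hsol (s / 2) 0 T A B by split.
  have [d d0 [A' [B' [[cA' cB' wd'] EAB]]]] := hsol_extend q34 hAB t0I (normr_ge0 b) HM.
  pose u' t := if t < T then u t else (ihat (A' t), ihat (B' t)).
  have Eu' : represents u' A' B' 0 (T + d).
    move=> t /andP[t1 t2]; rewrite /u'; case: ltrP => tT //.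
    by have [-> ->] := EAB t tT; rewrite (Eu t)// t1.
  exists (T + d), u'; split; first by rewrite ltrDl.
    split; first exact: continuous_in_Xs_ihat cA' cB' Eu'.
    - exact/(weak_system_transfer q12 cA' cB' Eu').
    - by rewrite /u' T0.
    - by rewrite /u' T0.
  by move=> t /andP[_ tT]; rewrite /u' tT.
(* a solution that continues past T has bounded slope near T *)
have [A' [B' [_ cB' Eu']]] := continuous_in_Xs_hat s32 cu'.
have TI : 0 <= T < T' by rewrite (ltW T0).
have [WT /(_ 1 ltr01)[r r0 Hr]] := cB' T TI.
pose K := nW (s / 2) (B' T) + 1.
pose M := pi^-1 * (K3 (s / 2) * K).
suff : ((- M)%:E <= -oo :> \bar R)%E by [].
rewrite -Einf; apply: (@le_trans _ _ (ereal_inf (f @` [set t | T - Num.min r T < t < T]))).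
  apply: le_ereal_inf_tmp => _ [t /andP[t1 t2] <-].
  have t0 : 0 <= t.
    apply: le_trans (ltW t1); rewrite subr_ge0 ge_min; apply/orP; right; exact: lexx.
  have tI : 0 <= t < T by rewrite t0.
  have tI' : 0 <= t < T' by rewrite t0 (lt_trans t2).
  have [Wt _] := cB' t tI'; rewrite /f -(Euu' t tI) (Eu' t tI').
  apply/(slope_inf _ q34 Wt) => x.
  have [Ld Bd] := W_L1_dmul q34 Wt.
  apply: le_trans (_ : - `|ihat (dmul (B' t)) x| <= _); last by rewrite lerNl -normrN ler_norm.
  rewrite lerN2; apply: le_trans (ihat_norm x Ld) _.
  rewrite ler_wpM2l ?invr_ge0 ?pi_ge0//; apply: le_trans Bd _.
  rewrite ler_wpM2l ?n2_ge0//.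
  have Hrt : nW (s / 2) (fun x => B' t x - B' T x) <= 1.
    apply: Hr => //; rewrite distrC gtr0_norm ?subr_gt0//.
    have : Num.min r T <= r by rewrite ge_min lexx.
    lra.
  rewrite (@eq_nW _ _ (fun x => B' T x + (B' t x - B' T x))); last by move=> y; rewrite addrC subrK.
  by apply: le_trans (nWD WT (WB Wt WT)) _; rewrite lerD2l.
apply: ereal_sup_ubound; exists [set t | T - Num.min r T < t < T] => //.
near=> t; apply/andP; split; near: t; last exact: nbhs_left_lt.
by apply: nbhs_left_gt; rewrite gtrBl lt_min r0.
Unshelve. all: by end_near. Qed.

End Integration.

Unset Implicit Arguments.

Theorem theorem5p1 (R : realType) (s : R) (hs : 3 / 2 < s)
    (u0 : (R -> R) * (R -> R)) (hu0 : Xs s u0)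
    (T : R) (hT : 0 < T)
    (u : R -> (R -> R) * (R -> R)) (hu : is_solution s T u0 u) :
  blows_up_at s T u0 u <->
  limf_einf (fun t => ereal_inf (range (fun x => (derive1 (u t).2 x)%:E))) T^'-
    = -oo%E.
Proof. exact: blowup_criterion hs hT hu. Qed.
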